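(* There is an absolute constant $C>0$ such that for every squarefree integer $q\ge 16$, every primitive Dirichlet character $\chi \pmod q$, and every real $x\ge 1$, $$ \left| S_\chi(x) \right| \le C\, \sqrt{q} \, (\log q) \left( \frac{(\log \log \log q)^2}{\log \log q} + \frac{(\log \log \log q)^2 \log \mathcal{P}(q)}{\log q} \right)^{1/4}. $$
   Context: For a Dirichlet character $\chi$ and real $x$, $S_\chi(x) := \sum_{n\le x}\chi(n)$, the sum being over positive integers $n\le x$. $\mathcal{P}(n)$ denotes the largest prime factor of $n$. *)

(* Defs.v *)
From HB Require Import structures.
From mathcomp Require Import all_boot all_order all_algebra.
From mathcomp Require Import complex.
From mathcomp Require Import reals exp.

Set Implicit Arguments.
Unset Strict Implicit.
Unset Printing Implicit Defensive.

Import Order.TTheory GRing.Theory Num.Theory.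

Local Open Scope ring_scope.
Local Open Scope complex_scope.

Definition squarefree (n : nat) : Prop :=
  forall d : nat, (1 < d)%N -> ~~ (d ^ 2 %| n)%N.

(* A Dirichlet character modulo q is represented by its extension by zero to
   the integers; chi 1 = 1 follows from dchar_mul and dchar_eq0. *)
Record dirichlet_char (R : realType) (q : nat) (chi : int -> R[i]) : Prop :=
  DirichletChar {
    dchar_periodic : forall n : int, chi (n + q%:Z) = chi n;
    dchar_mul : forall m n : int, chi (m * n) = chi m * chi n;
    dchar_eq0 : forall n : int, (chi n == 0) = ~~ coprimez n q%:Z }.

Definition induced_by (R : realType) (q : nat) (chi psi : int -> R[i]) : Prop :=
  forall n : int, coprimez n q%:Z -> chi n = psi n.

(* The modulus d = 1, whose only character is the constant 1, is allowed, so
   that the principal character modulo q > 1 is not primitive. *)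
Definition primitive_char (R : realType) (q : nat) (chi : int -> R[i]) : Prop :=
  dirichlet_char q chi /\
  forall (d : nat) (psi : int -> R[i]),
    (d %| q)%N -> (d < q)%N -> dirichlet_char d psi -> ~ induced_by q chi psi.

Definition char_sum (R : realType) (chi : int -> R[i]) (x : R) : R[i] :=
  \sum_(1 <= n < (Num.truncn x).+1) chi n%:Z.

(* Main.v *)
(* The Fourier expansion of the interval, cut at N, bounds S_chi(x) by sqrt(q) (log N + O(1)) as soon
   as the sums of chi(n) z^n, |z| = 1, over blocks of length N save a factor log q.  Since q is
   squarefree with prime factors at most P, one writes q = q_1 ... q_m u with q_i <= q^(1/m) P;
   shifting n successively by multiples of q_1, ..., q_m and applying Cauchy-Schwarz removes z and
   the characters modulo the q_i, and leaves a complete average modulo u of products of chi_u over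
   m-dimensional cubes, which factors over the primes p dividing u.  No Weil bound is needed: each
   factor saves p^(-2^(-O(m^2))), by a moment computation over polynomials when p is large, and by
   showing that characters are not close to polynomial phases otherwise.  As m may be taken of
   order (log log q)^(1/2), this gives log N / log q << (log log q)^(-1/2) + log P / log q, which is
   more than the fourth root requires. *)

Require Import Defs.
From HB Require Import structures.
From mathcomp Require Import all_boot all_order all_algebra.
From mathcomp Require Import cyclic complex.
From mathcomp Require Import boolp reals topology normedtype sequences derive exp trigo.
From mathcomp Require Import ring lra zify.

Set Implicit Arguments.
Unset Strict Implicit.
Unset Printing Implicit Defensive.

Import Order.TTheory GRing.Theory Num.Theory.
Import numFieldNormedType.Exports.

Local Open Scope ring_scope.
Local Open Scope complex_scope.

(** * Norms and averages *)

Section ComplexNorm.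
Variable R : rcfType.
Implicit Types (z w : R[i]).

(** The parameters obey one trade-off. After [m] differencings, saving a factor [L], about log q,
    means saving [L] to the power 2^m, while the average modulo u saves only u^(-1/K) with K =
    2^(3(m+6)^2); so u must be about (2 L^(2^m))^K. Up to powers of P, u^2 should not exceed
    q^(1/m), for then u costs no more than one of the q_i: this is what limits m to the square root
    of log log q. The exponent K is the same for all primes dividing u, so the savings 1/p multiply
    to 1/u. It is 2^(O(m^2)) because each of the m changes of dimension loses a factor 2^(O(m)).
    Primes below 2^(2(m+6)^2) are kept out of u: for them, cubes with a vertex where the character
    vanishes are too frequent compared with the saving. In a squarefree q these primes multiply to a
    negligible factor. The block length is a multiple of u, so that the last average is complete,
    and it contains one more factor u, so that the boundary terms created by shifting are small. *)

Definition nrm z : R := complex.Re `|z|.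

Lemma nrmE z : `|z| = (nrm z)%:C.
Proof. by rewrite /nrm RRe_real // normr_real. Qed.

Lemma nrm_ge0 z : 0 <= nrm z.
Proof. by rewrite -ler0c -nrmE. Qed.

Lemma nrm0 : nrm 0 = 0.
Proof. by rewrite /nrm normr0. Qed.

Lemma nrm1 : nrm 1 = 1.
Proof. by rewrite /nrm normr1. Qed.

Lemma nrmM z w : nrm (z * w) = nrm z * nrm w.
Proof. by apply: complexI; rewrite rmorphM /= -!nrmE normrM. Qed.

Lemma nrmX z n : nrm (z ^+ n) = nrm z ^+ n.
Proof. by elim: n => [|n IH]; rewrite ?expr0 ?nrm1 // !exprS nrmM IH. Qed.

Lemma nrmN z : nrm (- z) = nrm z.
Proof. by rewrite /nrm normrN. Qed.

Lemma nrmB z w : nrm (z - w) = nrm (w - z).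
Proof. by rewrite /nrm distrC. Qed.

Lemma nrmV z : nrm z^-1 = (nrm z)^-1.
Proof. by apply: complexI; rewrite fmorphV /= -!nrmE normfV. Qed.

Lemma nrmJ z : nrm z^* = nrm z.
Proof. by rewrite /nrm normcJ. Qed.

Lemma ler_nrmD z w : nrm (z + w) <= nrm z + nrm w.
Proof. by rewrite -lecR rmorphD /= -!nrmE ler_normD. Qed.

Lemma ler_nrmB z w : nrm (z - w) <= nrm z + nrm w.
Proof. by rewrite -[nrm w]nrmN ler_nrmD. Qed.

Lemma ler_nrmDB x z w : nrm (z - w) <= nrm (z - x) + nrm (x - w).
Proof. by have := ler_nrmD (z - x) (x - w); rewrite addrA subrK. Qed.

Lemma nrm_real (x : R) : 0 <= x -> nrm x%:C = x.
Proof. by move=> x0; apply: complexI; rewrite -nrmE ger0_norm // ler0c. Qed.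

Lemma nrm_nat n : nrm n%:R = n%:R.
Proof. by rewrite -[n%:R](rmorph_nat (real_complex R)) nrm_real. Qed.

Lemma nrm_eq0 z : (nrm z == 0) = (z == 0).
Proof. by rewrite -(inj_eq (@complexI R)) -nrmE normr_eq0. Qed.

Lemma ler_nrm_sum (I : Type) (r : seq I) (P : pred I) (F : I -> R[i]) :
  nrm (\sum_(i <- r | P i) F i) <= \sum_(i <- r | P i) nrm (F i).
Proof.
elim/big_rec2: _ => [|i y x _ le]; first by rewrite nrm0.
by apply: le_trans (ler_nrmD _ _) _; rewrite lerD2l.
Qed.

Lemma mulcJ z : z * z^* = (nrm z ^+ 2)%:C.
Proof. by rewrite -sqr_normc nrmE rmorphXn. Qed.

Lemma nrm_sqr z : nrm z ^+ 2 = complex.Re (z * z^*).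
Proof. by rewrite mulcJ. Qed.

Lemma Re_le_nrm z : complex.Re z <= nrm z.
Proof.
rewrite -lecR -nrmE; apply: le_trans (normc_ge_Re z).
by rewrite lecR ler_norm.
Qed.

Lemma Re_sum (I : Type) (r : seq I) (P : pred I) (F : I -> R[i]) :
  complex.Re (\sum_(i <- r | P i) F i) = \sum_(i <- r | P i) complex.Re (F i).
Proof. by apply: (big_morph (@complex.Re R)) => // -[a b] [c d]. Qed.

Lemma nrm_sub1X z w n : nrm z <= 1 -> nrm w <= 1 ->
  nrm (z ^+ n - w ^+ n) <= n%:R * nrm (z - w).
Proof.
move=> z1 w1; rewrite subrXX nrmM mulrC ler_wpM2r ?nrm_ge0 //.
apply: le_trans (ler_nrm_sum _ _ _) _.
rewrite -[X in _ <= X%:R]card_ord -sumr_const ler_sum // => i _.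
by rewrite nrmM !nrmX mulr_ile1 ?exprn_ge0 ?exprn_ile1 ?nrm_ge0.
Qed.

Lemma nrm_subM z1 z2 w1 w2 : nrm z1 <= 1 -> nrm w2 <= 1 ->
  nrm (z1 * z2 - w1 * w2) <= nrm (z1 - w1) + nrm (z2 - w2).
Proof.
move=> h1 h2; have -> : z1 * z2 - w1 * w2 = (z1 - w1) * w2 + z1 * (z2 - w2) by ring.
apply: le_trans (ler_nrmD _ _) _; rewrite !nrmM.
by rewrite lerD // ?ler_piMr ?ler_piMl ?nrm_ge0.
Qed.

Lemma cauchy_schwarz_nrm (I : finType) (F : I -> R[i]) :
  nrm (\sum_i F i) ^+ 2 <= #|I|%:R * \sum_i nrm (F i) ^+ 2.
Proof.
have le: nrm (\sum_i F i) ^+ 2 <= (\sum_i nrm (F i)) ^+ 2.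
  by rewrite lerXn2r ?nnegrE ?nrm_ge0 ?sumr_ge0 ?ler_nrm_sum // => i _; apply: nrm_ge0.
apply: le_trans le _; rewrite expr2 big_distrlr /=.
have -> : #|I|%:R * \sum_i nrm (F i) ^+ 2
   = \sum_i \sum_j (2^-1 * (nrm (F i) ^+ 2 + nrm (F j) ^+ 2)).
  under [RHS]eq_bigr do rewrite -mulr_sumr big_split sumr_const /=.
  rewrite -mulr_sumr big_split /= sumr_const sumrMnl.
  by move: (\sum_i _) => x; rewrite -[x *+ _]mulr_natl; move: (_ * x) => y; lra.
apply: ler_sum => i _; apply: ler_sum => j _.
by have := sqr_ge0 (nrm (F i) - nrm (F j)); rewrite !expr2; lra.
Qed.

(** Jensen's inequality for t^(2^m), by iterating Cauchy-Schwarz. It moves the powers required by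
    the remaining differencings inside the average over shifts. *)
Lemma power_mean2 (I : finType) (F : I -> R) m : (0 < #|I|)%N -> (forall i, 0 <= F i) ->
  ((\sum_i F i) / #|I|%:R) ^+ (2 ^ m) <= (\sum_i F i ^+ (2 ^ m)) / #|I|%:R.
Proof.
move=> I0; elim: m F => [|m IH] F F0; first by rewrite expr1.
have cI : 0 < #|I|%:R :> R by rewrite ltr0n.
have S0 (G : I -> R) : (forall i, 0 <= G i) -> 0 <= (\sum_i G i) / #|I|%:R.
  by move=> G0; rewrite divr_ge0 ?ler0n ?sumr_ge0.
rewrite expnS mulnC exprM; apply: le_trans (_ : ((\sum_i F i ^+ (2 ^ m)) / #|I|%:R) ^+ 2 <= _).
  by rewrite lerXn2r ?nnegrE ?IH ?exprn_ge0 ?S0 // => i; rewrite exprn_ge0.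
have := cauchy_schwarz_nrm (fun i => (F i ^+ (2 ^ m))%:C).
rewrite -(big_morph (real_complex R) (rmorphD _) (rmorph0 _)) nrm_real; last first.
  by rewrite sumr_ge0 // => i _; rewrite exprn_ge0.
under [X in _ <= _ * X]eq_bigr do rewrite nrm_real ?exprn_ge0 // -exprM.
move=> le; rewrite expr_div_n ler_pdivrMr ?exprn_gt0 //; apply: le_trans le _.
by rewrite expr2 mulrA divfK ?gt_eqF // mulrC.
Qed.

End ComplexNorm.

(** * Sums of periodic functions over the integers *)

Definition mod_periodic (V : Type) (u : nat) (f : int -> V) := forall n, f (n + u%:Z) = f n.

Section PeriodicSums.
Variable V : nmodType.
Implicit Types (f g : int -> V) (u : nat).

Lemma periodicM (T : Type) u (f : int -> T) n k : mod_periodic u f -> f (n + u%:Z * k) = f n.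
Proof.
move=> pf; have nat_case j m : f (m + u%:Z * j%:Z) = f m.
  elim: j m => [|j IH] m; first by rewrite mulr0 addr0.
  by rewrite intS mulrDr mulr1 addrA IH pf.
by case: k => k; rewrite ?NegzE ?mulrN // -(nat_case k.+1 (n - _)) subrK.
Qed.

Lemma periodic_eqmod (T : Type) u (f : int -> T) n m :
  mod_periodic u f -> (n = m %[mod u%:Z])%Z -> f n = f m.
Proof.
move=> pf e; rewrite (divz_eq n u%:Z) (divz_eq m u%:Z) e.
by rewrite ![_ * u%:Z]mulrC ![_ + (m %% _)%Z]addrC !periodicM.
Qed.

Lemma sum_periodic_affine u f (a b : int) : (0 < u)%N -> mod_periodic u f -> coprimez a u%:Z ->
  \sum_(h < u) f (a * h%:Z + b) = \sum_(h < u) f h%:Z.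
Proof.
move=> u0 pf ca.
have uZ : u%:Z != 0 by rewrite -lt0n.
have lt (h : 'I_u) : (`|((a * h%:Z + b) %% u%:Z)%Z|%N < u)%N.
  by rewrite -ltz_nat gez0_abs ?modz_ge0 // ltz_pmod.
pose s h := Ordinal (lt h).
have sE h : (s h)%:Z = ((a * h%:Z + b) %% u%:Z)%Z by rewrite /= gez0_abs ?modz_ge0.
have inj : injective s.
  move=> h1 h2 /(congr1 (fun x : 'I_u => x%:Z)); rewrite !sE => /eqP.
  rewrite eqz_mod_dvd opprD addrACA subrr addr0 -mulrBr Gauss_dvdzr 1?coprimez_sym // => d.
  apply: val_inj => /=.
  move: d; rewrite -eqz_mod_dvd !modz_small ?lez_nat ?ltz_nat ?ltn_ord // => /eqP [].
  by [].
rewrite [RHS](reindex_inj inj); apply: eq_bigr => h _.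
by rewrite sE; apply: periodic_eqmod pf _; rewrite modz_mod.
Qed.

Lemma sum_periodic_shift u f b : mod_periodic u f ->
  \sum_(h < u) f (b + h%:Z) = \sum_(h < u) f h%:Z.
Proof.
move=> pf; case: u pf => [|u] pf; first by rewrite !big_ord0.
rewrite -(@sum_periodic_affine _ f 1 b) ?coprimezE ?coprime1n //.
by apply: eq_bigr => h _; rewrite mul1r addrC.
Qed.

Lemma sum_periodic_mul u k f t : mod_periodic u f ->
  \sum_(n < u * k) f (t + n%:Z) = (\sum_(n < u) f n%:Z) *+ k.
Proof.
move=> pf; elim: k t => [|k IH] t; first by rewrite muln0 big_ord0.
rewrite mulnS big_split_ord /= sum_periodic_shift // mulrS; congr (_ + _).
by rewrite -(IH (t + u%:Z)); apply: eq_bigr => i _; rewrite PoszD addrA.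
Qed.

End PeriodicSums.

(** Write n = x + u y: the residue modulo u is x, and for fixed x the residue modulo v runs through
    all classes because u is a unit there. *)
Lemma sum_periodic_crt (R : pzSemiRingType) (u v : nat) (f g : int -> R) :
  (0 < u)%N -> (0 < v)%N -> coprime u v -> mod_periodic u f -> mod_periodic v g ->
  \sum_(n < u * v) f n%:Z * g n%:Z = (\sum_(n < u) f n%:Z) * (\sum_(n < v) g n%:Z).
Proof.
move=> u0 v0 cuv pf pg.
have lt (x : 'I_u * 'I_v) : (x.1 + u * x.2 < u * v)%N.
  case: x => x y /=; have := ltn_ord x; have := ltn_ord y; nia.
pose s x := Ordinal (lt x).
have inj : injective s.
  move=> [x1 y1] [x2 y2] /(congr1 val) /= e.
  have e1 : x1 = x2 :> nat.
    by have := congr1 (modn^~ u) e; rewrite ![(_ + u * _)%N]addnC !(mulnC u) !modnMDl !modn_small.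
  have e2 : y1 = y2 :> nat by move: e; rewrite e1 => /addnI /eqP; rewrite eqn_pmul2l // => /eqP.
  by congr (_, _); apply: val_inj.
have bij : bijective s by apply: inj_card_bij => //; rewrite card_prod !card_ord.
rewrite (reindex s) /=; last exact: onW_bij.
rewrite -(pair_bigA _ (fun (x : 'I_u) (y : 'I_v) => f (x + u * y)%N%:Z * g (x + u * y)%N%:Z)) /= big_distrl /=.
apply: eq_bigr => x _.
rewrite -(@sum_periodic_affine _ v g u%:Z x%:Z) // ?coprimezE ?absz_nat // mulr_sumr.
apply: eq_bigr => y _; rewrite PoszD PoszM periodicM //; congr (_ * g _); lia.
Qed.

(** * Gowers-type averages modulo u *)

Section GowersIntegers.
Variable R : rcfType.
Implicit Types (f g w : int -> R[i]) (u : nat).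

Definition mder (h : int) f := fun n => f (n + h) * (f n)^*.

(* The U^(m+1)-type average modulo u, except that the innermost mean enters through its absolute
   value and not its square. *)
Fixpoint gowers m f u : R :=
  if m is m'.+1 then (\sum_(h < u) gowers m' (mder h%:Z f) u) / u%:R
  else nrm (\sum_(n < u) f n%:Z) / u%:R.

Lemma gowers_ge0 m f u : 0 <= gowers m f u.
Proof.
elim: m f => [|m IH] f /=; first by rewrite divr_ge0 ?nrm_ge0.
by rewrite divr_ge0 ?sumr_ge0.
Qed.

Lemma mder_le1 h f : (forall n, nrm (f n) <= 1) -> forall n, nrm (mder h f n) <= 1.
Proof. by move=> le n; rewrite nrmM nrmJ mulr_ile1 ?nrm_ge0. Qed.

Lemma mder_periodic h u f : mod_periodic u f -> mod_periodic u (mder h f).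
Proof. by move=> pf n; rewrite /mder addrAC !pf. Qed.

Lemma mderM h f g : mder h (fun n => f n * g n) = fun n => mder h f n * mder h g n.
Proof. by apply: funext => n; rewrite /mder rmorphM mulrACA. Qed.

Lemma periodic_gowers_mder m u f : mod_periodic u f -> mod_periodic u (fun h => gowers m (mder h f) u).
Proof. by move=> pf h; congr gowers; apply: funext => n; rewrite /mder addrA pf. Qed.

Lemma gowers_le1 m f u : (forall n, nrm (f n) <= 1) -> gowers m f u <= 1.
Proof.
case: u => [|u].
  by move=> _; case: m => [|m] /=; rewrite big_ord0 ?nrm0 mul0r ler01.
elim: m f => [|m IH] f le /=; rewrite ler_pdivrMr ?ltr0Sn // mul1r.
  apply: le_trans (ler_nrm_sum _ _ _) _.
  by apply: le_trans (ler_sum _ (fun i _ => le _)) _; rewrite sumr_const card_ord.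
apply: (@le_trans _ _ (\sum_(h < u.+1) 1)); last by rewrite sumr_const card_ord.
by apply: ler_sum => h _; apply: IH; apply: mder_le1.
Qed.

(** The derivative of a product is the product of the derivatives, and its average depends on the
    shift only through the residue; so the Chinese remainder theorem separates one shift variable
    after the other, and finally the sum over n. This localizes the problem at the primes dividing
    u. *)
Lemma gowersM m (u v : nat) f g : (0 < u)%N -> (0 < v)%N -> coprime u v ->
  mod_periodic u f -> mod_periodic v g ->
  gowers m (fun n => f n * g n) (u * v) = gowers m f u * gowers m g v.
Proof.
move=> u0 v0 cuv; elim: m f g => [|m IH] f g pf pg /=.
  by rewrite (sum_periodic_crt u0 v0 cuv pf pg) nrmM natrM invfM mulrACA.
rewrite (eq_bigr (fun h : 'I__ => gowers m (mder h%:Z f) u * gowers m (mder h%:Z g) v)); last first.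
  by move=> h _; rewrite mderM IH //; exact: mder_periodic.
rewrite (sum_periodic_crt u0 v0 cuv (periodic_gowers_mder m pf) (periodic_gowers_mder m pg)).
by rewrite natrM invfM mulrACA.
Qed.

(** Shifts by multiples of [q] still run over all residues modulo [u]: this is why the factors to be
    removed must have moduli coprime to [u]. *)
Lemma sum_gowers_mder m u f (q a : int) : (0 < u)%N -> mod_periodic u f -> coprimez q u%:Z ->
  \sum_(h < u) gowers m (mder (q * (h%:Z - a)) f) u = u%:R * gowers m.+1 f u.
Proof.
move=> u0 pf cq; rewrite /= mulrCA mulfV ?mulr1 ?pnatr_eq0 -?lt0n //.
rewrite -(sum_periodic_affine (- (q * a)) u0 (periodic_gowers_mder m pf) cq).
by apply: eq_bigr => h _; rewrite mulrBr.
Qed.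

End GowersIntegers.

(** * The q-analogue of van der Corput differencing *)

Section VanDerCorput.
Variable R : rcfType.
Implicit Types (f g w e : int -> R[i]).

Lemma nrm_sum_shift f (t : int) (N j : nat) : (forall n, nrm (f n) <= 1) ->
  nrm (\sum_(n < N) f (t + n%:Z) - \sum_(n < N) f (t + n%:Z + j%:Z)) <= 2 * j%:R.
Proof.
move=> f1; elim: j => [|j IH].
  by under [X in _ - X]eq_bigr do rewrite addr0; rewrite subrr nrm0 mulr0.
apply: le_trans (ler_nrmDB (\sum_(n < N) f (t + n%:Z + j%:Z)) _ _) _.
rewrite -[j.+1]addn1 natrD mulrDr lerD // mulr1.
have -> : \sum_(n < N) f (t + n%:Z + j%:Z) - \sum_(n < N) f (t + n%:Z + (j + 1)%N%:Z)
    = f (t + j%:Z) - f (t + N%:Z + j%:Z).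
  rewrite -sumrB; under eq_bigr => n _.
    rewrite -opprB (_ : t + n%:Z + (j + 1)%N%:Z = t + n.+1%:Z + j%:Z); first over.
    by rewrite addn1 !intS; ring.
  rewrite sumrN -(big_mkord xpredT (fun n => f (t + n.+1%:Z + j%:Z) - f (t + n%:Z + j%:Z))).
  by rewrite telescope_sumr // opprB addr0.
by apply: le_trans (ler_nrmB _ _) _; rewrite -[2]/(1 + 1) lerD.
Qed.

(** Averaging over the shifts Q h with h < u leaves the Q-periodic [g] unchanged, so Cauchy-Schwarz
    in n discards it. Opening the square leaves correlations of [w] alone; the last term is the cost
    of moving a window of length N by at most Q u. *)
Lemma vdc_step (N Q u : nat) (t : int) g w : (0 < N)%N -> (0 < u)%N -> mod_periodic Q g ->
  (forall n, nrm (g n) <= 1) -> (forall n, nrm (w n) <= 1) ->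
  (nrm (\sum_(n < N) g (t + n%:Z) * w (t + n%:Z)) / N%:R) ^+ 2 <=
    (\sum_(h' < u) \sum_(h < u)
       nrm (\sum_(n < N) mder (Q%:Z * (h%:Z - h'%:Z)) w (t + Q%:Z * h'%:Z + n%:Z)) / N%:R)
     / (u%:R * u%:R) + 4 * (Q * u)%:R / N%:R.
Proof.
move=> N0 u0 pg g1 w1.
have NR : 0 < N%:R :> R by rewrite ltr0n.
have uR : 0 < u%:R :> R by rewrite ltr0n.
pose f n := g n * w n.
have f1 n : nrm (f n) <= 1 by rewrite nrmM mulr_ile1 ?nrm_ge0.
pose W n := \sum_(h < u) w (n + Q%:Z * h%:Z).
pose S := \sum_(n < N) f (t + n%:Z).
pose B := \sum_(n < N) g (t + n%:Z) * W (t + n%:Z).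
have SB : nrm (u%:R * S - B) <= 2 * (Q * u)%:R * u%:R.
  have -> : B = \sum_(h < u) \sum_(n < N) f (t + n%:Z + (Q * h)%N%:Z).
    rewrite exchange_big /=; apply: eq_bigr => n _; rewrite mulr_sumr.
    by apply: eq_bigr => h _; rewrite /f PoszM (periodicM _ _ pg).
  rewrite mulr_natl -[u in S *+ u]card_ord -sumr_const -sumrB.
  apply: le_trans (ler_nrm_sum _ _ _) _.
  apply: (@le_trans _ _ (\sum_(h < u) 2 * (Q * u)%:R)).
    apply: ler_sum => h _; apply: le_trans (nrm_sum_shift _ _ _ f1) _.
    by rewrite ler_wpM2l ?ler0n // ler_nat leq_mul2l (ltnW (ltn_ord h)) orbT.
  by rewrite sumr_const card_ord -[_ *+ u]mulr_natr.
set a := nrm S / N%:R.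
pose b := nrm B / (u%:R * N%:R).
have a0 : 0 <= a by rewrite divr_ge0 ?nrm_ge0 ?ltW.
have b0 : 0 <= b by rewrite divr_ge0 ?nrm_ge0 ?mulr_ge0 ?ltW.
have a1 : a <= 1.
  rewrite ler_pdivrMr // mul1r; apply: le_trans (ler_nrm_sum _ _ _) _.
  by apply: le_trans (ler_sum _ (fun i _ => f1 _)) _; rewrite sumr_const card_ord.
have W1 n : nrm (W n) <= u%:R.
  apply: le_trans (ler_nrm_sum _ _ _) _.
  by apply: le_trans (ler_sum _ (fun i _ => w1 _)) _; rewrite sumr_const card_ord.
have gW n : nrm (g n * W n) <= nrm (W n).
  by rewrite nrmM ler_piMl ?nrm_ge0.
have b1 : b <= 1.
  rewrite ler_pdivrMr ?mulr_gt0 // mul1r; apply: le_trans (ler_nrm_sum _ _ _) _.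
  apply: le_trans (ler_sum _ (fun i _ => le_trans (gW _) (W1 _))) _.
  by rewrite sumr_const card_ord mulr_natr.
set eps := 4 * (Q * u)%:R / N%:R.
have ab : a - b <= eps / 2.
  have : nrm (u%:R * S) - nrm B <= 2 * (Q * u)%:R * u%:R.
    apply: le_trans SB; rewrite lerBlDr; have := ler_nrmD (u%:R * S - B) B.
    by rewrite subrK.
  rewrite nrmM nrm_nat /a /b /eps => le.
  have -> : nrm S / N%:R - nrm B / (u%:R * N%:R) = (u%:R * nrm S - nrm B) / (u%:R * N%:R).
    by field; rewrite !gt_eqF.
  rewrite ler_pdivrMr ?mulr_gt0 //; apply: le_trans le _.
  by rewrite le_eqVlt; apply/orP; left; apply/eqP; field; rewrite gt_eqF.
have e0 : 0 <= eps by rewrite divr_ge0 ?mulr_ge0 ?ler0n.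
(* a^2 - b^2 = (a - b)(a + b), and a + b is at most 2. *)
have : a ^+ 2 <= b ^+ 2 + eps.
  move: (a) (b) (eps) a0 b0 a1 b1 ab e0 => x y z *; rewrite !expr2; nra.
move=> le; apply: le_trans le _; rewrite lerD2r.
have -> : b ^+ 2 = nrm B ^+ 2 / (u%:R * u%:R * N%:R ^+ 2).
  by rewrite /b; field; rewrite !gt_eqF.
have BW : nrm B ^+ 2 <= N%:R * \sum_(n < N) nrm (W (t + n%:Z)) ^+ 2.
  apply: le_trans (cauchy_schwarz_nrm _) _; rewrite card_ord ler_pM2l //.
  by apply: ler_sum => n _; rewrite lerXn2r ?nnegrE ?nrm_ge0.
have WW : \sum_(n < N) nrm (W (t + n%:Z)) ^+ 2 <= \sum_(h' < u) \sum_(h < u)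
       nrm (\sum_(n < N) mder (Q%:Z * (h%:Z - h'%:Z)) w (t + Q%:Z * h'%:Z + n%:Z)).
  have E : \sum_(n < N) W (t + n%:Z) * (W (t + n%:Z))^* = \sum_(h' < u) \sum_(h < u)
       \sum_(n < N) mder (Q%:Z * (h%:Z - h'%:Z)) w (t + Q%:Z * h'%:Z + n%:Z).
    under eq_bigr do rewrite /W rmorph_sum /= big_distrlr /=.
    rewrite exchange_big [RHS]exchange_big /=; apply: eq_bigr => h _.
    rewrite exchange_big /=; apply: eq_bigr => h' _; apply: eq_bigr => n _.
    by rewrite /mder; congr (w _ * (w _)^*); ring.
  under eq_bigr do rewrite nrm_sqr.
  rewrite -Re_sum E; apply: le_trans (Re_le_nrm _) _.
  apply: le_trans (ler_nrm_sum _ _ _) _; apply: ler_sum => h' _.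
  exact: ler_nrm_sum.
under [X in _ <= X / _]eq_bigr do rewrite -mulr_suml.
rewrite -mulr_suml ler_pdivrMr ?mulr_gt0 ?exprn_gt0 //.
apply: le_trans BW _; apply: le_trans (ler_wpM2l (ltW NR) WW) _.
rewrite le_eqVlt; apply/orP; left; apply/eqP.
move: (\sum_(h' < u) _) => z; field; by rewrite !gt_eqF.
Qed.

Definition bounded_factor (Q u : nat) (x : nat * (int -> R[i])) : Prop :=
  [/\ (x.1 <= Q)%N, coprime x.1 u, mod_periodic x.1 x.2 & forall n, nrm (x.2 n) <= 1].

Definition prod_factors (gs : seq (nat * (int -> R[i]))) n := \prod_(x <- gs) x.2 n.

(* Differencing turns such a twist into a constant: this is why additive characters cost nothing
   beyond the first step. *)
Definition phase_like e := (forall n, nrm (e n) <= 1) /\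
  (forall a, exists2 c, nrm c <= 1 & forall n, mder a e n = c).

Lemma ler_expB (x y d : R) K : 0 <= x <= 1 -> 0 <= y <= 1 -> 0 <= d -> x <= y + d ->
  x ^+ K <= y ^+ K + K%:R * d.
Proof.
move=> /andP[x0 x1] /andP[y0 y1] d0 le; have [xy|/ltW yx] := leP x y.
  apply: le_trans (_ : y ^+ K <= _); first by rewrite lerXn2r ?nnegrE.
  by rewrite lerDl mulr_ge0.
rewrite -lerBlDl subrXX mulrC ler_pM ?subr_ge0 ?lerBlDl //.
  by rewrite sumr_ge0 // => i _; rewrite mulr_ge0 ?exprn_ge0.
rewrite -[X in _ <= X%:R]card_ord -sumr_const ler_sum // => i _.
by rewrite mulr_ile1 ?exprn_ge0 ?exprn_ile1.
Qed.

(** There is one squaring per factor. The error is multiplied by the same power of 2, since on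
    [0, 1] raising to the power K enlarges an error at most K times. The start [t] is arbitrary
    because every differencing moves the window. *)
Definition vdc_bound (N Q u : nat) gs e := forall w t, mod_periodic u w -> (forall n, nrm (w n) <= 1) ->
  (nrm (\sum_(n < N) e (t + n%:Z) * prod_factors gs (t + n%:Z) * w (t + n%:Z)) / N%:R)
     ^+ (2 ^ size gs) <=
  gowers (size gs) w u + (2 ^ size gs)%:R * (4 * (Q * u)%:R / N%:R).

Lemma prod_factors_le1 Q u gs : List.Forall (bounded_factor Q u) gs ->
  forall n, nrm (prod_factors gs n) <= 1.
Proof.
move=> + n; elim=> [|x s [_ _ _ x1] _ IH]; first by rewrite /prod_factors big_nil nrm1.
by rewrite /prod_factors big_cons nrmM mulr_ile1 ?nrm_ge0.
Qed.

Definition der_factors (a : int) (gs : seq (nat * (int -> R[i]))) :=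
  [seq (x.1, mder a x.2) | x <- gs].

Lemma mder_prod_factors a gs n : mder a (prod_factors gs) n = prod_factors (der_factors a gs) n.
Proof.
elim: gs n => [|x s IH] n; first by rewrite /mder /prod_factors !big_nil rmorph1 mulr1.
have -> : prod_factors (x :: s) = fun k => x.2 k * prod_factors s k.
  by apply: funext => k; rewrite /prod_factors big_cons.
by rewrite mderM IH /prod_factors big_cons.
Qed.

Lemma der_factors_bounded Q u a gs : List.Forall (bounded_factor Q u) gs ->
  List.Forall (bounded_factor Q u) (der_factors a gs).
Proof.
elim=> [|x s [x1 x2 x3 x4] _ IH] /=; constructor=> //.
by split=> //=; [apply: mder_periodic | apply: mder_le1].
Qed.

(** One differencing removes [x] by periodicity and turns the phase [e] into a constant of modulus
    at most 1, which drops out of the absolute value. The other factors become their derivatives,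
    with the same moduli and bounds, so the induction hypothesis is needed only for the constant
    phase. *)
Lemma vdc_cons (N Q u k : nat) x gs e : N = (u * k)%N -> (0 < N)%N ->
  bounded_factor Q u x -> List.Forall (bounded_factor Q u) gs ->
  (forall a, vdc_bound N Q u (der_factors a gs) (fun=> 1)) ->
  phase_like e -> vdc_bound N Q u (x :: gs) e.
Proof.
move=> NE N0 [xQ cx px x1] bgs IH [e1 eP] w t pw w1.
have u0 : (0 < u)%N by move: N0; rewrite NE muln_gt0 => /andP[].
have NR : 0 < N%:R :> R by rewrite ltr0n.
have uR : 0 < u%:R :> R by rewrite ltr0n.
pose W n := e n * prod_factors gs n * w n.
have W1 n : nrm (W n) <= 1.
  by rewrite !nrmM !mulr_ile1 ?mulr_ge0 ?nrm_ge0 ?(prod_factors_le1 bgs).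
pose a (h' h : nat) : int := x.1%:Z * (h%:Z - h'%:Z).
pose X (h' h : nat) := nrm (\sum_(n < N) prod_factors (der_factors (a h' h) gs) (t + x.1%:Z * h'%:Z + n%:Z)
   * mder (a h' h) w (t + x.1%:Z * h'%:Z + n%:Z)) / N%:R.
set err := 4 * (Q * u)%:R / N%:R; have err0 : 0 <= err by rewrite divr_ge0 ?mulr_ge0 ?ler0n.
set m := size gs.
have X0 h' h : 0 <= X h' h by rewrite divr_ge0 ?nrm_ge0 ?ltW.
have X1 h' h : X h' h <= 1.
  rewrite ler_pdivrMr // mul1r; apply: le_trans (ler_nrm_sum _ _ _) _.
  apply: (@le_trans _ _ (\sum_(n < N) 1)); last by rewrite sumr_const card_ord.
  apply: ler_sum => n _; rewrite nrmM mulr_ile1 ?nrm_ge0 ?mder_le1 //.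
  exact: prod_factors_le1 (der_factors_bounded _ bgs) _.
have XV h' h : X h' h ^+ (2 ^ m) <= gowers m (mder (a h' h) w) u + (2 ^ m)%:R * err.
  have := IH (a h' h) (mder (a h' h) w) (t + x.1%:Z * h'%:Z) (mder_periodic _ pw) (mder_le1 _ w1).
  by rewrite size_map; under eq_bigr do rewrite mul1r.
set y := nrm _ / _.
have yE : y = nrm (\sum_(n < N) x.2 (t + n%:Z) * W (t + n%:Z)) / N%:R.
  rewrite /y; congr (nrm _ / _); apply: eq_bigr => n _.
  by rewrite /W /prod_factors big_cons; ring.
have y2 : y ^+ 2 <= (\sum_(h' < u) \sum_(h < u) X h' h) / (u%:R * u%:R) + err.
  rewrite yE; apply: le_trans (vdc_step t N0 u0 px x1 W1) _; rewrite lerD //; last first.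
    by rewrite ler_pM2r ?invr_gt0 // ler_wpM2l ?ler0n // ler_nat leq_mul2r xQ orbT.
  rewrite ler_pM2r ?invr_gt0 ?mulr_gt0 //; apply: ler_sum => h' _; apply: ler_sum => h _.
  rewrite /X ler_pM2r ?invr_gt0 //.
  have [c c1 cP] := eP (a h' h).
  have dW n : mder (a h' h) W n = c * (prod_factors (der_factors (a h' h) gs) n * mder (a h' h) w n).
    rewrite /W mderM (mderM _ e) cP mder_prod_factors; ring.
  under eq_bigr do rewrite dW.
  by rewrite -mulr_sumr nrmM ler_piMl ?nrm_ge0.
pose I := ('I_u * 'I_u)%type.
have cI : #|{: I}| = (u * u)%N by rewrite card_prod !card_ord.
pose XX (i : I) := X i.1 i.2.
have sXX : \sum_(h' < u) \sum_(h < u) X h' h = \sum_(i : I) XX i.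
  exact: (pair_bigA _ (fun h' h : 'I_u => X h' h)).
set A := _ / _ in y2.
have AE : A = (\sum_(i : I) XX i) / #|{: I}|%:R by rewrite /A sXX cI natrM.
have A01 : 0 <= A <= 1.
  rewrite AE; apply/andP; split.
    by rewrite divr_ge0 ?ler0n // sumr_ge0 // => i _; apply: X0.
  rewrite cI ler_pdivrMr ?ltr0n ?muln_gt0 ?u0 // mul1r.
  apply: (@le_trans _ _ (\sum_(i : I) 1)); first by apply: ler_sum => i _; apply: X1.
  by rewrite sumr_const cI.
have y01 : 0 <= y ^+ 2 <= 1.
  have y0 : 0 <= y by rewrite divr_ge0 ?nrm_ge0 ?ltW.
  rewrite exprn_ge0 // exprn_ile1 // yE ler_pdivrMr // mul1r; apply: le_trans (ler_nrm_sum _ _ _) _.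
  apply: (@le_trans _ _ (\sum_(n < N) 1)); last by rewrite sumr_const card_ord.
  by apply: ler_sum => n _; rewrite nrmM mulr_ile1 ?nrm_ge0.
rewrite [size _]/= expnS exprM; apply: le_trans (ler_expB (2 ^ m) y01 A01 err0 y2) _.
have AX : A ^+ (2 ^ m) <= gowers m.+1 w u + (2 ^ m)%:R * err.
  rewrite AE; apply: le_trans (power_mean2 m _ _) _.
  - by rewrite cI muln_gt0 u0.
  - by move=> i; apply: X0.
  rewrite ler_pdivrMr ?cI ?ltr0n ?muln_gt0 ?u0 //.
  apply: (@le_trans _ _ (\sum_(i : I) (gowers m (mder (a i.1 i.2) w) u + (2 ^ m)%:R * err))).
    by apply: ler_sum => i _; apply: XV.
  rewrite big_split /= sumr_const cI -(pair_bigA _ (fun h' h : 'I_u => gowers m (mder (a h' h) w) u)) /=.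
  under eq_bigr do rewrite sum_gowers_mder ?coprimezE ?absz_nat //.
  rewrite sumr_const card_ord.
  rewrite -/(gowers m.+1 w u).
  move: (gowers m.+1 w u) ((2 ^ m)%:R * err) => G E.
  by rewrite -[_ *+ (u * u)]mulr_natl -[(_ * G) *+ u]mulr_natl natrM mulrA -mulrDr mulrC.
apply: le_trans (lerD AX (lexx _)) _.
by rewrite -addrA -mulrDl -natrD addnn -mul2n -?expnS.
Qed.

Lemma phase_like1 : phase_like (fun=> 1).
Proof.
by split=> [n|a]; rewrite ?nrm1 //; exists 1; rewrite ?nrm1 // => n; rewrite /mder rmorph1 mulr1.
Qed.

Lemma vdc_iter1 (N Q u k : nat) gs : N = (u * k)%N -> (0 < N)%N ->
  List.Forall (bounded_factor Q u) gs -> vdc_bound N Q u gs (fun=> 1).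
Proof.
move=> NE N0; have [m le] := ubnP (size gs); elim: m gs le => // m IH [|x gs] /=.
  (* With no factor left, the window consists of [k] complete periods of [w]. *)
  move=> _ _ w t pw w1; rewrite expn0 expr1 mul1r.
  under eq_bigr do rewrite /prod_factors big_nil !mul1r.
  rewrite NE sum_periodic_mul // -[_ *+ k]mulr_natl nrmM nrm_nat natrM invfM.
  have k0 : (0 < k)%N by move: N0; rewrite NE muln_gt0 => /andP[].
  rewrite [gowers _ _ _]/=; set G := nrm _.
  have -> : k%:R * G * (u%:R^-1 / k%:R) = G / u%:R.
    by rewrite [k%:R * G]mulrC mulrACA mulfV ?mulr1 ?pnatr_eq0 -?lt0n.
  by rewrite lerDl ?mulr_ge0 ?invr_ge0.
move=> lt bf; inversion bf as [|y s bx bgs]; subst.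
apply: (@vdc_cons _ _ _ k) => //; last exact: phase_like1.
by move=> a; apply: IH; [rewrite size_map | apply: der_factors_bounded].
Qed.

Lemma vdc_iter (N Q u k : nat) gs e : N = (u * k)%N -> (0 < N)%N -> (0 < size gs)%N ->
  List.Forall (bounded_factor Q u) gs -> phase_like e -> vdc_bound N Q u gs e.
Proof.
case: gs => // x gs NE N0 _ bf; inversion bf as [|y s bx bgs]; subst.
apply: (@vdc_cons _ _ _ k) => // a; apply: (@vdc_iter1 _ _ _ k) => //.
exact: der_factors_bounded.
Qed.

End VanDerCorput.

(** * Cube averages over a finite field *)

Section SeqSums.
Variable F : finType.

(** The directions of a cube form a list, so that cubes and the sums over them unfold one direction
    at a time. *)
Fixpoint seqsum (V : nmodType) m (Phi : seq F -> V) : V :=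
  if m is m'.+1 then \sum_(h : F) seqsum m' (fun s => Phi (h :: s)) else Phi [::].

Lemma eq_seqsum (V : nmodType) m (Phi Psi : seq F -> V) :
  (forall s, size s = m -> Phi s = Psi s) -> seqsum m Phi = seqsum m Psi.
Proof.
elim: m Phi Psi => [|m IH] Phi Psi e /=; first exact: e.
by apply: eq_bigr => h _; apply: IH => s sm; apply: e; rewrite /= sm.
Qed.

Lemma seqsum_sum (V : nmodType) (I : Type) (r : seq I) (P : pred I) m (Phi : I -> seq F -> V) :
  seqsum m (fun s => \sum_(i <- r | P i) Phi i s) = \sum_(i <- r | P i) seqsum m (Phi i).
Proof.
elim: m Phi => //= m IH Phi.
by under eq_bigr do rewrite IH; rewrite exchange_big.
Qed.

Lemma seqsumD (V : nmodType) m (Phi Psi : seq F -> V) :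
  seqsum m (fun s => Phi s + Psi s) = seqsum m Phi + seqsum m Psi.
Proof. by elim: m Phi Psi => //= m IH Phi Psi; under eq_bigr do rewrite IH; rewrite big_split. Qed.

Lemma seqsum_const (V : nmodType) m (c : V) : seqsum m (fun=> c) = c *+ (#|F| ^ m).
Proof.
elim: m => //= m IH; under eq_bigr do rewrite IH.
by rewrite sumr_const -mulrnA -expnSr.
Qed.

Lemma seqsum_morph (V W : nmodType) (phi : V -> W) m (Phi : seq F -> V) :
  phi 0 = 0 -> {morph phi : x y / x + y} -> phi (seqsum m Phi) = seqsum m (phi \o Phi).
Proof.
move=> p0 pD; elim: m Phi => //= m IH Phi.
by rewrite (big_morph phi pD p0); apply: eq_bigr => h _; rewrite IH.
Qed.

Lemma seqsumMl (K : pzSemiRingType) m (c : K) (Phi : seq F -> K) :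
  seqsum m (fun s => c * Phi s) = c * seqsum m Phi.
Proof. by elim: m Phi => //= m IH Phi; under eq_bigr do rewrite IH; rewrite mulr_sumr. Qed.

Lemma ler_seqsum (K : numDomainType) m (Phi Psi : seq F -> K) :
  (forall s, size s = m -> Phi s <= Psi s) -> seqsum m Phi <= seqsum m Psi.
Proof.
elim: m Phi Psi => [|m IH] Phi Psi e /=; first exact: e.
by apply: ler_sum => h _; apply: IH => s sm; apply: e; rewrite /= sm.
Qed.

Lemma seqsum_ge0 (K : numDomainType) m (Phi : seq F -> K) :
  (forall s, size s = m -> 0 <= Phi s) -> 0 <= seqsum m Phi.
Proof.
move=> e; have := @ler_seqsum K m (fun=> 0) Phi e.
by rewrite seqsum_const mul0rn.
Qed.

Lemma seqsum_map (V : nmodType) m (b : F -> F) (Phi : seq F -> V) : injective b ->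
  seqsum m (fun s => Phi (map b s)) = seqsum m Phi.
Proof.
move=> inj; elim: m Phi => //= m IH Phi.
rewrite [RHS](reindex_inj inj); apply: eq_bigr => h _.
by rewrite (IH (fun s => Phi (b h :: s))).
Qed.

Lemma seqsum_power_mean (R : rcfType) m k (Phi : seq F -> R) : (0 < #|F|)%N ->
  (forall s, 0 <= Phi s) ->
  (seqsum m Phi / #|F|%:R ^+ m) ^+ (2 ^ k) <= seqsum m (fun s => Phi s ^+ (2 ^ k)) / #|F|%:R ^+ m.
Proof.
move=> F0; elim: m Phi => [|m IH] Phi P0 /=; first by rewrite expr0 !divr1.
have c0 : 0 < #|F|%:R :> R by rewrite ltr0n.
have e (G : F -> R) : (\sum_h G h) / #|F|%:R ^+ m.+1 = (\sum_h (G h / #|F|%:R ^+ m)) / #|F|%:R.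
  by rewrite -mulr_suml -mulrA -invfM -exprSr.
rewrite !e; apply: le_trans (power_mean2 k F0 _) _.
  by move=> h; rewrite divr_ge0 ?exprn_ge0 ?ler0n // seqsum_ge0.
by rewrite ler_pM2r ?invr_gt0 // ler_sum // => h _; apply: IH.
Qed.

End SeqSums.

Section CubeProducts.
Variables (R : rcfType) (F : finFieldType).
Implicit Types (f g : F -> R[i]) (x y h : F) (s : seq F).
Local Notation p := #|F|.

(** The iterated multiplicative derivative at [x] in the directions [s]: a product over the vertices
    of a cube, conjugated according to parity. *)
Fixpoint cube f x s : R[i] :=
  if s is h :: s' then cube f (x + h) s' * (cube f x s')^* else f x.

Lemma cubeM f g x s : cube (fun y => f y * g y) x s = cube f x s * cube g x s.
Proof. by elim: s x => //= h s IH x; rewrite !IH rmorphM mulrACA. Qed.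

Lemma cube1 x s : cube (fun=> 1) x s = 1.
Proof. by elim: s x => //= h s IH x; rewrite !IH rmorph1 mulr1. Qed.

Lemma cube_conj f x s : cube (fun y => (f y)^*) x s = (cube f x s)^*.
Proof. by elim: s x => //= h s IH x; rewrite !IH rmorphM. Qed.

Lemma cube_shift f h x s : cube (fun y => f (y + h)) x s = cube f (x + h) s.
Proof. by elim: s x => //= k s IH x; rewrite !IH addrAC. Qed.

Lemma cube_prod (I : Type) (r : seq I) (P : pred I) (f : I -> F -> R[i]) x s :
  cube (fun y => \prod_(i <- r | P i) f i y) x s = \prod_(i <- r | P i) cube (f i) x s.
Proof.
elim: r => [|i r IH]; first by rewrite big_nil -[RHS](cube1 x s); congr cube; apply: funext => y; rewrite big_nil.
rewrite big_cons -IH; case: ifP => Pi.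
  by rewrite -cubeM; congr cube; apply: funext => y; rewrite big_cons Pi.
by congr cube; apply: funext => y; rewrite big_cons Pi.
Qed.

Lemma cube_cons f x h s : cube f x (h :: s) = cube (fun y => f (y + h) * (f y)^*) x s.
Proof. by rewrite cubeM cube_shift cube_conj. Qed.

Lemma nrm_cube_le1 f x s : (forall y, nrm (f y) <= 1) -> nrm (cube f x s) <= 1.
Proof. by move=> f1; elim: s x => //= h s IH x; rewrite nrmM nrmJ mulr_ile1 ?nrm_ge0. Qed.

Definition gowersF m f : R := seqsum m (fun s => nrm (\sum_x cube f x s)) / p%:R ^+ m.+1.

Lemma gowersFS m f : gowersF m.+1 f = (\sum_h gowersF m (fun y => f (y + h) * (f y)^*)) / p%:R.
Proof.
rewrite /gowersF -mulr_suml -mulrA -invfM -exprSr; congr (_ / _).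
by apply: eq_bigr => h _; apply: eq_seqsum => s _; congr nrm; apply: eq_bigr => x _; apply: cube_cons.
Qed.

(** The sum over the first direction decouples x + h from x, so that for fixed remaining directions
    one gets the square of an absolute value. *)
Lemma cube_sum_ge0 m f : (0 < m)%N -> 0 <= \sum_x seqsum m (cube f x).
Proof.
case: m => // m _ /=.
rewrite exchange_big /=; under eq_bigr do rewrite -seqsum_sum.
rewrite -seqsum_sum; apply: seqsum_ge0 => s _.
rewrite exchange_big /=.
have -> : \sum_x \sum_h cube f (x + h) s * (cube f x s)^* = (\sum_y cube f y s) * (\sum_x cube f x s)^*.
  rewrite rmorph_sum mulrC mulr_suml; apply: eq_bigr => x _.
  rewrite mulrC mulr_suml [RHS](reindex_inj (addrI x)).
  by [].
exact: mulcJ_ge0.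
Qed.

(* The vertices of the cube based at x, without x itself. *)
Fixpoint cube_points x s : seq F :=
  if s is h :: s' then (x + h) :: cube_points (x + h) s' ++ cube_points x s' else [::].

Lemma size_cube_points x s : (size (cube_points x s)).+1 = (2 ^ size s)%N.
Proof.
elim: s x => //= h s IH x; rewrite size_cat -addSn -addnS !IH expnS; lia.
Qed.

Fixpoint cube_rest f x s : R[i] :=
  if s is h :: s' then cube f (x + h) s' * (cube_rest f x s')^* else 1.

Lemma cube_restE f x s : cube f x s = iter (size s) conjc (f x) * cube_rest f x s.
Proof.
elim: s x => [|h s IH] x /=; first by rewrite mulr1.
by rewrite (IH x) rmorphM mulrCA.
Qed.

Lemma eq_cube f g x s : f x = g x -> {in cube_points x s, f =1 g} -> cube f x s = cube g x s.
Proof.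
elim: s x => //= h s IH x e H.
rewrite (IH (x + h)) ?(IH x) // => [y yi||y yi]; apply: H; rewrite inE ?eqxx // mem_cat yi ?orbT //.
Qed.

Lemma eq_cube_rest f g x s : {in cube_points x s, f =1 g} -> cube_rest f x s = cube_rest g x s.
Proof.
elim: s x => //= h s IH x H.
rewrite (@eq_cube f g) ?(IH x) // => [y yi||y yi]; apply: H; rewrite inE ?eqxx // mem_cat yi ?orbT //.
Qed.

Lemma sum_conj_iter (I : finType) n (G : I -> R[i]) :
  \sum_i iter n conjc (G i) = iter n conjc (\sum_i G i).
Proof. by elim: n => //= n IH; rewrite -rmorph_sum IH. Qed.

(** A vertex other than the base is [x] plus a nonempty subset sum of the directions, hence
    uniformly distributed, and there are 2^m - 1 of them. The summand p^m in the strengthened claim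
    stands for the base and makes the induction close. *)
Lemma count_cube_points m x y :
  seqsum m (fun s => (count_mem y (cube_points x s))%:R) * p%:R <= (2 ^ m)%:R * p%:R ^+ m :> R.
Proof.
suff: seqsum m (fun s => (count_mem y (cube_points x s))%:R) * p%:R + p%:R ^+ m
        <= (2 ^ m)%:R * p%:R ^+ m :> R.
  by apply: le_trans; rewrite lerDl exprn_ge0.
elim: m x => [|m IH] x /=; first by rewrite mul0r add0r mulr1.
pose N z : R := seqsum m (fun s => (count_mem y (cube_points z s))%:R).
have e h : seqsum m (fun s => ((x + h == y) + count_mem y (cube_points (x + h) s ++ cube_points x s))%:R)
    = (x + h == y)%:R * p%:R ^+ m + (N (x + h) + N x) :> R.
  rewrite -!seqsumD -natrX mulr_natr -seqsum_const -seqsumD; apply: eq_seqsum => s _.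
  by rewrite count_cat !natrD.
rewrite (eq_bigr _ (fun h _ => e h)) !big_split /= -mulr_suml.
have -> : \sum_h (x + h == y)%:R = 1 :> R.
  rewrite (bigD1 (y - x)) //= [x + _]addrC subrK eqxx big1 ?addr0 // => h hn.
  by rewrite [x + h]addrC eq_sym -subr_eq eq_sym (negbTE hn).
set a := \sum_h N (x + h); set b := \sum_(h : F) N x.
have bnd (z : F -> F) : (\sum_h N (z h)) * p%:R
     + p%:R ^+ m.+1 <= (2 ^ m)%:R * p%:R ^+ m.+1 :> R.
  rewrite mulr_suml.
  have -> : p%:R ^+ m.+1 = \sum_(h : F) p%:R ^+ m :> R by rewrite sumr_const exprS mulr_natl.
  rewrite -big_split mulr_sumr /=; apply: ler_sum => h _; exact: IH.
have := bnd (fun h => x + h); have := bnd (fun=> x); rewrite -/a -/b.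
rewrite expnS natrM natrX mul1r !mulrDl -exprSr.
move: (a * _) (b * _) (_ ^+ m.+1) => u v w; lra.
Qed.

End CubeProducts.

(* Large p: expanding the 2M-th moment over the directions turns the products chi(x+n_1)...chi(x+n_M)
   into chi(Q(x)) for split monic Q.  After inserting a translation x every pair (Q, Q') contributes
   a nonnegative amount, so that the sum may be extended to all monic polynomials of degree M,
   where the M values of Q on the vertices of a cube are independent. *)
Section Moment.
Variables (R : rcfType) (F : finFieldType) (chi : F -> R[i]) (M : nat).
Hypothesis chiM : forall x y, chi (x * y) = chi x * chi y.
Hypothesis chi1 : chi 1 = 1.
Hypothesis chi_le1 : forall x, nrm (chi x) <= 1.
Hypothesis chi_sum0 : \sum_x chi x = 0.
Local Notation p := #|F|.
Hypothesis M0 : (0 < M)%N.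

Let monic_of (v : 'rV[F]_M) : {poly F} := 'X^M + rVpoly v.
Let char_poly (v : 'rV[F]_M) x : R[i] := chi (monic_of v).[x].
Let roots_poly (nu : {ffun 'I_M -> F}) : {poly F} := \prod_j ('X + (nu j)%:P).
Let coefs (nu : {ffun 'I_M -> F}) : 'rV[F]_M := poly_rV (roots_poly nu - 'X^M).

Let roots_polyE nu : roots_poly nu = \prod_j ('X - (- nu j)%:P).
Proof. by apply: eq_bigr => j _; rewrite polyCN opprK. Qed.

Let monic_of_coefs nu : monic_of (coefs nu) = roots_poly nu.
Proof.
suff sz : (size (roots_poly nu - 'X^M)%R <= M)%N by rewrite /monic_of /coefs poly_rV_K // addrC subrK.
have mon : roots_poly nu \is monic by rewrite roots_polyE rpred_prod // => j _; rewrite monicXsubC.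
have sz : size (roots_poly nu) = M.+1.
  by rewrite roots_polyE size_prod_XsubC -[index_enum _]enumT size_enum_ord.
apply/leq_sizeP => j; rewrite coefB coefXn leq_eqVlt => /predU1P [<-|lt].
  by rewrite eqxx -[X in _`_X]/(M.+1.-1) -sz -lead_coefE (eqP mon) subrr.
by rewrite (gtn_eqF lt) nth_default ?subr0 // sz.
Qed.

(** Each entry of [nu] is the negative of a root of the polynomial, which has at most M roots. *)
Let card_coefs_fiber v : (#|[set nu | coefs nu == v]| <= M ^ M)%N.
Proof.
pose D := [set x | root (monic_of v) (- x)].
have nz : monic_of v != 0.
  rewrite -size_poly_gt0 /monic_of size_polyDl size_polyXn // ltnS; exact: size_poly.
have cD : (#|D| <= M)%N.
  have le := @max_poly_roots _ (monic_of v) [seq - x | x <- enum D] nz.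
  rewrite size_map -cardE in le.
  have : (#|D| < size (monic_of v))%N.
    apply: le; last by rewrite map_inj_uniq ?enum_uniq //; exact: oppr_inj.
    by apply/allP => _ /mapP [x + ->]; rewrite mem_enum inE.
  by rewrite /monic_of size_polyDl size_polyXn ?ltnS //; exact: size_poly.
apply: (@leq_trans #|[pred nu : {ffun 'I_M -> F} | nu \in ffun_on (mem D)]|).
  apply: subset_leq_card; apply/subsetP => nu; rewrite inE => /eqP e.
  rewrite inE; apply/ffun_onP => j; rewrite inE -e monic_of_coefs roots_polyE.
  rewrite /root horner_prod (bigD1 j) //= hornerXsubC subrr mul0r //.
by rewrite card_ffun_on card_ord leq_exp2r // expn_gt0.
Qed.

Let sum_coefs (Psi : 'rV[F]_M -> R[i]) : (forall v, 0 <= Psi v) ->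
  \sum_nu Psi (coefs nu) <= (M ^ M)%:R * \sum_v Psi v.
Proof.
move=> P0; rewrite (partition_big coefs xpredT) //= mulr_sumr; apply: ler_sum => v _.
rewrite (eq_bigr (fun=> Psi v)); last by move=> nu /eqP ->.
rewrite sumr_const -[_ *+ _]mulr_natl ler_wpM2r // ler_nat.
by rewrite (leq_trans _ (card_coefs_fiber v)) // eq_leq // cardsE.
Qed.

Let cube_sum_pow x s : (\sum_n cube chi n s) ^+ M = \sum_nu cube (char_poly (coefs nu)) x s.
Proof.
rewrite (reindex_inj (addrI x)) /= -[M in LHS]card_ord -prodr_const.
rewrite (bigA_distr_bigA (fun _ n => cube chi (x + n) s)).
apply: eq_bigr => nu _; rewrite /char_poly monic_of_coefs.
under eq_bigr do rewrite -(cube_shift chi).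
rewrite -cube_prod; congr cube; apply: funext => y.
rewrite horner_prod (big_morph chi chiM chi1); apply: eq_bigr => j _.
by rewrite hornerD hornerX hornerC.
Qed.

(** Let rho, of degree M - 1, vanish at the other vertices. Adding c rho to a monic Q of degree M
    keeps it monic and changes only its value at [x], which runs over all of F with c; then
    [chi_sum0] applies. The other vertices may coincide with each other, but not with [x]. *)
Let char_poly_cube0 x s : (size (cube_points x s)).+1 = M -> x \notin cube_points x s ->
  \sum_v cube (char_poly v) x s = 0.
Proof.
move=> sm xs.
pose rho : {poly F} := \prod_(y <- cube_points x s) ('X - y%:P).
have rx : rho.[x] != 0.
  rewrite horner_prod prodf_seq_neq0; apply/allP => y ys /=.
  by rewrite hornerXsubC subr_eq0; apply: contraNneq xs => e; move: ys; rewrite -e.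
have sz : (size rho <= M)%N by rewrite size_prod_XsubC sm.
pose r : 'rV[F]_M := poly_rV rho.
have Qc c v : monic_of (c *: r + v) = monic_of v + c *: rho.
  by rewrite /monic_of linearD linearZ /= poly_rV_K // [c *: rho + _]addrC addrA.
have shift c : \sum_v cube (char_poly v) x s = \sum_v cube (char_poly (c *: r + v)) x s.
  by rewrite [LHS](reindex_inj (addrI (c *: r))).
have p0 : p%:R != 0 :> R[i] by rewrite pnatr_eq0 -lt0n; apply/card_gt0P; exists 0.
apply: (mulfI p0); rewrite mulr0 mulr_natl -[p]/#|xpredT : {pred F}| -sumr_const.
under eq_bigr => c _ do rewrite (shift c).
rewrite exchange_big /=; apply: big1 => v _.
under eq_bigr => c _.
  rewrite cube_restE (@eq_cube_rest _ _ _ (char_poly v)); first over.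
  move=> y ys; rewrite /char_poly Qc hornerD hornerZ.
  suff -> : rho.[y] = 0 by rewrite mulr0 addr0.
  by apply/eqP; rewrite -[_ == _]/(root rho y) root_prod_XsubC.
rewrite -mulr_suml sum_conj_iter.
suff -> : \sum_c char_poly (c *: r + v) x = 0.
  have -> : iter (size s) conjc (0 : R[i]) = 0 by elim: (size s) => //= n ->; rewrite rmorph0.
  by rewrite mul0r.
rewrite -[RHS]chi_sum0 [RHS](reindex (fun c => (monic_of v).[x] + c * rho.[x])) /=.
  by apply: eq_bigr => c _; rewrite /char_poly Qc hornerD hornerZ.
exists (fun d => (d - (monic_of v).[x]) / rho.[x]) => c _.
  by rewrite [_ + c * _]addrC addrK mulfK.
by rewrite divfK // addrC subrK.
Qed.

Let moment_complex m : (0 < m)%N -> M = (2 ^ m)%N ->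
  p%:R * seqsum m (fun s => nrm (\sum_n cube chi n s) ^+ (2 * M)) <=
  (M ^ M)%:R ^+ 2 * \sum_(x : F) seqsum m (fun s : seq F => (p ^ M)%:R ^+ 2 * (count_mem x (cube_points x s))%:R) :> R.
Proof.
move=> m0 ME; rewrite -lecR.
pose W v v' := \sum_x seqsum m (cube (fun y => char_poly v y * (char_poly v' y)^*) x).
have W0 v v' : 0 <= W v v' by apply: cube_sum_ge0.
have WE (I : finType) (c : I -> 'rV[F]_M) : \sum_i \sum_j W (c i) (c j) =
   \sum_x seqsum m (fun s => (\sum_i cube (char_poly (c i)) x s) * (\sum_i cube (char_poly (c i)) x s)^*).
  under eq_bigr do rewrite exchange_big /=.
  rewrite exchange_big /=; apply: eq_bigr => x _.
  under eq_bigr do rewrite -seqsum_sum.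
  rewrite -seqsum_sum; apply: eq_seqsum => s _.
  rewrite rmorph_sum big_distrlr /=; apply: eq_bigr => i _; apply: eq_bigr => j _.
  by rewrite cubeM cube_conj.
have -> : (p%:R * seqsum m (fun s => nrm (\sum_n cube chi n s) ^+ (2 * M)))%:C
    = \sum_nu \sum_nu' W (coefs nu) (coefs nu').
  rewrite WE rmorphM rmorph_nat /= (seqsum_morph _ _ (rmorph0 _) (rmorphD _)).
  rewrite mulr_natl -[p]/#|xpredT : {pred F}| -sumr_const.
  apply: eq_bigr => x _; apply: eq_seqsum => s _ /=.
  by rewrite -cube_sum_pow mulcJ nrmX -exprM mulnC.
apply: (@le_trans _ _ ((M ^ M)%:R * \sum_v \sum_nu' W v (coefs nu'))).
  by apply: (@sum_coefs (fun v => \sum_nu' W v (coefs nu'))) => v; rewrite sumr_ge0.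
rewrite rmorphM (rmorphXn (real_complex R)) rmorph_nat expr2 -mulrA ler_wpM2l ?ler0n //.
apply: (@le_trans _ _ (\sum_v (M ^ M)%:R * \sum_v' W v v')).
  by apply: ler_sum => v _; apply: (@sum_coefs (W v)).
rewrite -mulr_sumr ler_wpM2l ?ler0n // (WE _ id).
rewrite rmorph_sum /=; apply: ler_sum => x _.
rewrite (seqsum_morph _ _ (rmorph0 _) (rmorphD _)); apply: ler_seqsum => s sm /=.
(* The sum over all monic polynomials vanishes unless another vertex falls on the base. This happens
   for a proportion of at most 2^m / p of the cubes, which are bounded trivially. *)
rewrite mulcJ lecR; have [xs|xs] := boolP (x \in cube_points x s); last first.
  rewrite (char_poly_cube0 _ xs) ?nrm0 ?expr0n ?mulr_ge0 ?exprn_ge0 ?ler0n //.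
  by rewrite size_cube_points sm ME.
apply: (@le_trans _ _ ((p ^ M)%:R ^+ 2)); last first.
  by rewrite ler_peMr ?exprn_ge0 ?ler0n // ler1n -has_count has_pred1.
rewrite lerXn2r ?nnegrE ?nrm_ge0 ?ler0n //; apply: le_trans (ler_nrm_sum _ _ _) _.
apply: (@le_trans _ _ (\sum_(v : 'rV[F]_M) 1)).
  by apply: ler_sum => v _; apply: nrm_cube_le1 => y; apply: chi_le1.
by rewrite sumr_const card_mx mul1n.
Qed.

Lemma gowersF_moment m : (0 < m)%N -> M = (2 ^ m)%N ->
  gowersF m chi ^+ (2 * M) <= (M ^ M)%:R ^+ 2 * M%:R / p%:R.
Proof.
move=> m0 ME.
have p0 : (0 < p)%N by apply/card_gt0P; exists 0.
have pR : 0 < p%:R :> R by rewrite ltr0n.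
have -> : gowersF m chi = seqsum m (fun s => p%:R^-1 * nrm (\sum_x cube chi x s)) / p%:R ^+ m.
  by rewrite seqsumMl /gowersF exprS invfM mulrCA mulrA.
have -> : (2 * M)%N = (2 ^ m.+1)%N by rewrite ME expnS.
apply: le_trans (seqsum_power_mean _ _ p0 _) _.
  by move=> s; rewrite mulr_ge0 ?nrm_ge0 ?invr_ge0 ?ler0n.
have -> : (2 ^ m.+1)%N = (2 * M)%N by rewrite ME expnS.
rewrite ler_pdivrMr ?exprn_gt0 //.
rewrite (@eq_seqsum _ _ _ _ (fun s => p%:R^-1 ^+ (2 * M) * nrm (\sum_x cube chi x s) ^+ (2 * M))); last first.
  by move=> s _; rewrite exprMn.
rewrite seqsumMl.
have := moment_complex m0 ME; set T := seqsum m _.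
have le : \sum_(x : F) seqsum m (fun s : seq F => (p ^ M)%:R ^+ 2 * (count_mem x (cube_points x s))%:R)
    <= p%:R ^+ (2 * M) * (M%:R * p%:R ^+ m) :> R.
  rewrite -(ler_pM2r pR) mulr_suml.
  apply: (@le_trans _ _ (\sum_(x : F) (p ^ M)%:R ^+ 2 * (M%:R * p%:R ^+ m))).
    apply: ler_sum => x _; rewrite seqsumMl -mulrA ler_wpM2l ?exprn_ge0 ?ler0n //.
    by rewrite ME; apply: count_cube_points.
  by rewrite sumr_const natrX -exprM mulnC -[_ *+ _]mulr_natr.
move=> le2; rewrite -(ler_pM2l pR).
have -> : p%:R * (p%:R^-1 ^+ (2 * M) * T) = p%:R^-1 ^+ (2 * M) * (p%:R * T) by rewrite mulrCA.
apply: le_trans (ler_wpM2l _ le2) _; first by rewrite exprn_ge0 ?invr_ge0 ?ler0n.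
rewrite mulrCA; apply: le_trans (ler_wpM2l _ (ler_wpM2l _ le)) _; rewrite ?exprn_ge0 ?invr_ge0 ?ler0n //.
rewrite exprVn mulKf ?expf_neq0 ?gt_eqF //.
rewrite le_eqVlt; apply/orP; left; apply/eqP.
move: ((M ^ M)%:R ^+ 2) (M%:R) (p%:R ^+ m) => A B C0.
by field; rewrite gt_eqF.
Qed.

End Moment.

Section Averages.
Variables (R : rcfType) (F : finFieldType).
Local Notation p := #|F|.
Implicit Types (Phi Psi : F -> seq F -> R).

Definition cavg j Phi : R := (\sum_n seqsum j (Phi n)) / p%:R ^+ j.+1.

Let p0 : (0 < p)%N. Proof. by apply/card_gt0P; exists 0. Qed.
Let pR : 0 < p%:R :> R. Proof. by rewrite ltr0n. Qed.

Lemma eq_cavg j Phi Psi : (forall n s, size s = j -> Phi n s = Psi n s) -> cavg j Phi = cavg j Psi.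
Proof.
by move=> e; congr (_ / _); apply: eq_bigr => n _; apply: eq_seqsum => s sj; apply: e.
Qed.

Lemma ler_cavg j Phi Psi : (forall n s, size s = j -> Phi n s <= Psi n s) -> cavg j Phi <= cavg j Psi.
Proof.
move=> e; rewrite ler_pM2r ?invr_gt0 ?exprn_gt0 //.
by apply: ler_sum => n _; apply: ler_seqsum => s sj; apply: e.
Qed.

Lemma cavgD j Phi Psi : cavg j (fun n s => Phi n s + Psi n s) = cavg j Phi + cavg j Psi.
Proof. by rewrite -mulrDl -big_split; congr (_ / _); apply: eq_bigr => n _; rewrite seqsumD. Qed.

Lemma cavgMl j c Phi : cavg j (fun n s => c * Phi n s) = c * cavg j Phi.
Proof. by rewrite mulrA mulr_sumr; congr (_ / _); apply: eq_bigr => n _; rewrite seqsumMl. Qed.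

Lemma cavg_swap j (al : seq F -> F -> F) Phi : (forall s, injective (al s)) ->
  cavg j (fun n s => Phi (al s n) s) = cavg j Phi.
Proof.
move=> inj; congr (_ / _); rewrite -!seqsum_sum; apply: eq_seqsum => s _.
by rewrite [RHS](reindex_inj (inj s)).
Qed.

Lemma cavg_map j (b : F -> F) Phi : injective b ->
  cavg j (fun n s => Phi n (map b s)) = cavg j Phi.
Proof. by move=> inj; congr (_ / _); apply: eq_bigr => n _; rewrite (seqsum_map j (Phi n) inj). Qed.

Lemma cavgS j Phi : cavg j.+1 Phi = (\sum_h cavg j (fun n s => Phi n (h :: s))) / p%:R.
Proof. by rewrite /cavg -mulr_suml -mulrA -invfM -exprSr; congr (_ / _); rewrite exchange_big. Qed.

Lemma cavg_sum j (Phi : F -> F -> seq F -> R) :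
  cavg j (fun n s => (\sum_k Phi k n s) / p%:R) = (\sum_k cavg j (Phi k)) / p%:R.
Proof.
rewrite /cavg -mulr_suml exchange_big /= mulrAC; congr (_ / _).
rewrite mulr_suml; apply: eq_bigr => n _; rewrite -seqsum_sum.
rewrite mulrC -seqsumMl; apply: eq_seqsum => s _; by rewrite mulrC.
Qed.

Lemma cavg_const j (c : R) : cavg j (fun _ _ => c) = c.
Proof.
rewrite /cavg sumr_const seqsum_const -mulrnA -expnSr -[c *+ _]mulr_natr natrX mulfK //.
by rewrite expf_neq0 ?gt_eqF.
Qed.

Lemma cavg_count j : cavg j (fun n s => (count_mem 0 (n :: cube_points n s))%:R) <= (2 ^ j.+1)%:R / p%:R.
Proof.
rewrite ler_pdivrMr ?exprn_gt0 // mulrAC.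
have -> : (2 ^ j.+1)%:R * p%:R ^+ j.+1 / p%:R = (2 ^ j.+1)%:R * p%:R ^+ j :> R.
  by rewrite exprSr mulrA mulfK ?gt_eqF.
apply: (@le_trans _ _ (\sum_(n : F) ((n == 0)%:R * p%:R ^+ j + (2 ^ j)%:R * p%:R ^+ j / p%:R))).
  apply: ler_sum => n _ /=.
  rewrite (eq_seqsum (Psi := fun s => (n == 0)%:R + (count_mem 0 (cube_points n s))%:R)); last first.
    by move=> s _; rewrite natrD.
  rewrite seqsumD seqsum_const -[_ *+ (p ^ j)]mulr_natr natrX lerD2l.
  by rewrite ler_pdivlMr //; apply: count_cube_points.
rewrite big_split /= sumr_const -mulr_suml (bigD1 0) //= eqxx big1 ?addr0 ?mul1r; last first.
  by move=> n /negbTE ->.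
rewrite -[(_ / _) *+ _]mulr_natr divfK ?gt_eqF // expnS natrM -mulrA mulr2n mulrDl mul1r lerD2r.
by rewrite ler_peMl ?exprn_ge0 ?ler0n // ler1n expn_gt0.
Qed.

End Averages.

(* Every p: if the cube products of f were almost all close to 1, those of one dimension less would
   be almost multilinear in the directions; a dilation by 2 would multiply the exponent by 2^j and
   also fix the value, so that these products would be close to 1 as well, down to dimension 1. *)
Section Unimodular.
Variables (R : rcfType) (F : finFieldType).
Implicit Types (f : F -> R[i]).
Local Notation p := #|F|.

Let p0 : (0 < p)%N. Proof. by apply/card_gt0P; exists 0. Qed.
Let pR : 0 < p%:R :> R. Proof. by rewrite ltr0n. Qed.

Definition unimod f := forall x, nrm (f x) = 1.

Lemma unimodJ (z : R[i]) : nrm z = 1 -> z * z^* = 1.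
Proof. by move=> z1; rewrite mulcJ z1 expr1n. Qed.

Lemma unimod_cube f x s : unimod f -> nrm (cube f x s) = 1.
Proof. by move=> f1; elim: s x => //= h s IH x; rewrite nrmM nrmJ !IH mulr1. Qed.

Lemma unimod_der f h : unimod f -> unimod (fun x => f (x + h) * (f x)^*).
Proof. by move=> f1 x; rewrite nrmM nrmJ !f1 mulr1. Qed.

Definition defect j f : R := cavg j (fun n s => nrm (1 - cube f n s)).

Lemma defect_ge0 j f : 0 <= defect j f.
Proof.
rewrite divr_ge0 ?exprn_ge0 ?ler0n // sumr_ge0 // => n _.
by rewrite seqsum_ge0 // => s _; apply: nrm_ge0.
Qed.

Lemma defectS j f : defect j.+1 f = (\sum_h defect j (fun x => f (x + h) * (f x)^*)) / p%:R.
Proof.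
rewrite /defect cavgS; congr (_ / _); apply: eq_bigr => h _; apply: eq_cavg => n s _.
by rewrite cube_cons.
Qed.

Lemma defect_diff j f : unimod f ->
  defect j.+1 f = cavg j (fun n s => (\sum_h nrm (cube f (n + h) s - cube f n s)) / p%:R).
Proof.
move=> f1; rewrite defectS cavg_sum; congr (_ / _); apply: eq_bigr => h _; apply: eq_cavg => n s _.
rewrite -cube_cons /=.
have -> : cube f (n + h) s - cube f n s = - ((1 - cube f (n + h) s * (cube f n s)^*) * cube f n s).
  by rewrite mulrBl mul1r -mulrA [_^* * _]mulrC unimodJ ?unimod_cube // mulr1 opprB.
by rewrite nrmN nrmM unimod_cube // mulr1.
Qed.

(** Both values are compared with the value at a third point, obtained by a uniform random shift;
    each comparison costs one [defect]. The move may thus depend on the directions. *)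
Lemma cube_move j f (al : seq F -> F -> F) : unimod f -> (forall s, injective (al s)) ->
  cavg j (fun n s => nrm (cube f (al s n) s - cube f n s)) <= 2 * defect j.+1 f.
Proof.
move=> f1 inj; pose D n s := (\sum_h nrm (cube f (n + h) s - cube f n s)) / p%:R : R.
have e1 : defect j.+1 f = cavg j D by apply: defect_diff.
have e2 : defect j.+1 f = cavg j (fun n s => D (al s n) s) by rewrite e1 cavg_swap.
rewrite mulr2n mulrDl mul1r {1}e2 e1 -cavgD; apply: ler_cavg => n s _.
rewrite -mulrDl ler_pdivlMr // mulr_natr -[p]/#|xpredT : {pred F}| -sumr_const.
rewrite [X in _ <= _ + X](_ : _ = \sum_h nrm (cube f (al s n + h) s - cube f n s)); last first.
  rewrite (reindex_inj (addrI (al s n - n))) /=; apply: eq_bigr => h _.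
  by congr (nrm (cube f _ s - _)); rewrite addrA addrCA subrr addr0.
rewrite -big_split; apply: ler_sum => h _ /=.
by rewrite [X in _ <= X + _]nrmB; apply: ler_nrmDB.
Qed.

Lemma cube_step f x h k s : unimod f ->
  cube f x ((h + k) :: s) = cube f (x + h) (k :: s) * cube f x (h :: s).
Proof.
move=> f1 /=; rewrite addrA.
transitivity (cube f (x + h + k) s * (cube f (x + h) s * (cube f (x + h) s)^*) * (cube f x s)^*).
  by rewrite unimodJ ?mulr1 ?unimod_cube.
by rewrite !mulrA [X in X * _]mulrAC.
Qed.

(** By [cube_step], a doubled direction yields the product of two adjacent cubes, which nearly
    agree; each of the [j] directions therefore contributes one squaring. *)
Lemma cube_double j f : (2 : F) != 0 -> unimod f ->
  cavg j (fun n s => nrm (cube f n (map ( *%R 2) s) - cube f n s ^+ (2 ^ j))) <= (2 ^ j.+1)%:R * defect j.+1 f.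
Proof.
move=> two; elim: j f => [|j IH] f f1.
  rewrite (@eq_cavg _ _ _ _ (fun _ _ => 0)) ?cavg_const; first by apply: mulr_ge0; [rewrite ler0n | apply: defect_ge0].
  by move=> n [|//] _; rewrite /= expr1 subrr nrm0.
apply: (@le_trans _ _ (cavg j.+1 (fun n s =>
    nrm (cube f n (map ( *%R 2) s) - cube f n (2 * head 0 s :: behead s) ^+ (2 ^ j))
    + (2 ^ j)%:R * nrm (cube f (n + head 0 s) s - cube f n s)))).
  apply: ler_cavg => n [//|h s] _; rewrite [head _ _]/= [behead _]/= [map _ (h :: s)]/=.
  apply: le_trans (ler_nrmDB (cube f n (2 * h :: s) ^+ (2 ^ j)) _ _) _; rewrite lerD2l.
  have -> : 2 * h = h + h by rewrite mulr2n mulrDl mul1r.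
  rewrite (cube_step _ _ _ _ f1) expnS exprM.
  apply: le_trans (nrm_sub1X _ _ _) _.
  - by rewrite nrmM !unimod_cube ?mulr1.
  - by rewrite nrmX unimod_cube ?expr1n.
  by rewrite ler_wpM2l ?ler0n // expr2 -mulrBl nrmM [X in _ * X]unimod_cube // mulr1.
rewrite cavgD cavgMl.
have le2 : cavg j.+1 (fun n s => nrm (cube f (n + head 0 s) s - cube f n s)) <= 2 * defect j.+2 f.
  by apply: (@cube_move _ _ (fun s n => n + head 0 s)) => // s; apply: addIr.
have le1 : cavg j.+1 (fun n s =>
     nrm (cube f n (map ( *%R 2) s) - cube f n (2 * head 0 s :: behead s) ^+ (2 ^ j)))
     <= (2 ^ j.+1)%:R * defect j.+2 f.
  rewrite cavgS; apply: (@le_trans _ _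
    ((\sum_h (2 ^ j.+1)%:R * defect j.+1 (fun x => f (x + 2 * h) * (f x)^*)) / p%:R)).
    rewrite ler_pM2r ?invr_gt0 //; apply: ler_sum => h _.
    rewrite (@eq_cavg _ _ _ _ (fun n s => nrm (cube (fun x => f (x + 2 * h) * (f x)^*) n (map ( *%R 2) s)
       - cube (fun x => f (x + 2 * h) * (f x)^*) n s ^+ (2 ^ j)))).
      by apply: IH; apply: unimod_der.
    by move=> n s _; rewrite -!cube_cons.
  rewrite -mulr_sumr -mulrA.
  rewrite -(reindex_inj (P := xpredT) (F := fun h => defect j.+1 (fun x => f (x + h) * (f x)^*)) (mulfI two)).
  by rewrite -defectS.
apply: le_trans (lerD le1 (ler_wpM2l (ler0n _ _) le2)) _.
move: (defect _ _) => D; rewrite mulrA -natrM -expnSr -mulrDl -natrD addnn -mul2n -expnS.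
exact: lexx.
Qed.

Lemma cube_multiple j f K : unimod f ->
  cavg j.+1 (fun n s => nrm (cube f n (K%:R * head 0 s :: behead s) - cube f n s ^+ K))
   <= (2 * K)%:R * defect j.+2 f.
Proof.
move=> f1; elim: K => [|K IH].
  rewrite muln0 mul0r -[X in _ <= X](cavg_const F j.+1); apply: ler_cavg => n [//|h s] _ /=.
  by rewrite mul0r addr0 unimodJ ?unimod_cube // subrr nrm0.
apply: (@le_trans _ _ (cavg j.+1 (fun n s =>
    nrm (cube f (n + K%:R * head 0 s) s - cube f n s)
    + nrm (cube f n (K%:R * head 0 s :: behead s) - cube f n s ^+ K)))).
  apply: ler_cavg => n [//|h s] _; rewrite [head _ _]/= [behead _]/=.
  have -> : K.+1%:R * h = K%:R * h + h by rewrite mulrSr mulrDl mul1r.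
  rewrite (cube_step _ _ _ _ f1) exprS.
  by apply: nrm_subM; rewrite ?nrmX ?unimod_cube ?expr1n.
rewrite cavgD mulnS natrD mulrDl lerD //.
by apply: (@cube_move _ _ (fun s n => n + K%:R * head 0 s)) => // s; apply: addIr.
Qed.

(** A cube with at least one direction has as many conjugated as unconjugated vertices, so [c]
    cancels. Only cubes with a vertex at 0 can differ, by at most 2. *)
Lemma cube_dilate j f (c : R[i]) : (0 < j)%N -> unimod f -> nrm c = 1 ->
  (forall x, x != 0 -> f (2 * x) = c * f x) ->
  cavg j (fun n s => nrm (cube f (2 * n) (map ( *%R 2) s) - cube f n s)) <= (2 ^ j.+2)%:R / p%:R.
Proof.
move=> j0 f1 c1 fc.
apply: (@le_trans _ _ (2 * cavg j (fun n s => (count_mem 0 (n :: cube_points n s))%:R))); last first.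
  by rewrite expnS natrM -mulrA ler_wpM2l ?ler0n //; apply: cavg_count.
rewrite -cavgMl; apply: ler_cavg => n s sj.
have [z|nz] := boolP (0 \in n :: cube_points n s).
  apply: le_trans (ler_nrmB _ _) _; rewrite !unimod_cube //; apply: (@le_trans _ _ (2 * 1)); first by rewrite mulr1.
  by rewrite ler_wpM2l ?ler0n // ler1n -has_count has_pred1.
rewrite [X in nrm X](_ : _ = 0) ?nrm0 ?mulr_ge0 ?ler0n //.
have -> : cube f (2 * n) (map ( *%R 2) s) = cube (fun x => f (2 * x)) n s.
  by elim: s n {sj nz} => //= h s IH n; rewrite -mulrDr !IH.
rewrite (@eq_cube _ _ _ (fun x => c * f x)); first last.
- by move=> y ys; apply: fc; apply: contraNneq nz => <-; rewrite inE ys orbT.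
- by apply: fc; apply: contraNneq nz => ->; rewrite mem_head.
rewrite cubeM; case: s sj {nz} => [sj|h s _]; first by rewrite -sj in j0.
suff -> : cube (fun=> c) n (h :: s) = 1 by rewrite mul1r subrr.
by rewrite cube_cons unimodJ // cube1.
Qed.

(** Let K = 2^(j+1). Multiplying one direction by K and doubling all j + 1 directions both
    approximate the K-th power of the cube, and the doubled cube nearly has the original value
    because f(2x) = c f(x). So the cubes with first direction K h and h nearly agree; their quotient
    is the cube at n + h with first direction (K - 1) h, which is a generic cube since K - 1 is
    invertible. *)
Lemma defect_step j f (c : R[i]) : (2 : F) != 0 -> ((2 ^ j.+1).-1%:R : F) != 0 ->
  unimod f -> nrm c = 1 -> (forall x, x != 0 -> f (2 * x) = c * f x) ->
  defect j.+1 f <= (2 ^ (j + 4))%:R * defect j.+2 f + (2 ^ (j + 3))%:R / p%:R.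
Proof.
move=> two KF f1 c1 fc; set K := (2 ^ j.+1)%N.
have K1 : K = K.-1.+1 by rewrite prednK // expn_gt0.
pose Kh (s : seq F) := K%:R * head 0 s :: behead s.
apply: (@le_trans _ _ (cavg j.+1 (fun n s =>
    nrm (cube f n (Kh s) - cube f n s ^+ K) + nrm (cube f n (map ( *%R 2) s) - cube f n s ^+ K)
   + (nrm (cube f (2 * n) (map ( *%R 2) s) - cube f n (map ( *%R 2) s))
      + nrm (cube f (2 * n) (map ( *%R 2) s) - cube f n s))))).
  have -> : defect j.+1 f = cavg j.+1 (fun n s => nrm (cube f n (Kh s) - cube f n s)).
    rewrite /defect !cavgS; congr (_ / _).
    rewrite (reindex_inj (mulfI KF)); apply: eq_bigr => h _.
    rewrite -[LHS](@cavg_swap _ _ _ (fun s n => n + h)); last by move=> s; apply: addIr.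
    apply: eq_cavg => n s _; rewrite /Kh [head _ _]/= [behead _]/=.
    have -> : K%:R * h = h + (K.-1)%:R * h by rewrite {1}K1 mulrS mulrDl mul1r.
    rewrite (cube_step _ _ _ _ f1) -[RHS]/(nrm (_ * _ - cube f n (h :: s))).
    rewrite -[X in nrm (_ * _ - X)]mul1r -mulrBl nrmM (unimod_cube n (h :: s) f1) mulr1.
    by rewrite nrmB.
  apply: ler_cavg => n s _.
  apply: le_trans (ler_nrmDB (cube f n s ^+ K) _ _) _; rewrite -addrA lerD2l.
  apply: le_trans (ler_nrmDB (cube f n (map ( *%R 2) s)) _ _) _; rewrite nrmB lerD2l.
  by apply: le_trans (ler_nrmDB (cube f (2 * n) (map ( *%R 2) s)) _ _) _; rewrite nrmB.
rewrite !cavgD.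
have b1 := cube_multiple j K f1; have b2 := cube_double j.+1 two f1.
have b4 := @cube_dilate j.+1 f c isT f1 c1 fc.
have b3 : cavg j.+1 (fun n s => nrm (cube f (2 * n) (map ( *%R 2) s) - cube f n (map ( *%R 2) s)))
    <= 2 * defect j.+2 f.
  rewrite (cavg_map j.+1 (fun n s => nrm (cube f (2 * n) s - cube f n s)) (mulfI two)).
  by apply: (@cube_move _ _ (fun s n => 2 * n)) => // s; apply: mulfI.
apply: le_trans (lerD (lerD b1 b2) (lerD b3 b4)) _.
rewrite addrA -!mulrDl -/K.
have -> : (2 ^ (j + 3))%N = (2 ^ j.+3)%N by rewrite addn3.
rewrite lerD2r ler_wpM2r //.
  exact: defect_ge0.
rewrite -!natrD ler_nat /K addn4 !expnS; have := expn_gt0 2 j; lia.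
Qed.

(** The sum over x and h of f(x + h) conj(f(x)) - 1 is |sum f|^2 - p^2, which is large in absolute
    value when the sum of f is small. *)
Lemma defect1 f : unimod f -> nrm (\sum_x f x) <= 1 -> 1 - p%:R^-1 <= defect 1 f.
Proof.
move=> f1 sf; rewrite defect_diff // /cavg expr1.
rewrite -(ler_pM2r pR) -mulrA mulVf ?gt_eqF // mulr1 mulrBl mul1r mulVf ?gt_eqF //.
rewrite -(ler_pM2r pR) /= mulr_suml.
under [X in _ <= X]eq_bigr do rewrite divfK ?gt_eqF //.
apply: (@le_trans _ _ (nrm (\sum_x \sum_h (f (x + h) * (f x)^* - 1)))); last first.
  apply: le_trans (ler_nrm_sum _ _ _) _; apply: ler_sum => x _.
  apply: le_trans (ler_nrm_sum _ _ _) _; apply: ler_sum => h _.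
  have -> : f (x + h) * (f x)^* - 1 = (f (x + h) - f x) * (f x)^* by rewrite mulrBl unimodJ.
  by rewrite nrmM nrmJ f1 mulr1.
have -> : \sum_x \sum_h (f (x + h) * (f x)^* - 1) = (\sum_x f x) * (\sum_x f x)^* - p%:R * p%:R.
  under eq_bigr => x _.
    rewrite sumrB sumr_const -mulr_suml -(reindex_inj (P := xpredT) (addrI x)); over.
  rewrite sumrB sumr_const -mulr_sumr rmorph_sum; congr (_ - _).
  by rewrite -[_ *+ #|_|]mulr_natl.
rewrite nrmB; apply: (@le_trans _ _ (nrm (p%:R * p%:R) - nrm ((\sum_x f x) * (\sum_x f x)^*))).
  rewrite !nrmM nrmJ nrm_nat mulrBl mul1r lerD2l lerN2; apply: le_trans (_ : 1 * 1 <= _).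
    by rewrite ler_pM ?nrm_ge0.
  by rewrite mul1r ler1n.
by rewrite lerBlDr; have := ler_nrmD (p%:R * p%:R - (\sum_x f x) * (\sum_x f x)^*) ((\sum_x f x) * (\sum_x f x)^*); rewrite subrK.
Qed.

(** For fixed directions, Cauchy-Schwarz over x and h bounds the mean distance d between two values
    of the cube product through their variance: d^2 <= 2 (1 - S^2) <= 4 (1 - S), where S is the
    absolute value of their mean. Convexity of the square then allows averaging over the
    directions. *)
Lemma defect_gowers m f : unimod f -> gowersF m f <= 1 - defect m.+1 f ^+ 2 / 4.
Proof.
move=> f1.
pose S s := nrm (\sum_x cube f x s) / p%:R.
pose d s := (\sum_x \sum_h nrm (cube f (x + h) s - cube f x s)) / p%:R ^+ 2.
have S01 s : 0 <= S s <= 1.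
  rewrite divr_ge0 ?nrm_ge0 ?ler0n //= ler_pdivrMr // mul1r.
  apply: le_trans (ler_nrm_sum _ _ _) _; under eq_bigr do rewrite unimod_cube //.
  by rewrite sumr_const.
have dS s : d s ^+ 2 <= 4 * (1 - S s).
  have le : d s ^+ 2 <= 2 * (1 - S s ^+ 2).
    pose G (i : F * F) := (nrm (cube f (i.1 + i.2) s - cube f i.1 s))%:C : R[i].
    have := cauchy_schwarz_nrm G; rewrite card_prod.
    have -> : \sum_i G i = (\sum_x \sum_h nrm (cube f (x + h) s - cube f x s))%:C.
      rewrite rmorph_sum /= [RHS](eq_bigr (fun x => \sum_h (nrm (cube f (x + h) s - cube f x s))%:C)).
        by rewrite (pair_bigA _ (fun x h => (nrm (cube f (x + h) s - cube f x s))%:C)).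
      by move=> x _; rewrite rmorph_sum.
    rewrite nrm_real; last by rewrite sumr_ge0 // => x _; rewrite sumr_ge0 // => h _; apply: nrm_ge0.
    have -> : \sum_i nrm (G i) ^+ 2 = 2 * (p%:R ^+ 2 - nrm (\sum_x cube f x s) ^+ 2).
      apply: complexI; rewrite rmorph_sum /=.
      rewrite -(pair_bigA _ (fun x h => (nrm (nrm (cube f (x + h) s - cube f x s))%:C ^+ 2)%:C)) /=.
      transitivity (\sum_x \sum_h ((1 + 1) - (cube f (x + h) s * (cube f x s)^* + cube f x s * (cube f (x + h) s)^*)) : R[i]).
        apply: eq_bigr => x _; apply: eq_bigr => h _; rewrite nrm_real ?nrm_ge0 // -mulcJ.
        by rewrite rmorphB mulrBl !mulrBr !unimodJ ?unimod_cube //; ring.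
      set T := \sum_x cube f x s.
      have E x : \sum_h (1 + 1 - (cube f (x + h) s * (cube f x s)^* + cube f x s * (cube f (x + h) s)^*))
          = 2 * p%:R - (T * (cube f x s)^* + cube f x s * T^*) :> R[i].
        rewrite sumrB sumr_const big_split /=; congr (_ - (_ + _)).
        - by rewrite -[_ *+ #|_|]mulr_natr.
        - by rewrite -mulr_suml; congr (_ * _); rewrite [RHS](reindex_inj (addrI x)).
        by rewrite -mulr_sumr -rmorph_sum; congr (_ * _^*); rewrite [RHS](reindex_inj (addrI x)).
      rewrite (eq_bigr _ (fun x _ => E x)) sumrB sumr_const big_split /= -mulr_sumr -mulr_suml.
      rewrite -rmorph_sum -/T mulcJ; move: (nrm T ^+ 2) => t.
      rewrite (rmorphM (real_complex R)) (rmorphB (real_complex R)).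
      rewrite -!natrX !(rmorph_nat (real_complex R)).
      rewrite -[_ *+ #|_|]mulr_natr.
      rewrite natrX; have rg (q z : R[i]) : 2 * q * q - (z + z) = 2 * (q ^+ 2 - z) by ring.
      exact: rg.
    rewrite /d /S => le; rewrite expr_div_n ler_pdivrMr ?exprn_gt0 //.
    apply: le_trans le _; rewrite natrM le_eqVlt; apply/orP; left; apply/eqP.
    move: (nrm _) => z; field; by rewrite gt_eqF.
  apply: le_trans le _; have /andP[] := S01 s; move: (S s) => z z0 z1; rewrite expr2; nra.
have -> : gowersF m f = seqsum m S / p%:R ^+ m.
  rewrite /gowersF exprS invfM mulrA; congr (_ / _).
  rewrite mulrC -seqsumMl; apply: eq_seqsum => s _; by rewrite mulrC.
have -> : defect m.+1 f = seqsum m d / p%:R ^+ m.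
  rewrite defect_diff // /cavg -seqsum_sum exprS invfM mulrA; congr (_ / _).
  rewrite mulrC -seqsumMl; apply: eq_seqsum => s _.
  by rewrite /d -mulr_suml mulrC -mulrA -invfM -expr2.
have pm : 0 < p%:R ^+ m :> R by rewrite exprn_gt0.
have := @seqsum_power_mean _ _ m 1 d p0; rewrite expn1 => pw.
rewrite lerBrDr addrC; apply: le_trans (_ : seqsum m (fun s => d s ^+ 2) / p%:R ^+ m / 4 + seqsum m S / p%:R ^+ m <= _).
  rewrite lerD2r ler_pM2r ?invr_gt0 ?ltr0n //; apply: pw => s.
  by rewrite divr_ge0 ?exprn_ge0 ?ler0n // sumr_ge0 // => x _; rewrite sumr_ge0 // => h _; apply: nrm_ge0.
rewrite mulrAC -mulrDl ler_pdivrMr // mul1r mulrC -seqsumMl -seqsumD.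
have -> : p%:R ^+ m = seqsum m (fun _ : seq F => 1) :> R by rewrite seqsum_const natrX.
apply: ler_seqsum => s _; have := dS s; move: (d s) (S s) => x y; lra.
Qed.

End Unimodular.

(** From v (1 + 1/n) <= 1 and Bernoulli's inequality (1 + 1/n)^n >= 2. *)
Lemma bernoulli_half (R : realFieldType) (v : R) n : (0 < n)%N -> 0 <= v <= 1 - n%:R^-1 -> v ^+ n <= 2^-1.
Proof.
move=> n0 /andP[v0 v1]; have nR : 0 < n%:R :> R by rewrite ltr0n.
set x := n%:R^-1 in v1; have x0 : 0 < x by rewrite invr_gt0.
have bern k : 1 + k%:R * x <= (1 + x) ^+ k.
  elim: k => [|k IH]; first by rewrite mul0r addr0.
  rewrite exprS; apply: le_trans (_ : (1 + x) * (1 + k%:R * x) <= _); last first.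
    by rewrite ler_wpM2l // addr_ge0 ?ltW.
  have kx : 0 <= k%:R * x * x by rewrite !mulr_ge0 ?ler0n ?ltW.
  rewrite -natr1 !mulrDl !mulrDr !mul1r mulr1 mulrCA; move: kx; rewrite -!mulrA.
  move: (k%:R * (x * x)) (k%:R * x) => y z; lra.
have two : 2 <= (1 + x) ^+ n.
  by apply: le_trans (bern n); rewrite mulfV ?gt_eqF.
have le1 : v ^+ n * (1 + x) ^+ n <= 1.
  rewrite -exprMn exprn_ile1 //; first by rewrite mulr_ge0 // addr_ge0 // ltW.
  apply: le_trans (_ : (1 - x) * (1 + x) <= _); first by rewrite ler_pM2r ?addr_gt0.
  by rewrite -subr_sqr expr1n gerBl sqr_ge0.
rewrite -(ler_pM2r (_ : 0 < 2)) // mulVf ?pnatr_eq0 //.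
by apply: le_trans le1; rewrite ler_wpM2l ?exprn_ge0.
Qed.

(** * The saving at a single prime *)

Section PrimeBound.
Variables (R : rcfType) (F : finFieldType) (chi : F -> R[i]) (m : nat).
Hypothesis chiM : forall x y, chi (x * y) = chi x * chi y.
Hypothesis chi0 : chi 0 = 0.
Hypothesis chi_unimod : forall x : F, x != 0 -> nrm (chi x) = 1.
Hypothesis chi_sum0 : \sum_x chi x = 0.
Hypothesis m0 : (0 < m)%N.
Hypothesis pow2 : forall j, (0 < j <= m)%N -> ((2 ^ j)%:R : F) != 0 /\ ((2 ^ j).-1%:R : F) != 0.
Local Notation p := #|F|.
Hypothesis p_large : (2 ^ (2 * (m + 6) ^ 2) <= p)%N.

Let p0 : (0 < p)%N. Proof. by apply/card_gt0P; exists 0. Qed.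
Let pR : 0 < p%:R :> R. Proof. by rewrite ltr0n. Qed.

(** The value 1 at 0 makes the function unimodular everywhere; its sum becomes 1, and the relation
    with its dilate by 2 survives away from 0. *)
Let f (x : F) : R[i] := if x == 0 then 1 else chi x.

Let f_unimod : unimod f.
Proof. by move=> x; rewrite /f; case: eqP => [_|/eqP]; rewrite ?nrm1 //; apply: chi_unimod. Qed.

Let chi_le1 x : nrm (chi x) <= 1.
Proof. by have [->|/chi_unimod ->] := eqVneq x 0; rewrite ?chi0 ?nrm0. Qed.

Let two : (2 : F) != 0.
Proof. by have [] := @pow2 1; rewrite ?m0. Qed.

Let f_dilate x : x != 0 -> f (2 * x) = chi 2 * f x.
Proof. by move=> x0; rewrite /f mulf_eq0 (negbTE two) (negbTE x0) chiM. Qed.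

(** Passing from dimension j + 1 to j + 2 loses a factor 2^(j+5), of which a factor 2 pays for the
    term with 1/p. Since (j+4)^2 + (j+5) <= (j+5)^2, the exponents grow quadratically in the
    dimension. *)
Let defect_lower j : (j <= m)%N -> (2 ^ ((j + 4) ^ 2))%:R^-1 <= defect j.+1 f.
Proof.
elim: j => [|j IH] jm.
  apply: le_trans (_ : 1 - p%:R^-1 <= _).
    have p2 : 2 <= p%:R :> R.
      rewrite ler_nat; apply: leq_trans p_large; rewrite -{1}(expn1 2) leq_exp2l //; nia.
    have : p%:R^-1 <= 2^-1 :> R by rewrite lef_pV2 ?posrE ?ltr0n.
    have : (2 ^ ((0 + 4) ^ 2))%:R^-1 <= 2^-1 :> R.
      by rewrite lef_pV2 ?posrE ?ltr0n ?expn_gt0 // ler_nat -{1}(expn1 2) leq_exp2l.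
    move: (p%:R^-1) ((2 ^ ((0 + 4) ^ 2))%:R^-1) => x y; lra.
  apply: defect1 => //.
  have -> : \sum_x f x = 1.
    have := chi_sum0; rewrite (bigD1 0) //= chi0 add0r => e.
    rewrite (bigD1 0) //= {1}/f eqxx (eq_bigr chi) ?e ?addr0 // => x /negbTE nx.
    by rewrite /f nx.
  by rewrite nrm1.
have := defect_step two _ f_unimod (chi_unimod two) f_dilate => /(_ j) /(_ (proj2 (@pow2 j.+1 _))).
move=> /(_ jm) st; have := le_trans (IH (ltnW jm)) st.
set D := defect _ _; set a := (2 ^ ((j + 4) ^ 2))%:R^-1; move=> le.
have pj : (2 ^ (j + 3))%:R / p%:R <= a / 2.
  rewrite /a -invfM -natrM mulnC -expnS ler_pdivrMr // mulrC ler_pdivlMr ?ltr0n ?expn_gt0 //.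
  rewrite -natrM ler_nat -expnD; apply: leq_trans p_large; rewrite leq_exp2l //; nia.
have : a / 2 <= (2 ^ (j + 4))%:R * D.
  by move: le pj; move: (_ / p%:R) (_ * D) => x y; lra.
move=> le2; have : a / 2 / (2 ^ (j + 4))%:R <= D.
  by rewrite ler_pdivrMr ?ltr0n ?expn_gt0 // [D * _]mulrC.
apply: le_trans; rewrite /a -!invfM -!natrM lef_pV2 ?posrE ?ltr0n ?muln_gt0 ?expn_gt0 //.
rewrite ler_nat -[X in (_ * X * _)%N](expn1 2) -!expnD leq_exp2l //; nia.
Qed.

Let gowersF_compare : gowersF m chi <= gowersF m f + (2 ^ m.+1)%:R / p%:R.
Proof.
apply: le_trans (_ : _ <= gowersF m f + cavg m (fun n s => (count_mem 0 (n :: cube_points n s))%:R)) _; last first.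
  by rewrite lerD2l; apply: cavg_count.
rewrite /gowersF /cavg -mulrDl ler_pM2r ?invr_gt0 ?exprn_gt0 // -seqsum_sum -seqsumD.
apply: ler_seqsum => s _.
rewrite -lerBlDl; apply: le_trans (_ : nrm (\sum_x (cube chi x s - cube f x s)) <= _).
  rewrite sumrB lerBlDl; have := ler_nrmD (\sum_x cube chi x s - \sum_x cube f x s) (\sum_x cube f x s).
  by rewrite subrK addrC.
apply: le_trans (ler_nrm_sum _ _ _) _; apply: ler_sum => x _.
have [z|nz] := boolP (0 \in x :: cube_points x s).
  have -> : cube chi x s = 0.
    elim: s x z => [|h s IH] x /=; first by rewrite inE eq_sym => /eqP ->.
    rewrite inE => /orP[/eqP e|].
      by rewrite (IH x) ?rmorph0 ?mulr0 // -e mem_head.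
    rewrite inE mem_cat => /or3P[z|z|z].
    - by rewrite IH ?mul0r // inE z.
    - by rewrite IH ?mul0r // inE z orbT.
    by rewrite (IH x) ?rmorph0 ?mulr0 // inE z orbT.
  by rewrite sub0r nrmN unimod_cube // ler1n -has_count has_pred1.
rewrite (@eq_cube _ _ f chi) ?subrr ?nrm0 ?ler0n //.
  by rewrite /f; case: eqP nz => // ->; rewrite mem_head.
by move=> y ys; rewrite /f; case: eqP nz ys => // -> + ys; rewrite inE ys orbT.
Qed.

Let gowersF01 : 0 <= gowersF m chi <= 1.
Proof.
rewrite divr_ge0 ?exprn_ge0 ?ler0n ?seqsum_ge0 //=; last by move=> s _; apply: nrm_ge0.
rewrite ler_pdivrMr ?exprn_gt0 // mul1r.
apply: (@le_trans _ _ (seqsum m (fun _ : seq F => p%:R))).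
  apply: ler_seqsum => s _; apply: le_trans (ler_nrm_sum _ _ _) _.
  apply: (@le_trans _ _ (\sum_(x : F) 1)); last by rewrite sumr_const.
  by apply: ler_sum => x _; apply: nrm_cube_le1.
by rewrite seqsum_const -[_ *+ (p ^ m)]mulr_natr natrX -exprS.
Qed.

Let gowersF_small : gowersF m chi <= 1 - (2 ^ (2 * (m + 4) ^ 2 + 3))%:R^-1.
Proof.
apply: le_trans gowersF_compare _; apply: le_trans (lerD (defect_gowers m f_unimod) (lexx _)) _.
have := defect_lower (leqnn m); set a := (2 ^ ((m + 4) ^ 2))%:R^-1; move=> aD.
have a0 : 0 <= a by rewrite invr_ge0.
have a2 : a ^+ 2 <= defect m.+1 f ^+ 2 by rewrite lerXn2r ?nnegrE ?defect_ge0.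
have e : (2 ^ (2 * (m + 4) ^ 2 + 3))%:R^-1 = a ^+ 2 / 8 :> R.
  rewrite /a exprVn -natrX -expnM expnD natrM invfM mulnC; congr (_ * _^-1).
have pm : (2 ^ m.+1)%:R / p%:R <= a ^+ 2 / 8.
  rewrite -e ler_pdivrMr // mulrC ler_pdivlMr ?ltr0n ?expn_gt0 //.
  rewrite -natrM ler_nat -expnD; apply: leq_trans p_large; rewrite leq_exp2l //; nia.
rewrite e; move: a2 pm; move: (a ^+ 2) (_ ^+ 2) (_ / p%:R) => x y z; lra.
Qed.

Lemma gowersF_prime : gowersF m chi ^+ (2 ^ (3 * (m + 6) ^ 2)) <= p%:R^-1.
Proof.
have /andP[V0 V1] := gowersF01; set V := gowersF m chi in V0 V1 *.
have down K K' : (K' <= K)%N -> V ^+ K' <= p%:R^-1 -> V ^+ K <= p%:R^-1.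
  by move=> le; apply: le_trans; apply: ler_wiXn2l.
(* With M = 2^m one has b = 8 M^2, and p >= 2^b guarantees that the constant (M^M)^2 M of the moment
   bound is at most the square root of p. For smaller p it suffices to reach 2^(-b), by amplifying
   the weak saving [gowersF_small]. *)
set b := (2 ^ (2 * m + 3))%N.
have [lt|ge] := ltnP p (2 ^ b).
  set e := (2 * (m + 4) ^ 2 + 3)%N.
  apply: (down _ (2 ^ e * b)%N); first by rewrite /b -expnD leq_exp2l // /e; nia.
  rewrite exprM; apply: le_trans (_ : 2^-1 ^+ b <= _).
    rewrite lerXn2r ?nnegrE ?exprn_ge0 ?invr_ge0 ?ler0n //.
    by rewrite bernoulli_half ?expn_gt0 // V0 gowersF_small.
  by rewrite exprVn lef_pV2 ?posrE ?exprn_gt0 // -natrX ler_nat ltnW.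
have chi1 : chi 1 = 1.
  have c1 : chi 1 != 0 by rewrite -nrm_eq0 chi_unimod ?oner_eq0.
  by apply: (mulfI c1); rewrite -chiM !mulr1.
have [M ME] : {M | M = (2 ^ m)%N} by exists (2 ^ m)%N.
have M0 : (0 < M)%N by rewrite ME expn_gt0.
have mom := gowersF_moment chiM chi1 chi_le1 chi_sum0 M0 m0 ME.
apply: (down _ (2 * M * 2)%N).
  by rewrite ME -expnS -expnSr leq_exp2l //; nia.
rewrite exprM; rewrite -/V in mom.
set s := ((M ^ M)%:R ^+ 2 * M%:R : R) in mom.
have s0 : 0 <= s by rewrite mulr_ge0 ?exprn_ge0.
have sp : s ^+ 2 <= p%:R.
  rewrite /s -natrX -natrM -natrX ler_nat; apply: leq_trans ge.
  rewrite [X in ((X ^ _) ^ _ * X)%N]ME -!expnM -expnD -expnM leq_exp2l // /b.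
  have := ltn_expl m (isT : (1 < 2)%N); rewrite expnD (mulnC 2 m) expnM -ME => h; nia.
apply: le_trans (_ : (s / p%:R) ^+ 2 <= _).
  by rewrite lerXn2r // nnegrE; [apply: exprn_ge0 | apply: divr_ge0].
rewrite expr_div_n ler_pdivrMr ?exprn_gt0 // expr2 mulKf ?gt_eqF //.
Qed.

End PrimeBound.

(** * Dirichlet characters to squarefree moduli *)

Lemma sum_Fp (V : nmodType) p (G : nat -> V) : prime p ->
  \sum_(h < p) G h = \sum_(x : 'F_p) G x.
Proof. by move=> pp; rewrite -(big_mkord xpredT G) -{1}(Fp_cast pp) big_mkord. Qed.

Lemma gowers_Fp (R : rcfType) m p (f : int -> R[i]) : prime p -> mod_periodic p f ->
  gowers m f p = gowersF m (fun x : 'F_p => f (x : nat)%:Z).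
Proof.
move=> pp; have pZ : p%:R = #|'F_p|%:R :> R by rewrite card_Fp.
elim: m f => [|m IH] f pf.
  by rewrite /= /gowersF /= expr1 (sum_Fp (fun h => f h%:Z) pp) pZ.
rewrite gowersFS -pZ /= (sum_Fp (fun h => gowers m (mder h%:Z f) p) pp); congr (_ / _).
apply: eq_bigr => h _; rewrite IH; last exact: mder_periodic.
congr gowersF; apply: funext => x; rewrite /mder; congr (_ * _).
apply: periodic_eqmod pf _; rewrite -PoszD !modz_nat; congr Posz.
by rewrite /= [X in (_ %% X %% _)%N]Fp_cast // modn_mod.
Qed.

Lemma coprimez_eqmod (n m : int) (q : nat) : (n = m %[mod q%:Z])%Z -> coprimez n q%:Z = coprimez m q%:Z.
Proof. by move=> e; rewrite /coprimez -gcdz_modl e gcdz_modl. Qed.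

Lemma eqmodz_mul (n m : int) (a b : nat) : coprime a b ->
  (n = m %[mod a%:Z])%Z -> (n = m %[mod b%:Z])%Z -> (n = m %[mod (a * b)%N%:Z])%Z.
Proof.
move=> cab /eqP; rewrite eqz_mod_dvd => ea /eqP; rewrite eqz_mod_dvd => eb.
by apply/eqP; rewrite eqz_mod_dvd PoszM Gauss_dvdz ?ea // coprimezE.
Qed.

Lemma eqmodz_dvd (n m : int) (a b : nat) : (a %| b)%N ->
  (n = m %[mod b%:Z])%Z -> (n = m %[mod a%:Z])%Z.
Proof.
move=> ab /eqP; rewrite eqz_mod_dvd => e; apply/eqP; rewrite eqz_mod_dvd.
by apply: dvdz_trans e; rewrite dvdzE.
Qed.

Lemma coprimez_mull (n m d : int) : coprimez (n * m) d = coprimez n d && coprimez m d.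
Proof. by rewrite !coprimezE abszM coprimeMl. Qed.

Lemma squarefree_coprime a b : squarefree (a * b) -> coprime a b.
Proof.
move=> sq; rewrite /coprime; set g := gcdn a b; have [g0|g0|//] := ltngtP g 1.
  have /eqP := sq 2 isT; case; have : g = 0%N by move: g0; case: g.
  by case: (posnP a) => [->|a0]; rewrite ?mul0n ?dvdn0 // /g; have := gcdn_gt0 a b; rewrite a0 => /lt0n_neq0 /eqP.
by have := sq g g0; rewrite expnS expn1 dvdn_mul ?dvdn_gcdl ?dvdn_gcdr.
Qed.

Lemma squarefree_dvd a b : (a %| b)%N -> squarefree b -> squarefree a.
Proof. by move=> ab sq d d1; apply: contra (sq d d1) => /dvdn_trans; apply. Qed.

Section DirichletCharacters.
Variable R : realType.
Implicit Types (chi : int -> R[i]) (q : nat).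

Lemma dchar_eqmod q chi n m : dirichlet_char q chi -> (n = m %[mod q%:Z])%Z -> chi n = chi m.
Proof. by case=> pc _ _; apply: periodic_eqmod. Qed.

Lemma dchar1 q chi : dirichlet_char q chi -> chi 1 = 1.
Proof.
case=> pc mc ec; have c1 : chi 1 != 0 by rewrite ec coprimezE coprime1n.
by apply: (mulfI c1); rewrite -mc !mulr1.
Qed.

Lemma dcharX q chi n k : dirichlet_char q chi -> chi (n ^+ k) = chi n ^+ k.
Proof.
move=> dc; elim: k => [|k IH]; first by rewrite !expr0 (dchar1 dc).
by case: (dc) => _ mc _; rewrite !exprS mc IH.
Qed.

Lemma dchar_nrm q chi n : (0 < q)%N -> dirichlet_char q chi -> coprimez n q%:Z -> nrm (chi n) = 1.
Proof.
move=> q0 dc cn; have qZ : q%:Z != 0 by rewrite -lt0n.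
pose r := `|(n %% q%:Z)%Z|%N.
have rn : (r%:Z = n %[mod q%:Z])%Z by rewrite gez0_abs ?modz_ge0 // modz_mod.
have cr : coprime r q by have := cn; rewrite -(coprimez_eqmod rn) coprimezE.
have PX k : (r ^ k)%N%:Z = r%:Z ^+ k by elim: k => // k IH; rewrite exprS expnS PoszM IH.
have chir : chi n ^+ totient q = 1.
  rewrite -(dcharX _ _ dc) -(dchar1 dc); apply: (dchar_eqmod dc).
  rewrite -modzXm -rn modzXm -PX !modz_nat; congr Posz.
  exact: Euler_exp_totient.
apply/eqP; rewrite -(@pexpr_eq1 _ _ (totient q)) ?nrm_ge0 //; first by rewrite -nrmX chir nrm1.
by rewrite totient_gt0.
Qed.

Lemma dchar_le1 q chi n : (0 < q)%N -> dirichlet_char q chi -> nrm (chi n) <= 1.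
Proof.
move=> q0 dc; have [cn|ncn] := boolP (coprimez n q%:Z); first by rewrite (dchar_nrm q0 dc).
have : chi n == 0 by case: dc => _ _ ->.
by move/eqP ->; rewrite nrm0.
Qed.

(* For squarefree q this is primitivity: no prime p dividing q can be removed from the conductor. *)
Definition locally_nonprincipal q chi : Prop := forall p, prime p -> (p %| q)%N ->
  exists c : int, [/\ coprimez c q%:Z, (c = 1 %[mod (q %/ p)%N%:Z])%Z & chi c <> 1].

Definition good_char q chi := dirichlet_char q chi /\ locally_nonprincipal q chi.

Definition crt1 (a b : nat) (n : int) := zchinese a%:Z b%:Z n 1.

Lemma crt1_modl a b n : coprime a b -> (crt1 a b n = n %[mod a%:Z])%Z.
Proof. by move=> cab; apply: zchinese_modl; rewrite coprimezE. Qed.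

Lemma crt1_modr a b n : coprime a b -> (crt1 a b n = 1 %[mod b%:Z])%Z.
Proof. by move=> cab; apply: zchinese_modr; rewrite coprimezE. Qed.

Lemma coprimez_crt1 a b n : coprime a b -> coprimez (crt1 a b n) (a * b)%N%:Z = coprimez n a%:Z.
Proof.
move=> cab; rewrite PoszM coprimezMr (coprimez_eqmod (crt1_modl n cab)).
by rewrite (coprimez_eqmod (crt1_modr n cab)) [coprimez 1 _]coprimezE coprime1n andbT.
Qed.

Lemma eqmodzM (d m1 m2 n1 n2 : int) : (m1 = n1 %[mod d])%Z -> (m2 = n2 %[mod d])%Z ->
  (m1 * m2 = n1 * n2 %[mod d])%Z.
Proof. by move=> e1 e2; rewrite -modzMm e1 e2 modzMm. Qed.

(** The component of [chi] at the factor [a] of the modulus, read off at integers congruent to 1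
    modulo [b]. *)
Definition char_part (a b : nat) chi : int -> R[i] := fun n => chi (crt1 a b n).

Lemma char_part_dchar a b chi : coprime a b -> dirichlet_char (a * b) chi ->
  dirichlet_char a (char_part a b chi).
Proof.
move=> cab dc; case: (dc) => pc mc ec; split.
- move=> n; apply: (dchar_eqmod dc); apply: eqmodz_mul => //.
    by rewrite !crt1_modl // modzDr.
  by rewrite !crt1_modr.
- move=> m n; rewrite /char_part -mc; apply: (dchar_eqmod dc); apply: eqmodz_mul => //.
    by rewrite crt1_modl //; apply: eqmodzM; rewrite crt1_modl.
  by rewrite crt1_modr // -[in LHS](mulr1 1); apply: eqmodzM; rewrite crt1_modr.
- by move=> n; rewrite /char_part ec coprimez_crt1.
Qed.

Lemma char_partE a b chi n : coprime a b -> dirichlet_char (a * b) chi ->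
  chi n = char_part a b chi n * char_part b a chi n.
Proof.
move=> cab dc; have cba : coprime b a by rewrite coprime_sym.
case: (dc) => pc mc ec; rewrite /char_part -mc; apply: (dchar_eqmod dc); apply: eqmodz_mul => //.
  by rewrite -[in LHS](mulr1 n); apply: eqmodzM; rewrite ?crt1_modl ?crt1_modr.
by rewrite -[in LHS](mul1r n); apply: eqmodzM; rewrite ?crt1_modl ?crt1_modr.
Qed.

Lemma char_part_good a b chi : (0 < b)%N -> coprime a b -> good_char (a * b) chi ->
  good_char a (char_part a b chi).
Proof.
move=> b0 cab [dc np]; split; first exact: char_part_dchar.
move=> p pp pa; have [|c [cc c1 nc]] := np p pp; first exact: dvdn_mulr.
have e : (a * b %/ p = (a %/ p) * b)%N by rewrite divn_mulAC.
exists c; split.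
- by move: cc; rewrite PoszM coprimezMr => /andP[].
- by apply: eqmodz_dvd c1; rewrite e dvdn_mulr.
suff <- : chi c = char_part a b chi c by [].
apply: (dchar_eqmod dc); apply: eqmodz_mul => //; first by rewrite crt1_modl.
by rewrite crt1_modr //; apply: eqmodz_dvd c1; rewrite e dvdn_mull.
Qed.

(** If no such c existed for p, then [chi] would be trivial on the units congruent to 1 modulo d = q
    / p, hence induced by its component modulo d. Squarefreeness makes d and p coprime, so that this
    component is a character. *)
Lemma primitive_good q chi : (0 < q)%N -> squarefree q -> primitive_char q chi -> good_char q chi.
Proof.
move=> q0 sq [dc prim]; split=> // p pp pq; apply: contrapT => none.
set d := (q %/ p)%N; have qE : q = (d * p)%N by rewrite divnK.
have cdp : coprime d p by apply: squarefree_coprime; rewrite -qE.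
have dc' : dirichlet_char (d * p) chi by rewrite -qE.
have d0 : (0 < d)%N by rewrite divn_gt0 ?prime_gt0 // dvdn_leq.
have dq : (d < q)%N by rewrite ltn_Pdiv ?prime_gt1.
apply: (prim d (char_part d p chi) _ dq (char_part_dchar cdp dc')).
  by rewrite qE dvdn_mulr.
move=> n cn; have /coprimezP [[u v] /= uv] := cn.
have inv : (n * u = 1 %[mod q%:Z])%Z by rewrite -uv addrC modzMDl mulrC.
have cu : coprimez u q%:Z.
  have : coprimez (n * u) q%:Z by rewrite (coprimez_eqmod inv) coprimezE coprime1n.
  by rewrite coprimez_mull => /andP[].
have cnd : coprimez n d%:Z by move: cn; rewrite qE PoszM coprimezMr => /andP[].
have ce : coprimez (crt1 d p n) q%:Z by rewrite qE coprimez_crt1.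
case: (dc) => _ mc ec.
have c1 : chi (crt1 d p n * u) = 1.
  apply: contrapT => ne; apply: none; exists (crt1 d p n * u); split => //.
    by rewrite coprimez_mull ce cu.
  rewrite -/d; transitivity ((n * u) %% d%:Z)%Z; first by apply: eqmodzM; rewrite ?crt1_modl.
  by apply: eqmodz_dvd inv; rewrite qE dvdn_mulr.
have u0 : chi u != 0 by rewrite ec cu.
apply: (mulIf u0); rewrite -!mc /char_part c1 (dchar_eqmod dc inv).
exact: dchar1 dc.
Qed.

Lemma gowers_prime_char m p chi : prime p -> (0 < m)%N -> (2 ^ (2 * (m + 6) ^ 2) <= p)%N ->
  good_char p chi -> gowers m chi p ^+ (2 ^ (3 * (m + 6) ^ 2)) <= p%:R^-1.
Proof.
move=> pp m0 pl [dc np]; case: (dc) => pc mc ec.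
have p0 := prime_gt0 pp.
have vlt (x : 'F_p) : (x < p)%N by rewrite -[X in (_ < X)%N](Fp_cast pp) ltn_ord.
have cop (x : 'F_p) : coprimez (x : nat)%:Z p%:Z = (x != 0).
  rewrite coprimezE /= coprime_sym prime_coprime //; congr negb.
  by rewrite /dvdn modn_small.
pose phi (x : 'F_p) := chi (x : nat)%:Z.
have phiM x y : phi (x * y) = phi x * phi y.
  rewrite /phi -mc; apply: (dchar_eqmod dc); rewrite -PoszM !modz_nat; congr Posz.
  by rewrite /= [X in (_ %% X %% _)%N]Fp_cast // modn_mod.
have phi0 : phi 0 = 0 by apply/eqP; rewrite ec cop eqxx.
have phi1 x : x != 0 -> nrm (phi x) = 1 by move=> x0; apply: dchar_nrm p0 dc _; rewrite cop.
have [c [cc _ nc]] := np p pp (dvdnn p).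
pose c0 : 'F_p := (`|(c %% p%:Z)%Z|%N)%:R.
have phic : phi c0 = chi c.
  apply: (dchar_eqmod dc); rewrite /c0 val_Fp_nat // -modz_nat gez0_abs ?modz_ge0 ?modz_mod //.
  by rewrite -lt0n.
have c00 : c0 != 0 by apply/eqP => e; move: (ec c); rewrite cc -phic e phi0 eqxx.
(* Multiplying the variable by [c0] multiplies the sum by chi(c), which is not 1. *)
have sum0 : \sum_x phi x = 0.
  apply: contrapT => ne; apply: nc; rewrite -phic; apply: (mulIf (introN eqP ne)).
  rewrite mul1r mulr_sumr [RHS](reindex_inj (mulfI c00)).
  by apply: eq_bigr => x _; rewrite phiM.
rewrite (gowers_Fp m pp pc).
suff: gowersF m phi ^+ (2 ^ (3 * (m + 6) ^ 2)) <= #|'F_p|%:R^-1 by rewrite card_Fp.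
apply: (gowersF_prime phiM phi0 phi1 sum0 m0); last by rewrite card_Fp.
move=> j /andP[j0 jm].
have jp : (2 ^ j < p)%N by apply: leq_trans pl; rewrite ltn_exp2l //; nia.
have nz k : (0 < k < p)%N -> (k%:R : 'F_p) != 0.
  by move=> /andP[k0 kp]; rewrite -(dvdn_pcharf (pchar_Fp pp)) gtnNdvd.
have j2 : (2 ^ 1 <= 2 ^ j)%N by rewrite leq_exp2l.
by split; apply: nz; lia.
Qed.

(** The exponent does not depend on the prime, so multiplicativity of the average multiplies the
    bounds 1/p to 1/u. *)
Lemma gowers_squarefree_char m u chi : (0 < m)%N -> (0 < u)%N -> squarefree u ->
  (forall p, prime p -> (p %| u)%N -> (2 ^ (2 * (m + 6) ^ 2) <= p)%N) ->
  good_char u chi -> gowers m chi u ^+ (2 ^ (3 * (m + 6) ^ 2)) <= u%:R^-1.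
Proof.
move=> m0; have [n le] := ubnP u; elim: n u chi le => // n IH u chi le u0 sq pl gd.
have [u1|u1] := leqP u 1.
  have -> : u = 1%N by apply/eqP; rewrite eqn_leq u1.
  rewrite invr1 exprn_ile1 ?gowers_ge0 // gowers_le1 // => k.
  by apply: dchar_le1 u0 (proj1 gd).
have pp := pdiv_prime u1; have pu := pdiv_dvd u; set p := pdiv u in pp pu.
have uE : u = (p * (u %/ p))%N by rewrite mulnC divnK.
set v := (u %/ p)%N in uE; have p0 := prime_gt0 pp.
have v0 : (0 < v)%N by move: u0; rewrite uE muln_gt0 => /andP[].
have cpv : coprime p v by apply: squarefree_coprime; rewrite -uE.
have cvp : coprime v p by rewrite coprime_sym.
have gp : good_char p (char_part p v chi) by apply: char_part_good => //; rewrite -uE.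
have gv : good_char v (char_part v p chi) by apply: char_part_good => //; rewrite mulnC -uE.
have chiE : chi = fun k => char_part p v chi k * char_part v p chi k.
  by apply: funext => k; apply: char_partE => //; rewrite -uE; case: gd.
rewrite chiE uE gowersM //; first last.
- by case: gv => -[].
- by case: gp => -[].
rewrite exprMn natrM invfM ler_pM ?exprn_ge0 ?gowers_ge0 //.
  by apply: gowers_prime_char => //; apply: pl.
apply: IH => //.
- by rewrite -ltnS; apply: leq_ltn_trans le; rewrite ltn_Pdiv ?prime_gt1.
- by apply: squarefree_dvd sq; rewrite [X in (_ %| X)%N]uE dvdn_mull.
- by move=> r pr rv; apply: pl => //; apply: dvdn_trans rv _; rewrite [X in (_ %| X)%N]uE dvdn_mull.
Qed.

End DirichletCharacters.

(** * Choice of the factorization of q *)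

(** If n > T, take the least divisor that is at least T: dividing it by one of its primes, which is
    at most P, brings it below T. *)
Lemma divisor_between n T P : (0 < n)%N -> (0 < T)%N -> (0 < P)%N ->
  (forall p, prime p -> (p %| n)%N -> (p <= P)%N) ->
  exists d, [/\ (d %| n)%N, (d <= T * P)%N & (d = n \/ T <= d)%N].
Proof.
move=> n0 T0 P0 pP; have [nT|Tn] := leqP n T.
  by exists n; split; [|apply: leq_trans nT _; rewrite leq_pmulr|left].
have ex : exists d, (d %| n)%N && (T <= d)%N by exists n; rewrite dvdnn ltnW.
case: (ex_minnP ex) => d /andP[dn Td] dmin; exists d; split=> //; last by right.
have [d1|d1] := leqP d 1; first by apply: leq_trans d1 _; rewrite muln_gt0 T0.
have pp := pdiv_prime d1; have pd := pdiv_dvd d.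
rewrite -(divnK pd) leq_mul ?pP //; last exact: dvdn_trans dn.
rewrite leqNgt; apply/negP => lt; have := dmin (d %/ pdiv d)%N.
rewrite (ltnW lt) (dvdn_trans _ dn) ?dvdn_div // => /(_ isT).
by rewrite leqNgt ltn_Pdiv ?prime_gt1 // (leq_trans T0).
Qed.

(** Such an n divides the factorial of Y. *)
Lemma squarefree_leq_exp n Y : (0 < n)%N -> squarefree n ->
  (forall p, prime p -> (p %| n)%N -> (p < Y)%N) -> (n <= Y ^ Y)%N.
Proof.
move=> n0 sq pY; apply: (@leq_trans Y`!); last first.
  have : forall k, (k <= Y)%N -> (k`! <= Y ^ k)%N.
    by elim=> // k IH kY; rewrite factS expnS leq_mul // IH // ltnW.
  by apply.
apply: dvdn_leq; rewrite ?fact_gt0 //; apply/dvdn_partP => // p.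
rewrite mem_primes => /and3P[pp _ pn].
apply: (@dvdn_trans p); last by rewrite dvdn_fact // prime_gt0 // ltnW // pY.
rewrite p_part -[X in (_ %| X)%N](expn1 p) dvdn_exp2l // leqNgt.
by apply/negP => l2; have := sq p (prime_gt1 pp); rewrite pfactor_dvdn // l2.
Qed.

(** * Sums over one block *)

Section BlockBound.
Variable R : realType.
Implicit Types (chi : int -> R[i]).

(** Each factor either exhausts n or is at least T, so [k] of them suffice. Once n is exhausted, the
    trivial character modulo 1 fills the list up to length exactly [k], which fixes the number of
    differencings. *)
Lemma char_factors k n u T P chi : (0 < n)%N -> (0 < T)%N -> (0 < P)%N -> squarefree n ->
  coprime n u -> good_char n chi -> (forall p, prime p -> (p %| n)%N -> (p <= P)%N) ->
  (n <= T ^ k)%N ->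
  exists gs, [/\ size gs = k, List.Forall (bounded_factor (T * P) u) gs & chi =1 prod_factors gs].
Proof.
move=> + T0 P0; elim: k n chi => [|k IH] n chi n0 sq cnu gd pP nT.
  have n1 : n = 1%N by apply/eqP; rewrite eqn_leq n0 andbT.
  exists [::]; split => // j; rewrite /prod_factors big_nil -(dchar1 (proj1 gd)).
  by apply: (dchar_eqmod (proj1 gd)); rewrite n1 !modz1.
have [d [dn dTP dT]] := divisor_between n0 T0 P0 pP.
have nE : n = (d * (n %/ d))%N by rewrite mulnC divnK.
set v := (n %/ d)%N in nE.
have /andP[d0 v0] : (0 < d)%N && (0 < v)%N by rewrite -muln_gt0 -nE.
have cdv : coprime d v by apply: squarefree_coprime; rewrite -nE.
have cvd : coprime v d by rewrite coprime_sym.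
have vn : (v %| n)%N by rewrite [X in (_ %| X)%N]nE dvdn_mull.
have gdd : good_char d (char_part d v chi) by apply: char_part_good => //; rewrite -nE.
have gv : good_char v (char_part v d chi) by apply: char_part_good => //; rewrite mulnC -nE.
have [||||gs [sz bf gsE]] := IH v _ v0 _ _ gv.
- exact: squarefree_dvd sq.
- by apply: coprime_dvdl cnu.
- by move=> p pp pv; apply: pP => //; apply: dvdn_trans vn.
- case: dT => [dE|Td].
    have -> : v = 1%N by rewrite /v dE divnn n0.
    by rewrite expn_gt0 T0.
  by rewrite -(leq_pmul2l T0) -expnS (leq_trans _ nT) // [X in (_ <= X)%N]nE leq_mul2r Td orbT.
exists ((d, char_part d v chi) :: gs); split => [|| j].
- by rewrite /= sz.
- constructor => //; split => //=.
  + exact: coprime_dvdl dn cnu.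
  + by case: gdd => -[].
  + by move=> j; apply: dchar_le1 d0 (proj1 gdd).
rewrite /prod_factors big_cons /= -/(prod_factors gs j) -gsE; apply: char_partE => //.
by rewrite -nE; case: gd.
Qed.

(** The part of q prime to u supplies the [m] factors to be removed; the part modulo u stays as the
    weight. With a block of length u T P u the boundary error is 2^(m+2) / u, and the two lower
    bounds on u make the main term and this error each at most half of L^(-2^m). *)
Lemma char_block_bound q u m L T P chi e t : (0 < m)%N -> (0 < L)%N -> (0 < T)%N -> (0 < P)%N ->
  (0 < q)%N -> squarefree q -> good_char q chi ->
  (forall p, prime p -> (p %| q)%N -> (p <= P)%N) -> (q <= T ^ m)%N ->
  (u %| q)%N -> (forall p, prime p -> (p %| u)%N -> (2 ^ (2 * (m + 6) ^ 2) <= p)%N) ->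
  ((2 * L ^ (2 ^ m)) ^ (2 ^ (3 * (m + 6) ^ 2)) <= u)%N -> (2 ^ (m + 3) * L ^ (2 ^ m) <= u)%N ->
  phase_like e ->
  nrm (\sum_(n < u * (T * P * u)) e (t + n%:Z) * chi (t + n%:Z)) <= (u * (T * P * u))%:R / L%:R.
Proof.
move=> m0 L0 T0 P0 q0 sq gd pP qT uq pu u1 u2 ph.
have u0 : (0 < u)%N by apply: dvdn_gt0 uq.
set N := (u * _)%N; have N0 : (0 < N)%N by rewrite !muln_gt0 u0 T0 P0.
have uR : 0 < u%:R :> R by rewrite ltr0n.
have LR : 0 < L%:R :> R by rewrite ltr0n.
have qE : q = (q %/ u * u)%N by rewrite divnK.
set v := (q %/ u)%N in qE.
have v0 : (0 < v)%N by move: q0; rewrite qE muln_gt0 => /andP[].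
have vq : (v %| q)%N by rewrite [X in (_ %| X)%N]qE dvdn_mulr.
have cvu : coprime v u by apply: squarefree_coprime; rewrite -qE.
have cuv : coprime u v by rewrite coprime_sym.
have gv : good_char v (char_part v u chi) by apply: char_part_good => //; rewrite -qE.
have gu : good_char u (char_part u v chi) by apply: char_part_good => //; rewrite mulnC -qE.
have [|||gs [sz bf gsE]] := @char_factors m v u T P _ v0 T0 P0 _ cvu gv.
- exact: squarefree_dvd sq.
- by move=> p pp pv; apply: pP => //; apply: dvdn_trans vq.
- by apply: leq_trans qT; apply: dvdn_leq.
have := @vdc_iter R N (T * P) u (T * P * u) gs e (erefl _) N0 _ bf ph.
rewrite /vdc_bound sz => /(_ m0 (char_part u v chi) t) /(_ (let: conj (DirichletChar a _ _) _ := gu in a)).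
move=> /(_ (fun n => dchar_le1 n u0 (proj1 gu))).
under eq_bigr => n _.
  rewrite -gsE -mulrA -char_partE //; last by rewrite -qE; case: gd.
  over.
set y := nrm _ / _; set V := gowers _ _ _ => le.
have VK : V ^+ (2 ^ (3 * (m + 6) ^ 2)) <= u%:R^-1.
  by apply: gowers_squarefree_char => //; apply: squarefree_dvd sq.
set X : R := (L ^ (2 ^ m))%:R.
have X0 : 0 < X by rewrite ltr0n expn_gt0 L0.
have Vb : V <= (2 * X)^-1.
  rewrite leNgt; apply/negP => lt.
  suff : u%:R^-1 < V ^+ (2 ^ (3 * (m + 6) ^ 2)) by rewrite ltNge VK.
  apply: le_lt_trans (_ : (2 * X)^-1 ^+ (2 ^ (3 * (m + 6) ^ 2)) < _); last first.
    by rewrite ltrXn2r ?expn_eq0 // invr_ge0 mulr_ge0 // ltW.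
  rewrite exprVn lef_pV2 ?posrE ?exprn_gt0 ?mulr_gt0 //.
  by rewrite /X -natrM -natrX ler_nat.
have err : (2 ^ m)%:R * (4 * (T * P * u)%:R / N%:R) <= (2 * X)^-1.
  have -> : (2 ^ m)%:R * (4 * (T * P * u)%:R / N%:R) = (2 ^ (m + 2))%:R / u%:R :> R.
    have W0 : (T * P * u)%:R != 0 :> R by rewrite pnatr_eq0 -lt0n !muln_gt0 T0 P0 u0.
    rewrite /N; move: (T * P * u)%N W0 => W W0; rewrite expnD !natrM.
    move: (2 ^ m)%:R (W%:R) (u%:R) W0 uR => z w b W0 uR; field.
    by rewrite W0 gt_eqF.
  rewrite ler_pdivrMr // mulrC ler_pdivlMr ?mulr_gt0 // /X mulrA -!natrM ler_nat.
  by apply: leq_trans u2; rewrite leq_mul2r !expnD; apply/orP; right; lia.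
have yX : y ^+ (2 ^ m) <= L%:R^-1 ^+ (2 ^ m).
  apply: le_trans le _; apply: le_trans (lerD Vb err) _.
  rewrite exprVn -natrX -/X invfM; move: (X^-1) => z; lra.
have y1 : y <= L%:R^-1.
  rewrite leNgt; apply/negP => lt.
  have : L%:R^-1 ^+ (2 ^ m) < y ^+ (2 ^ m).
    by rewrite ltrXn2r ?expn_eq0 // invr_ge0 ltW.
  by rewrite ltNge yX.
by rewrite mulrC -ler_pdivrMr ?ltr0n.
Qed.

End BlockBound.

(** Used with U = 2^E, where E is the product 2^(3a^2) (1 + (l+1) 2^m), and Y = 2^(2a^2). As 2^l <=
    L, the first bound gives U^2 <= 2^(L/m), so that u does not dominate the block length; the
    second gives U Y^Y <= 2^L <= q, so that discarding the primes below Y leaves enough room for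
    u. *)
Lemma pow_ineq a l m : (m + 6 = a)%N -> (10 * a ^ 2 <= l)%N ->
  (2 ^ (3 * a ^ 2) * (1 + l.+1 * 2 ^ m) * (2 * m) <= 2 ^ l)%N /\
  (2 ^ (3 * a ^ 2) * (1 + l.+1 * 2 ^ m) + 2 * a ^ 2 * 2 ^ (2 * a ^ 2) <= 2 ^ l)%N.
Proof.
move=> ma al; set x := (a ^ 2)%N; have xm : (6 * m + 36 <= x)%N by rewrite /x -ma; nia.
rewrite -/x in al; clearbody x.
set r := (l - 10 * x)%N; have lE : (l = 10 * x + r)%N by rewrite /r subnKC.
have xl := ltn_expl x (isT : (1 < 2)%N); have rl := ltn_expl r (isT : (1 < 2)%N).
have ml := ltn_expl m (isT : (1 < 2)%N).
have l2 : (l + 2 <= 2 ^ (x + 4 + r))%N.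
  rewrite !expnD lE; move: (2 ^ x)%N (2 ^ r)%N xl rl => X Y *; nia.
have b1 : (1 + l.+1 * 2 ^ m <= 2 ^ (x + 4 + r + m))%N.
  rewrite expnD; apply: leq_trans (_ : (l + 2) * 2 ^ m <= _)%N; last by rewrite leq_mul2r l2 orbT.
  move: (2 ^ m)%N ml => M ?; nia.
have b2 : (2 ^ (3 * x) * (1 + l.+1 * 2 ^ m) <= 2 ^ (4 * x + 4 + r + m))%N.
  apply: leq_trans (_ : 2 ^ (3 * x) * 2 ^ (x + 4 + r + m) <= _)%N; first by rewrite leq_mul2l b1 orbT.
  by rewrite -expnD leq_exp2l //; lia.
split.
  apply: leq_trans (_ : 2 ^ (4 * x + 4 + r + m) * (2 * 2 ^ m) <= _)%N.
    by apply: leq_mul => //; lia.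
  by rewrite -expnS -expnD leq_exp2l //; lia.
apply: leq_trans (_ : 2 ^ (l.-1) + 2 ^ (l.-1) <= _)%N; last by rewrite addnn -mul2n -expnS leq_exp2l //; lia.
apply: leq_add; first by apply: leq_trans b2 _; rewrite leq_exp2l //; lia.
apply: leq_trans (_ : 2 * 2 ^ x * 2 ^ (2 * x) <= _)%N; first by rewrite leq_mul2r leq_mul2l (ltnW xl) !orbT.
by rewrite -expnS -expnD leq_exp2l //; lia.
Qed.

Lemma block_length_exists (R : realType) q m P (chi : int -> R[i]) :
  let L := trunc_log 2 q in (0 < m)%N -> (10 * (m + 6) ^ 2 <= trunc_log 2 L)%N ->
  squarefree q -> good_char q chi -> (0 < P)%N ->
  (forall p, prime p -> (p %| q)%N -> (p <= P)%N) ->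
  exists N, [/\ (0 < N)%N, (N <= 2 ^ (2 * (L %/ m)).+1 * P ^ 3)%N &
    forall e t, phase_like e -> nrm (\sum_(n < N) e (t + n%:Z) * chi (t + n%:Z)) <= N%:R / L%:R].
Proof.
move=> L m0 ml sq gd P0 pP; set l := trunc_log 2 L in ml.
have l0 : (0 < l)%N by apply: leq_trans ml; nia.
have L0 : (0 < L)%N by move: l0; rewrite /l; case: (L) => //; rewrite trunc_log0.
have q0 : (0 < q)%N by move: L0; rewrite /L; case: (q) => //; rewrite trunc_log0.
have Ll : (2 ^ l <= L)%N by apply: trunc_logP.
have Ll' : (L < 2 ^ l.+1)%N by apply: trunc_log_ltn.
have qL : (2 ^ L <= q)%N by apply: trunc_logP.
have qL' : (q < 2 ^ L.+1)%N by apply: trunc_log_ltn.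
have [i1 i2] := pow_ineq (erefl _) ml.
set a2 := ((m + 6) ^ 2)%N in i1 i2; set Y := (2 ^ (2 * a2))%N.
set E := (2 ^ (3 * a2) * (1 + l.+1 * 2 ^ m))%N in i1 i2; set U := (2 ^ E)%N.
pose pi := [pred p : nat | Y <= p]%N.
have part : (q`_pi * q`_pi^')%N = q by rewrite partnC.
have small : (q`_pi^' <= Y ^ Y)%N.
  apply: squarefree_leq_exp; first exact: part_gt0.
    by apply: squarefree_dvd sq; apply: dvdn_part.
  move=> p pp pd; have : p \in pi^' by apply: pnatPpi (part_pnat pi^' q) _; rewrite mem_primes pp part_gt0 pd.
  by rewrite !inE /= -ltnNge.
have big : (U <= q`_pi)%N.
  rewrite -(leq_pmul2r (_ : 0 < Y ^ Y))%N; last by rewrite !expn_gt0.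
  apply: leq_trans (_ : q <= _)%N; last by rewrite -{1}part leq_mul2l small orbT.
  apply: leq_trans qL; rewrite /U /Y -expnM -expnD leq_exp2l //.
  exact: leq_trans i2 Ll.
have [||||u [uq uU uu]] := @divisor_between q`_pi U P; rewrite ?part_gt0 ?expn_gt0 //.
  by move=> p pp pd; apply: pP => //; apply: dvdn_trans pd (dvdn_part _ _).
have Uu : (U <= u)%N by case: uu => // ->.
have uq' : (u %| q)%N by apply: dvdn_trans uq (dvdn_part _ _).
have u0 : (0 < u)%N by apply: dvdn_gt0 uq'.
(* The exponent is rounded up because T^m has to exceed q, which is only known to be below
   2^(L+1). *)
set T := (2 ^ (L %/ m).+1)%N.
have T0 : (0 < T)%N by rewrite expn_gt0.
have LU : (2 * L ^ (2 ^ m) <= 2 ^ (1 + l.+1 * 2 ^ m))%N.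
  by rewrite expnD expn1 leq_mul2l /= expnM leq_exp2r ?expn_gt0 // ltnW.
exists (u * (T * P * u))%N; split.
- by rewrite !muln_gt0 u0 T0 P0.
- apply: leq_trans (_ : T * P * (U * P) ^ 2 <= _)%N.
    by rewrite mulnCA leq_mul2l !expnS expn0 muln1 leq_mul // orbT.
  have -> : (T * P * (U * P) ^ 2 = T * U ^ 2 * P ^ 3)%N by rewrite expnMn; ring.
  rewrite leq_mul2r /T /U -expnM -expnD leq_exp2l //; apply/orP; right.
  have : (E * 2 <= L %/ m)%N; last by move: (E * 2)%N (L %/ m)%N => *; lia.
  rewrite leq_divRL // -mulnA; exact: leq_trans i1 Ll.
move=> e t ph; apply: (@char_block_bound _ q u m L T P) => //.
- rewrite /T -expnM; apply: leq_trans (ltnW qL') _; rewrite leq_exp2l //.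
  by have := ltn_ceil L m0; lia.
- move=> p pp pu; have : p \in pi; last by rewrite inE.
  by apply: pnatPpi (part_pnat pi q) _; rewrite mem_primes pp part_gt0 (dvdn_trans pu).
- apply: leq_trans Uu; rewrite /U /E [(2 ^ (3 * a2) * _)%N]mulnC [X in (_ <= X)%N]expnM leq_exp2r ?expn_gt0 //.
apply: leq_trans Uu; apply: leq_trans (_ : 2 ^ (m + 3) * 2 ^ (1 + l.+1 * 2 ^ m) <= _)%N.
  by rewrite leq_mul2l; apply/orP; right; apply: leq_trans LU; lia.
rewrite -expnD /U /E leq_exp2l //.
have a1 : (0 < a2)%N by rewrite expn_gt0 addnS.
have a4 : (2 ^ 2 <= 2 ^ (3 * a2))%N by rewrite leq_exp2l //; apply: leq_trans (leq_mul (leqnn 3) a1).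
have lM : (m < l.+1 * 2 ^ m)%N by apply: leq_trans (ltn_expl m (isT : (1 < 2)%N)) _; rewrite leq_pmull.
apply: leq_trans (leq_mul a4 (leqnn _)); move: (_ * 2 ^ m)%N lM => M; clear => lM; lia.
Qed.

(** * The Polya-Vinogradov expansion *)

Section Trigonometry.
Variable R : realType.
Implicit Types x y : R.

Lemma sin_le_id x : 0 <= x -> sin x <= x.
Proof.
move=> x0; have [|c _ e] := MVT_segment x0 (fun y _ => is_derive_sin y).
  by apply: continuous_subspaceT; apply: continuous_sin.
move: e; rewrite sin0 !subr0 => ->; apply: ler_piMl => //; exact: cos_le1.
Qed.

Lemma sin_le_norm x : `|sin x| <= `|x|.
Proof.
wlog x0 : x / 0 <= x => [H|].
  have [/H //|/ltW x0] := leP 0 x.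
  by rewrite -[`|x|]normrN -[`|sin x|]normrN -sinN; apply: H; rewrite oppr_ge0.
have xx := sin_le_id x0.
rewrite [`|x|]ger0_norm //; have [|/ltW s0] := leP 0 (sin x); first by move=> ?; rewrite ger0_norm.
rewrite ler0_norm // lerNl; have [x1|x1] := leP x 2; last by have := sin_geN1 x; lra.
have [->|xn] := eqVneq x 0; first by rewrite oppr0 sin0.
have [x2|x2] := ltP x 2; last first.
  by have := sin_geN1 x; lra.
have := @sin2_gt0 R x; rewrite lt_neqAle eq_sym xn x0 x2 => /(_ isT); lra.
Qed.

Lemma cos_lower x : 1 - x ^+ 2 / 2 <= cos x.
Proof.
have -> : cos x = 1 - sin (x / 2) ^+ 2 *+ 2.
  have {1}-> : x = (x / 2) *+ 2 by rewrite -mulr_natr divfK ?pnatr_eq0.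
  by rewrite cos_mulr2n cos2sin2; ring.
have : sin (x / 2) ^+ 2 <= (x / 2) ^+ 2.
  by rewrite -[X in X <= _]real_normK ?num_real // -[X in _ <= X]real_normK ?num_real // lerXn2r ?nnegrE // sin_le_norm.
rewrite -[_ *+ 2]mulr_natl; move: (sin _ ^+ 2) => s; rewrite !expr2; lra.
Qed.

(** A crude form of Jordan's inequality: the derivative is at least 1/2 on [0, 1], and beyond 1
    monotonicity suffices as pi / 2 < 2. *)
Lemma sin_lower x : 0 <= x <= pi / 2 -> x / 4 <= sin x.
Proof.
have small y : 0 <= y <= 1 -> y / 2 <= sin y.
  move=> /andP[y0 y1]; have [|c + e] := MVT_segment y0 (fun z _ => is_derive_sin z).
    by apply: continuous_subspaceT; apply: continuous_sin.
  rewrite in_itv /= => /andP[c0 cy]; move: e; rewrite sin0 !subr0 => ->.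
  have := cos_lower c; have : c ^+ 2 <= 1 by rewrite exprn_ile1 // (le_trans cy).
  move: (c ^+ 2) (cos c) => s C *; rewrite mulrC ler_wpM2r //; lra.
move=> /andP[x0 xp]; have [x1|x1] := leP x 1.
  by apply: le_trans (small x _); rewrite ?x0 ?x1 //; lra.
have : 1 / 2 <= sin (1 : R) by apply: small; rewrite ler01 lexx.
have : sin 1 < sin x.
  by rewrite ltr_sin // in_itv /=; have := pihalf_ge1 R; have := pi_ge2 R; lra.
have := pihalf_lt2 R; lra.
Qed.

Definition expi x : R[i] := (cos x) +i* (sin x).

Lemma expiD x y : expi (x + y) = expi x * expi y.
Proof. by rewrite /expi cosD sinD; apply/eqP; rewrite eq_complex /= eqxx addrC eqxx. Qed.

Lemma expi0 : expi 0 = 1.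
Proof. by rewrite /expi cos0 sin0. Qed.

Lemma nrm_complex (a b : R) : nrm (a +i* b) ^+ 2 = a ^+ 2 + b ^+ 2.
Proof. by rewrite nrm_sqr /= !expr2; ring. Qed.

Lemma nrm_expi x : nrm (expi x) = 1.
Proof.
apply/eqP; rewrite -(@pexpr_eq1 _ _ 2) ?nrm_ge0 //; apply/eqP.
by rewrite nrm_complex cos2Dsin2.
Qed.

Lemma expiN x : expi (- x) = (expi x)^*.
Proof. by rewrite /expi cosN sinN. Qed.

Lemma nrm_expiB1 x : nrm (expi x - 1) = 2 * `|sin (x / 2)|.
Proof.
apply/eqP; rewrite -(@eqrXn2 _ 2) ?nrm_ge0 ?mulr_ge0 //; apply/eqP.
have -> : expi x - 1 = (cos x - 1) +i* (sin x).
  by rewrite /expi; apply/eqP; rewrite eq_complex /= eqxx subr0 eqxx.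
rewrite nrm_complex exprMn real_normK ?num_real //.
have {1 2}-> : x = (x / 2) *+ 2 by rewrite -mulr_natr divfK ?pnatr_eq0.
rewrite cos_mulr2n sin_mulr2n.
have := cos2Dsin2 (x / 2); move: (cos (x / 2)) (sin (x / 2)) => c s e.
have ec : c ^+ 2 = 1 - s ^+ 2 by rewrite -e addrK.
have -> : ((c * s) *+ 2) ^+ 2 = (c ^+ 2 * s ^+ 2) *+ 4 by ring.
by rewrite ec; ring.
Qed.

Lemma harmonic_ln n : (0 < n)%N -> \sum_(i < n) (i.+1)%:R^-1 <= 1 + ln n%:R :> R.
Proof.
case: n => // n _; elim: n => [|n IH]; first by rewrite big_ord_recr big_ord0 /= add0r invr1 ln1 addr0.
rewrite big_ord_recr /=; apply: le_trans (lerD IH (lexx _)) _; rewrite -addrA lerD2l.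
have n1 : 0 < n.+1%:R :> R by rewrite ltr0n.
have n2 : 0 < n.+2%:R :> R by rewrite ltr0n.
rewrite -lerBrDl -lerN2 opprB -ln_div ?posrE //.
have -> : n.+1%:R / n.+2%:R = 1 - n.+2%:R^-1 :> R.
  apply: (mulIf (lt0r_neq0 n2)); rewrite divfK ?gt_eqF // mulrBl mul1r mulVf ?gt_eqF //.
  by rewrite -[n.+2%:R]natr1 addrK.
apply: le_ln1Dx; rewrite ltrN2 invf_lt1 // ltr1n //.
Qed.

End Trigonometry.

Section PolyaVinogradov.
Variable R : realType.

Lemma nrm_sum_blocks (psi : int -> R[i]) (N : nat) (d : R) t n : (0 < N)%N -> 0 <= d ->
  (forall k, nrm (psi k) <= 1) ->
  (forall t, nrm (\sum_(j < N) psi (t + j%:Z)) <= N%:R * d) ->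
  nrm (\sum_(j < n) psi (t + j%:Z)) <= d * n%:R + N%:R.
Proof.
move=> N0 d0 p1 blk; have [k le] := ubnP n; elim: k n t le => // k IH n t le.
have [nN|Nn] := ltnP n N.
  apply: le_trans (_ : n%:R <= _).
    apply: le_trans (ler_nrm_sum _ _ _) _.
    by apply: le_trans (ler_sum _ (fun i _ => p1 _)) _; rewrite sumr_const card_ord.
  by apply: le_trans (_ : N%:R <= _); rewrite ?ler_nat ?(ltnW nN) // lerDr mulr_ge0.
rewrite -(subnKC Nn) big_split_ord /=; apply: le_trans (ler_nrmD _ _) _.
have e : \sum_(i < n - N) psi (t + (N + i)%N%:Z) = \sum_(i < n - N) psi (t + N%:Z + i%:Z).
  by apply: eq_bigr => i _; rewrite PoszD addrA.
rewrite e natrD mulrDr -addrA lerD //; first by rewrite mulrC.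
by apply: IH; lia.
Qed.

Lemma abel_tail (psi : nat -> R[i]) (w : nat -> R[i]) A k :
  \sum_(i < k) psi i * w (A + i).+1 =
  (\sum_(i < k) psi i) * w (A + k)%N - \sum_(i < k) (\sum_(j < i) psi j) * (w (A + i).+1 - w (A + i)%N).
Proof.
elim: k => [|k IH]; first by rewrite !big_ord0 mul0r subrr.
rewrite !big_ord_recr /= IH !addnS; ring.
Qed.

(** Terms up to N are bounded trivially and give log N. Beyond N, partial summation uses the saving
    [d] on blocks, so that log q appears only with the factor [d]. The weight models 1 / (e(a/q) -
    1), of size q/a and with differences of size q/a^2. *)
Lemma weighted_sum_bound (psi : int -> R[i]) (w : nat -> R[i]) (N q Y : nat) (d : R) :
  (0 < N)%N -> (0 < q)%N -> 0 <= d ->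
  (forall k, nrm (psi k) <= 1) ->
  (forall t, nrm (\sum_(j < N) psi (t + j%:Z)) <= N%:R * d) ->
  (forall a, (0 < a)%N -> (2 * a <= q)%N -> nrm (w a) <= q%:R / a%:R) ->
  (forall a, (0 < a)%N -> (2 * a.+1 <= q)%N -> nrm (w a.+1 - w a) <= 8 * q%:R / (a%:R * a.+1%:R)) ->
  (2 * Y <= q)%N ->
  nrm (\sum_(i < Y) psi i.+1%:Z * w i.+1) <= q%:R * (10 + ln N%:R + 9 * d + 8 * d * ln q%:R).
Proof.
move=> N0 q0 d0 p1 blk w1 w2 Yq.
have lnN : 0 <= ln N%:R :> R by rewrite ln_ge0 // ler1n.
have lnq : 0 <= ln q%:R :> R by rewrite ln_ge0 // ler1n.
have qR : 0 < q%:R :> R by rewrite ltr0n.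
have head y : (2 * y <= q)%N -> (y <= N)%N ->
    nrm (\sum_(i < y) psi i.+1%:Z * w i.+1) <= q%:R * (1 + ln N%:R).
  case: y => [|y] yq yN; first by rewrite big_ord0 nrm0 mulr_ge0 ?addr_ge0 // ltW.
  apply: le_trans (ler_nrm_sum _ _ _) _.
  apply: (@le_trans _ _ (\sum_(i < y.+1) q%:R * (i.+1)%:R^-1)).
    apply: ler_sum => i _; rewrite nrmM; apply: le_trans (_ : nrm (w i.+1) <= _).
      by rewrite ler_piMl ?nrm_ge0.
    by apply: w1 => //; apply: leq_trans yq; rewrite leq_mul2l /= ltn_ord.
  rewrite -mulr_sumr ler_pM2l //; apply: le_trans (harmonic_ln R _) _ => //.
  by rewrite lerD2l ler_ln ?posrE ?ltr0n // ler_nat.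
have [YN|NY] := leqP Y N.
  apply: le_trans (head Y Yq YN) _; rewrite ler_pM2l //.
  have : 0 <= d * ln q%:R by rewrite mulr_ge0.
  rewrite -mulrA; move: (ln N%:R) (d * ln q%:R) => x y; lra.
set k := (Y - N)%N; have YE : Y = (N + k)%N by rewrite subnKC // ltnW.
have NR : 0 < N%:R :> R by rewrite ltr0n.
rewrite YE big_split_ord /=; apply: le_trans (ler_nrmD _ _) _.
have -> : q%:R * (10 + ln N%:R + 9 * d + 8 * d * ln q%:R)
   = q%:R * (1 + ln N%:R) + q%:R * (9 + 9 * d + 8 * d * ln q%:R) by ring.
apply: lerD; first by apply: head => //; lia.
rewrite (abel_tail (fun i => psi (N + i).+1%:Z) w).
have Ub i : nrm (\sum_(j < i) psi (N + j).+1%:Z) <= d * i%:R + N%:R.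
  have := nrm_sum_blocks (N.+1%:Z) i N0 d0 p1 blk.
  by congr (nrm _ <= _); apply: eq_bigr => j _; rewrite -PoszD.
apply: le_trans (ler_nrmB _ _) _.
have -> : q%:R * (9 + 9 * d + 8 * d * ln q%:R) = q%:R * (d + 1) + 8 * q%:R * (d * (1 + ln q%:R) + 1) by ring.
apply: lerD.
  rewrite nrmM; apply: le_trans (ler_pM _ _ (Ub k) (w1 _ _ _)) _; rewrite ?nrm_ge0 ?addn_gt0 ?N0 //; first lia.
  have NkR : 0 < (N + k)%:R :> R by rewrite ltr0n addn_gt0 N0.
  rewrite mulrCA ler_pM2l // ler_pdivrMr // natrD.
  have : 0 <= d * N%:R by rewrite mulr_ge0.
  have : 0 <= k%:R :> R by [].
  rewrite mulrDl mul1r mulrDr; move: (d * N%:R) (d * k%:R) (k%:R) => x y z; lra.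
apply: le_trans (ler_nrm_sum _ _ _) _.
apply: (@le_trans _ _ (\sum_(i < k) 8 * q%:R * (d * i.+1%:R^-1 + (N%:R * (N + i)%:R^-1 - N%:R * (N + i).+1%:R^-1)))).
  apply: ler_sum => i _; rewrite nrmM.
  apply: le_trans (ler_pM _ _ (Ub i) (w2 _ _ _)) _; rewrite ?nrm_ge0 ?addn_gt0 ?N0 //.
    by have := ltn_ord i; lia.
  rewrite mulrCA ler_pM2l ?mulr_gt0 //.
  have a0 : 0 < (N + i)%:R :> R by rewrite ltr0n addn_gt0 N0.
  have a1 : 0 < (N + i).+1%:R :> R by rewrite ltr0n.
  have -> : N%:R * (N + i)%:R^-1 - N%:R * (N + i).+1%:R^-1 = N%:R / ((N + i)%:R * (N + i).+1%:R) :> R.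
    move: a0 a1; rewrite -[(N + i).+1%:R]natr1; move: ((N + i)%:R) => x x0 x1.
    by field; rewrite !gt_eqF.
  rewrite mulrDl lerD2r -mulrA ler_wpM2l // invfM.
  apply: le_trans (_ : (N + i)%:R * ((N + i)%:R^-1 * (N + i).+1%:R^-1) <= _).
    by apply: ler_wpM2r; rewrite ?ler_nat ?leq_addl // mulr_ge0 // invr_ge0.
  by rewrite mulVKf ?gt_eqF // lef_pV2 ?posrE ?ltr0n // ler_nat ltnS leq_addl.
rewrite -mulr_sumr ler_pM2l ?mulr_gt0 // big_split /= lerD //.
  rewrite -mulr_sumr ler_wpM2l //; have [->|k0] := posnP k; first by rewrite big_ord0 addr_ge0.
  apply: le_trans (harmonic_ln R k0) _; rewrite lerD2l ler_ln ?posrE ?ltr0n // ler_nat; lia.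
rewrite -(big_mkord xpredT (fun i => N%:R * (N + i)%:R^-1 - N%:R * (N + i).+1%:R^-1)).
rewrite (eq_bigr (fun i => - (N%:R * (N + i.+1)%:R^-1 - N%:R * (N + i)%:R^-1))); last first.
  by move=> i _; rewrite opprB addnS.
rewrite sumrN telescope_sumr // opprB addn0 mulfV ?gt_eqF // gerBl.
by rewrite mulr_ge0 ?invr_ge0.
Qed.

Variable q : nat.
Hypothesis q1 : (1 < q)%N.

Let q0 : (0 < q)%N. Proof. exact: ltnW. Qed.
Let qR : 0 < q%:R :> R. Proof. by rewrite ltr0n. Qed.

Definition addchar (k : int) : R[i] := expi (k%:~R * (pi *+ 2) / q%:R).

Lemma addcharD a b : addchar (a + b) = addchar a * addchar b.
Proof. by rewrite /addchar intrD !mulrDl expiD. Qed.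

Lemma addchar0 : addchar 0 = 1.
Proof. by rewrite /addchar !mul0r expi0. Qed.

Lemma nrm_addchar a : nrm (addchar a) = 1.
Proof. exact: nrm_expi. Qed.

Lemma addcharN a : addchar (- a) = (addchar a)^*.
Proof. by rewrite /addchar intrN !mulNr expiN. Qed.

Lemma addchar_periodic : mod_periodic q addchar.
Proof.
move=> a; rewrite addcharD -[RHS]mulr1; congr (_ * _).
rewrite /addchar mulrC mulrA mulVf ?gt_eqF // mul1r.
by rewrite /expi cos2pi sin2pi.
Qed.

Lemma addcharX a n : addchar (a * n%:Z) = addchar a ^+ n.
Proof.
elim: n => [|n IH]; first by rewrite mulr0 addchar0.
by rewrite intS mulrDr mulr1 addcharD IH exprS.
Qed.

Lemma addchar_arg (a : nat) : a%:Z%:~R * (pi *+ 2) / q%:R / 2 = pi * (a%:R / q%:R) :> R.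
Proof. by rewrite -mulr_natl -pmulrn; field; rewrite gt_eqF. Qed.

Lemma nrm_addcharB1_lower (a : nat) : (2 * a <= q)%N -> a%:R / q%:R <= nrm (addchar a%:Z - 1).
Proof.
move=> aq; rewrite nrm_expiB1 addchar_arg.
have aq2 : a%:R / q%:R <= 1 / 2 :> R.
  by rewrite ler_pdivrMr // mulrAC mul1r ler_pdivlMr // -natrM ler_nat mulnC.
set x : R := a%:R / q%:R in aq2 *; have x0 : 0 <= x by rewrite divr_ge0.
have p2 := pi_ge2 R.
have xp : 0 <= pi * x <= pi / 2.
  by rewrite mulr_ge0 ?ler_pM2l ?pi_gt0 // ?(le_trans _ p2) //; move: aq2; rewrite mul1r.
have s := sin_lower xp.
apply: le_trans (ler_wpM2l _ (ler_norm _)) => //.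
have : 2 * x <= pi * x by rewrite ler_wpM2r.
lra.
Qed.

Lemma nrm_addchar1B1_upper : nrm (addchar 1 - 1) <= 8 / q%:R.
Proof.
rewrite nrm_expiB1 (addchar_arg 1); apply: le_trans (ler_wpM2l _ (sin_le_norm _)) _ => //.
have p4 := pihalf_lt2 R; have p0 := pi_gt0 R.
rewrite ger0_norm; last by rewrite mulr_ge0 ?divr_ge0 ?pi_ge0.
rewrite mul1r mulrA ler_pM2r ?invr_gt0 //; lra.
Qed.

Lemma addchar_neq1 (a : nat) : (0 < a < q)%N -> addchar a%:Z != 1.
Proof.
move=> /andP[a0 aq]; rewrite -subr_eq0 -nrm_eq0 nrm_expiB1 addchar_arg gt_eqF // mulr_gt0 //.
rewrite normr_gt0 gt_eqF // sin_gt0_pi // mulr_gt0 ?pi_gt0 ?divr_gt0 ?ltr0n //=.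
by rewrite -[ltRHS]mulr1 ltr_pM2l ?pi_gt0 // ltr_pdivrMr // mul1r ltr_nat.
Qed.

Lemma addchar_sum (a : nat) : (0 < a < q)%N -> \sum_(n < q) addchar (a%:Z * n%:Z) = 0.
Proof.
move=> aq; have ne : addchar a%:Z - 1 != 0 by rewrite subr_eq0 addchar_neq1.
apply: (mulfI ne); rewrite mulr0.
under eq_bigr do rewrite addcharX.
rewrite -subrX1 -addcharX -[a%:Z * _]add0r mulrC (periodicM 0 a%:Z addchar_periodic) addchar0 subrr //.
Qed.

Lemma phase_like_addchar (c : int) : phase_like (fun n => addchar (c * n)).
Proof.
split=> [n|a]; first by rewrite nrm_addchar.
exists (addchar (c * a)); first by rewrite nrm_addchar.
move=> n; rewrite /mder mulrDr addcharD mulrAC mulcJ nrm_addchar expr1n mul1r //.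
Qed.

End PolyaVinogradov.

(** * Gauss sums and completion of the character sum *)

Section GaussSum.
Variable R : realType.
Variables (q : nat) (chi : int -> R[i]).
Hypothesis q1 : (1 < q)%N.
Hypothesis gd : good_char q chi.
Local Notation E := (@addchar R q).

Let q0 : (0 < q)%N. Proof. exact: ltnW. Qed.
Let qR : 0 < q%:R :> R. Proof. by rewrite ltr0n. Qed.

Let psi n := (chi n)^*.

Let dpsi : dirichlet_char q psi.
Proof.
case: gd => -[pc mc ec] _; split => [n|m n|n]; rewrite /psi; first by rewrite pc.
- by rewrite mc rmorphM.
- by rewrite conjc_eq0 ec.
Qed.

Let gsum n : R[i] := \sum_(a < q) psi a%:Z * E (a%:Z * n).

Let gsum_scale c n : coprimez c q%:Z -> gsum n = psi c * gsum (c * n).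
Proof.
move=> cc; case: dpsi => pp mp _.
have pF : mod_periodic q (fun a => psi a * E (a * n)).
  by move=> a; rewrite pp mulrDl [q%:Z * n]mulrC (mulrC n) (periodicM _ n (addchar_periodic R q1)).
rewrite /gsum -(sum_periodic_affine 0 q0 pF cc) mulr_sumr; apply: eq_bigr => a _.
by rewrite addr0 mp -mulrA; congr (_ * (_ * E _)); ring.
Qed.

(** If n is not coprime to q, then gsum n must vanish. For a prime p dividing both, the c given by
    local nonprincipality satisfies c n = n modulo q, so [gsum_scale] yields gsum n = psi c * gsum n
    with psi c different from 1. *)
Lemma gsum_char n : chi n * gsum 1 = gsum n.
Proof.
have [cn|ncn] := boolP (coprimez n q%:Z).
  rewrite (gsum_scale 1 cn) mulr1 mulrA mulcJ (dchar_nrm q0 (proj1 gd) cn) expr1n mul1r //.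
have -> : chi n = 0 by apply/eqP; case: (proj1 gd) => _ _ ->.
rewrite mul0r; apply/esym.
pose g := gcdn `|n| q.
have g1 : (1 < g)%N.
  rewrite ltn_neqAle gcdn_gt0 q0 orbT andbT eq_sym; move: ncn.
  by rewrite coprimezE /coprime.
have pg := pdiv_dvd g; have pp := pdiv_prime g1.
have pn : (pdiv g %| `|n|)%N by apply: dvdn_trans pg (dvdn_gcdl _ _).
have pq : (pdiv g %| q)%N by apply: dvdn_trans pg (dvdn_gcdr _ _).
have [c [cc c1 nc]] := proj2 gd _ pp pq.
have cn : (c * n = n %[mod q%:Z])%Z.
  apply/eqP; rewrite eqz_mod_dvd -[X in _ - X]mul1r -mulrBl.
  have -> : q%:Z = (q %/ pdiv g)%N%:Z * (pdiv g)%:Z by rewrite -PoszM divnK.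
  apply: dvdz_mul; last by rewrite dvdzE.
  by rewrite -eqz_mod_dvd; apply/eqP.
have pgs : mod_periodic q gsum.
  move=> k; apply: eq_bigr => a _; congr (_ * _).
  by rewrite mulrDr [a%:Z * q%:Z]mulrC (periodicM _ a%:Z (addchar_periodic R q1)).
have e : gsum n = psi c * gsum n by rewrite {1}(gsum_scale n cc) (periodic_eqmod pgs cn).
apply: contrapT => ne; apply: nc; rewrite -[chi c]conjcK -/(psi c).
have /(congr1 (fun z => z^*)) : psi c = 1.
  by apply: (mulIf (introN eqP ne)); rewrite mul1r -e.
by rewrite rmorph1.
Qed.

Let addchar_orth (a b : 'I_q) : \sum_(n < q) E ((a%:Z - b%:Z) * n%:Z) = ((a == b)%:R * q%:R).
Proof.
have [->|ne] := eqVneq a b.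
  by under eq_bigr do rewrite subrr mul0r addchar0; rewrite sumr_const card_ord mul1r.
rewrite mul0r; have [ab|ba|ab] := ltngtP a b; last by move/val_inj: ab ne => ->; rewrite eqxx.
  have -> : a%:Z - b%:Z = - (b - a)%N%:Z by rewrite -subzn ?opprB // ltnW.
  under eq_bigr do rewrite mulNr addcharN.
  by rewrite -rmorph_sum addchar_sum ?rmorph0 // subn_gt0 ab (leq_ltn_trans (leq_subr _ _)).
have -> : a%:Z - b%:Z = (a - b)%N%:Z by rewrite -subzn // ltnW.
by rewrite addchar_sum // subn_gt0 ba (leq_ltn_trans (leq_subr _ _)).
Qed.

(* By Parseval, since |gsum n| = |chi n| |gsum 1|. *)
Lemma gsum_norm : nrm (gsum 1) ^+ 2 = q%:R.
Proof.
have parseval : \sum_(n < q) gsum n%:Z * (gsum n%:Z)^* = (q%:R * \sum_(a < q) nrm (chi a%:Z) ^+ 2)%:C.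
  transitivity (\sum_(a < q) \sum_(b < q) psi a%:Z * (psi b%:Z)^* *
       \sum_(n < q) E ((a%:Z - b%:Z) * n%:Z)).
    under eq_bigr do rewrite /gsum rmorph_sum big_distrlr /=.
    rewrite exchange_big /=; apply: eq_bigr => a _; rewrite exchange_big /=; apply: eq_bigr => b _.
    rewrite mulr_sumr; apply: eq_bigr => n _.
    by rewrite rmorphM mulrACA mulrBl addcharD addcharN.
  rewrite mulr_sumr rmorph_sum; apply: eq_bigr => a _ /=.
  rewrite (bigD1 a) //= addchar_orth eqxx mul1r big1 ?addr0; last first.
    by move=> b ba; rewrite addchar_orth eq_sym (negbTE ba) mul0r mulr0.
  by rewrite mulcJ nrmJ [RHS](rmorphM (real_complex R)) (rmorph_nat (real_complex R)) mulrC.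
move: parseval; under eq_bigr do rewrite -gsum_char mulcJ nrmM exprMn.
rewrite -rmorph_sum -mulr_suml => /complexI; rewrite mulrC; apply: mulIf.
rewrite gt_eqF //; pose i1 := Ordinal q1.
rewrite (bigD1 i1) //= (dchar1 (proj1 gd)) nrm1 expr1n ltr_pwDl // sumr_ge0 // => i _.
by rewrite exprn_ge0 ?nrm_ge0.
Qed.

Variables (N : nat) (d : R).
Hypothesis N0 : (0 < N)%N.
Hypothesis d0 : 0 <= d.
Hypothesis block : forall e t, phase_like e ->
  nrm (\sum_(n < N) e (t + n%:Z) * chi (t + n%:Z)) <= N%:R * d.
Local Notation B := (10 + ln N%:R + 9 * d + 8 * d * ln q%:R).

Let half_sum (s c : int) Y : (s = 1) \/ (s = -1) -> (2 * Y <= q)%N ->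
  nrm (\sum_(i < Y) psi (s * i.+1%:Z) * E (s * i.+1%:Z * c) / (E (s * i.+1%:Z) - 1)) <= q%:R * B.
Proof.
move=> s1 Yq; case: (dpsi) => _ mp _.
pose w (a : nat) := (E (s * a%:Z) - 1)^-1.
pose ps k := psi k * E (s * c * k).
have ps1 k : nrm (ps k) <= 1.
  by rewrite nrmM nrm_addchar mulr1 nrmJ; apply: dchar_le1 q0 (proj1 gd).
have sq (a : nat) : nrm (E (s * a%:Z) - 1) = nrm (E a%:Z - 1).
  case: s1 => ->; rewrite ?mul1r // mulN1r addcharN -[RHS]nrmJ; congr nrm.
  by rewrite rmorphB rmorph1.
have lower (a : nat) : (0 < a)%N -> (2 * a <= q)%N -> 0 < a%:R / q%:R :> R /\ a%:R / q%:R <= nrm (E (s * a%:Z) - 1).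
  by move=> a0 aq; split; [rewrite divr_gt0 ?ltr0n | rewrite sq nrm_addcharB1_lower].
have w1 a : (0 < a)%N -> (2 * a <= q)%N -> nrm (w a) <= q%:R / a%:R.
  move=> a0 aq; have [l0 l1] := lower a a0 aq.
  by rewrite nrmV -[q%:R / _]invf_div lef_pV2 ?posrE // (lt_le_trans l0).
have w2 a : (0 < a)%N -> (2 * a.+1 <= q)%N -> nrm (w a.+1 - w a) <= 8 * q%:R / (a%:R * a.+1%:R).
  move=> a0 aq1; have aq : (2 * a <= q)%N by lia.
  have [l0 l1] := lower a a0 aq; have [k0 k1] := lower a.+1 isT aq1.
  have n0 : E (s * a%:Z) - 1 != 0 by rewrite -nrm_eq0 gt_eqF // (lt_le_trans l0).
  have n1 : E (s * a.+1%:Z) - 1 != 0 by rewrite -nrm_eq0 gt_eqF // (lt_le_trans k0).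
  have -> : w a.+1 - w a = - (E (s * a%:Z) * (E (s * 1%:Z) - 1)) * (w a * w a.+1).
    rewrite /w; move: n1; have -> : E (s * a.+1%:Z) = E (s * a%:Z) * E (s * 1%:Z).
      by rewrite intS mulrDr addrC addcharD.
    move: (E (s * a%:Z)) (E (s * 1%:Z)) n0 => x y xn yn.
    by field; rewrite xn yn.
  rewrite nrmM nrmN !nrmM nrm_addchar mul1r sq.
  apply: le_trans (_ : 8 / q%:R * (q%:R / a%:R * (q%:R / a.+1%:R)) <= _).
    apply: ler_pM; rewrite ?mulr_ge0 ?nrm_ge0 //; first exact: nrm_addchar1B1_upper.
    by apply: ler_pM; rewrite ?nrm_ge0 ?w1.
  rewrite le_eqVlt; apply/orP; left; apply/eqP.
  have : a%:R != 0 :> R by rewrite pnatr_eq0 -lt0n.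
  have : a.+1%:R != 0 :> R by rewrite pnatr_eq0.
  move: (a%:R) (a.+1%:R) => x y y0 x0; field.
  by rewrite x0 y0 gt_eqF.
have blk t : nrm (\sum_(j < N) ps (t + j%:Z)) <= N%:R * d.
  (* Conjugation turns a sum of [psi] into a sum of [chi] with the opposite phase, to which [block]
     applies. *)
  have ph := phase_like_addchar R q (- (s * c)).
  have := block t ph; rewrite -nrmJ rmorph_sum; congr (nrm _ <= _); apply: eq_bigr => j _.
  rewrite /ps; have -> : s * c * (t + j%:Z) = - (- (s * c) * (t + j%:Z)) by rewrite mulNr opprK.
  by rewrite addcharN -rmorphM mulrC.
have := weighted_sum_bound N0 q0 d0 ps1 blk w1 w2 Yq.
have psis : nrm (psi s) = 1.
  rewrite nrmJ; apply: dchar_nrm q0 (proj1 gd) _.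
  by case: s1 => ->; rewrite coprimezE coprime1n.
set S := \sum_(i < Y) ps _ * _; set S' := \sum_(i < Y) _.
have -> : S' = psi s * S; last by rewrite nrmM psis mul1r.
rewrite /S mulr_sumr; apply: eq_bigr => i _.
by rewrite /ps mp -!mulrA; congr (_ * (_ * (E _ * _))); ring.
Qed.

(** Expand [chi] in additive characters by [gsum_char]. The residues a are centred at 0, where
    e(a/q) - 1 has size at least |a|/q, and a = 0 contributes nothing. The closed form of the
    geometric sum has two terms and a has two signs, whence the constant 4; the summation index
    starts at 1, whence the frequencies X + 1 and 1. *)
Lemma polya_vinogradov (X : nat) :
  nrm (\sum_(n < X) chi n.+1%:Z) <= 4 * Num.sqrt q%:R * B.
Proof.
set S := \sum_(n < X) _.
pose G (a : int) := psi a * (\sum_(n < X) E (a * n.+1%:Z)).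
have gS : gsum 1 * S = \sum_(a < q) G a%:Z.
  rewrite mulr_sumr; under eq_bigr do rewrite mulrC gsum_char.
  by rewrite /gsum exchange_big /=; apply: eq_bigr => a _; rewrite /G mulr_sumr.
have pG : mod_periodic q G.
  move=> a; case: dpsi => pp _ _; rewrite /G pp; congr (_ * _); apply: eq_bigr => n _.
  by rewrite mulrDl (periodicM _ _ (addchar_periodic R q1)).
pose h := q./2; pose Y := (q.-1 - h)%N.
have hq : (2 * h <= q)%N by rewrite /h; lia.
have Yq : (2 * Y <= q)%N by rewrite /Y /h; lia.
have qE : q = (Y + h.+1)%N by rewrite /Y /h; lia.
have G0 : G 0 = 0.
  rewrite /G; have -> : psi 0 = 0; last by rewrite mul0r.
  by apply/eqP; case: dpsi => _ _ ->; rewrite coprimezE /coprime gcd0n gtn_eqF.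
have split : \sum_(a < q) G a%:Z = \sum_(i < Y) G (-1 * i.+1%:Z) + \sum_(i < h) G (1 * i.+1%:Z).
  rewrite -(sum_periodic_shift (- Y%:Z) pG) [in LHS]qE big_split_ord /= big_ord_recl /= addn0 addNr G0 add0r.
  congr (_ + _).
    rewrite (reindex_inj rev_ord_inj) /=; apply: eq_bigr => i _; congr G.
    by rewrite -subzn // addKr mulN1r.
  by apply: eq_bigr => i _; congr G; rewrite mul1r /bump /= PoszD addKr.
have part (s : int) y : (s = 1) \/ (s = -1) -> (2 * y <= q)%N ->
    nrm (\sum_(i < y) G (s * i.+1%:Z)) <= 2 * (q%:R * B).
  move=> s1 yq.
  have -> : \sum_(i < y) G (s * i.+1%:Z)
     = \sum_(i < y) psi (s * i.+1%:Z) * E (s * i.+1%:Z * X.+1%:Z) / (E (s * i.+1%:Z) - 1)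
     - \sum_(i < y) psi (s * i.+1%:Z) * E (s * i.+1%:Z * 1) / (E (s * i.+1%:Z) - 1).
    rewrite -sumrB; apply: eq_bigr => i _; rewrite /G -!mulrA -mulrBr; congr (_ * _).
    set a := s * _; have ne : E a - 1 != 0.
      have iq : (0 < i.+1 < q)%N by have := ltn_ord i; lia.
      have := addchar_neq1 R q1 iq; rewrite -subr_eq0 => n1; rewrite /a.
      case: s1 => ->; rewrite ?mul1r // mulN1r addcharN; apply: contra n1 => /eqP e.
      by rewrite -conjc_eq0 rmorphB rmorph1 e.
    apply: (mulIf ne); rewrite mulrBl !divfK // mulr1 mulrC.
    under eq_bigr do rewrite addcharX exprS.
    rewrite -mulr_sumr mulrCA -subrX1 mulrBr mulr1 -exprS -addcharX.
    by rewrite /a -mulrA.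
  apply: le_trans (ler_nrmB _ _) _; rewrite mulr2n mulrDl mul1r.
  by rewrite lerD //; apply: half_sum.
have gs : nrm (gsum 1) = Num.sqrt q%:R by rewrite -gsum_norm sqrtr_sqr ger0_norm ?nrm_ge0.
have sq0 : 0 < Num.sqrt q%:R :> R by rewrite sqrtr_gt0.
rewrite -(ler_pM2l sq0) -{1}gs -nrmM gS split; apply: le_trans (ler_nrmD _ _) _.
apply: le_trans (lerD (part (-1) Y _ Yq) (part 1 h _ hq)) _; [by right|by left|].
rewrite le_eqVlt; apply/orP; left; apply/eqP.
have e : q%:R = Num.sqrt q%:R * Num.sqrt q%:R :> R by rewrite -expr2 sqr_sqrtr // ltW.
move: e; move: (Num.sqrt _) (10 + _ + _ + _) => r b ->; ring.
Qed.

End GaussSum.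

(** * Comparison of the parameters *)

Section FinalNumerics.
Variable R : realType.
Implicit Types x y a b : R.

Lemma expR_double x a b : expR x <= a -> a * a <= b -> expR (x * 2) <= b.
Proof.
move=> xa; apply: le_trans; have -> : x * 2 = x + x by rewrite mulr2n mulrDr mulr1.
by rewrite expRD ler_pM ?expR_ge0.
Qed.

Lemma expR_small x a : x < 1 -> 1 <= a * (1 - x) -> expR x <= a.
Proof.
move=> x1 ax; have e : expR (- x) >= 1 - x by have := expR_ge1Dx (- x).
rewrite expRN in e.
have x0 : 0 < 1 - x by rewrite subr_gt0.
have := expR_gt0 x; move: e; move: (expR x) => E e E0.
have : (1 - x) * E <= E^-1 * E by rewrite ler_wpM2r // ltW.
rewrite mulVf ?gt_eqF //.
move=> le; rewrite -(ler_pM2l x0); apply: le_trans le _; by rewrite mulrC.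
Qed.

(** Repeated squaring, starting from exp(x) <= 1 / (1 - x) at x = 1/128; the fractions are
    successive upper roundings. The next lemma does the same at 131/48, and together they give e^e <
    16. *)
Lemma expR1_bound : expR 1 <= 131 / 48 :> R.
Proof.
rewrite [X in expR X](_ : 1 = 1 / 128 * 2 * 2 * 2 * 2 * 2 * 2 * 2); last lra.
apply: (@expR_double _ (375 / 227)); last lra.
apply: (@expR_double _ (437 / 340)); last lra.
apply: (@expR_double _ (1009 / 890)); last lra.
apply: (@expR_double _ (855 / 803)); last lra.
apply: (@expR_double _ (2234 / 2165)); last lra.
apply: (@expR_double _ (257 / 253)); last lra.
apply: (@expR_double _ (128 / 127)); last lra.
by apply: expR_small; lra.
Qed.

Lemma expR_expR1_bound : expR (131 / 48) < 16 :> R.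
Proof.
suff : expR (131 / 48) <= 15 + 9 / 10 :> R by lra.
rewrite [X in expR X](_ : _ = 131 / 12288 * 2 * 2 * 2 * 2 * 2 * 2 * 2 * 2); last lra.
apply: (@expR_double _ (2701 / 685)); last lra.
apply: (@expR_double _ (139 / 70)); last lra.
apply: (@expR_double _ (1078 / 765)); last lra.
apply: (@expR_double _ (2627 / 2213)); last lra.
apply: (@expR_double _ (2227 / 2044)); last lra.
apply: (@expR_double _ (1525 / 1461)); last lra.
apply: (@expR_double _ (2499 / 2446)); last lra.
apply: (@expR_double _ (469 / 464)); last lra.
by apply: expR_small; lra.
Qed.

(* This is what makes the triple logarithm bounded below by a positive constant. *)
Lemma ln_ln16_gt1 : 1 < ln (ln 16) :> R.
Proof.
have e : expR 1 < ln 16 :> R.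
  rewrite -ltr_expR [X in _ < X]lnK ?posrE // (le_lt_trans _ expR_expR1_bound) //.
  by rewrite ler_expR expR1_bound.
by rewrite -[X in X < _]expRK ltr_ln ?posrE ?expR_gt0 // (lt_trans _ e) ?expR_gt0.
Qed.

Lemma ln2_bounds : 1 / 2 <= ln (2 : R) <= 1.
Proof.
have e1 : expR (1 / 2) <= 2 :> R by apply: expR_small; lra.
have e2 : 2 <= expR 1 :> R by have := expR_ge1Dx (1 : R); lra.
apply/andP; split; first by rewrite -[X in X <= _]expRK ler_ln ?posrE ?expR_gt0.
by rewrite -[X in _ <= X]expRK ler_ln ?posrE ?expR_gt0.
Qed.

Lemma ln_le_pow2 n k : (0 < n)%N -> (n <= 2 ^ k)%N -> ln n%:R <= k%:R :> R.
Proof.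
move=> n0 nk; apply: le_trans (_ : ln (2 ^ k)%:R <= _).
  by rewrite ler_ln ?posrE ?ltr0n ?expn_gt0 // ler_nat.
rewrite natrX lnXn // -[ln _ *+ k]mulr_natl ler_piMr //; by have /andP[] := ln2_bounds.
Qed.

End FinalNumerics.

Lemma le_root4 (R : realType) (t D : R) : 0 <= t -> t ^+ 4 <= D -> t <= D `^ (1 / 4%:R).
Proof.
move=> t0 tD; have -> : t = (t ^+ 4) `^ (1 / 4%:R).
  by rewrite -powR_mulrn // -powRrM mul1r mulfV ?powRr1 // pnatr_eq0.
apply: ge0_ler_powR => //; rewrite ?nnegrE ?exprn_ge0 ?divr_ge0 //.
by apply: le_trans tD; rewrite exprn_ge0.
Qed.

Section SizeParameters.
Variables (R : realType) (q : nat).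
Hypothesis q16 : (16 <= q)%N.
Local Notation L := (trunc_log 2 q).
Local Notation l := (trunc_log 2 L).
Local Notation l1 := (ln q%:R : R).
Local Notation l2 := (ln l1).
Local Notation l3 := (ln l2).

Let q0 : (0 < q)%N. Proof. exact: leq_trans q16. Qed.
Let L4 : (4 <= L)%N. Proof. by rewrite trunc_log_max. Qed.
Let qL : (2 ^ L <= q)%N. Proof. exact: trunc_logP. Qed.
Let Ll : (2 ^ l <= L)%N. Proof. by apply: trunc_logP => //; apply: leq_trans L4. Qed.
Let Ll' : (L < 2 ^ l.+1)%N. Proof. exact: trunc_log_ltn. Qed.

Lemma lnq_gt1 : 1 < l1.
Proof.
have c := ln_ln16_gt1 R; have : 1 < ln 16 :> R.
  rewrite ltNge; apply/negP => le; have := ln_le0 le; lra.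
by move/lt_le_trans; apply; rewrite ler_ln ?posrE ?ltr0n // ler_nat.
Qed.

Lemma lnlnq_gt1 : 1 < l2.
Proof.
apply: lt_le_trans (ln_ln16_gt1 R) _; rewrite ler_ln ?posrE ?ln_gt0 ?ltr1n //.
- by rewrite ler_ln ?posrE ?ltr0n // ler_nat.
by apply: leq_trans q16.
Qed.

Lemma lnlnlnq_lower : ln (ln (ln 16)) <= l3.
Proof.
have c := ln_ln16_gt1 R; rewrite ler_ln ?posrE; [|lra|have := lnlnq_gt1; lra].
rewrite ler_ln ?posrE ?ln_gt0 ?ltr1n //; last by apply: leq_trans q16.
by rewrite ler_ln ?posrE ?ltr0n // ler_nat.
Qed.

Lemma lnq_upper : l1 <= 2 * L%:R.
Proof.
apply: le_trans (ln_le_pow2 R q0 (ltnW (trunc_log_ltn q _))) _ => //.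
by rewrite -natrM ler_nat; lia.
Qed.

Lemma lnq_lower : L%:R <= 2 * l1.
Proof.
have : ln (2 ^ L)%:R <= l1 by rewrite ler_ln ?posrE ?ltr0n ?expn_gt0 // ler_nat.
rewrite natrX lnXn // -[ln _ *+ _]mulr_natl; have /andP[h _] := ln2_bounds R.
have : L%:R * (1 / 2) <= L%:R * ln 2 :> R by rewrite ler_wpM2l.
move: (L%:R) (L%:R * ln 2) => x y; lra.
Qed.

Lemma lnlnq_upper : l2 <= l%:R + 2.
Proof.
have h : l1 <= (2 * L)%:R by rewrite natrM lnq_upper.
have : ln (2 * L)%:R <= l.+2%:R :> R.
  apply: ln_le_pow2; first by rewrite muln_gt0 (leq_trans _ L4).
  by rewrite expnS leq_mul2l ltnW.
have -> : l.+2%:R = l%:R + 2 :> R by rewrite -addn2 natrD.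
move=> h2; apply: (le_trans _ h2).
have l10 : 0 < l1 by have := lnq_gt1; lra.
by rewrite ler_ln ?posrE // (lt_le_trans l10).
Qed.

End SizeParameters.

(** 490 = 10 * 7^2 is the first value of l that admits m = 1. The largest admissible m satisfies l <
    10 (m + 7)^2, and m + 7 <= 8 m produces 640. *)
Lemma exists_depth l : (490 <= l)%N ->
  exists m, [/\ (0 < m)%N, (m <= l)%N, (10 * (m + 6) ^ 2 <= l)%N & (l < 640 * m ^ 2)%N].
Proof.
move=> l490; have ex : exists m, (10 * (m + 6) ^ 2 <= l)%N by exists 1%N.
have bd m : (10 * (m + 6) ^ 2 <= l)%N -> (m <= l)%N by apply: leq_trans; nia.
case: (ex_maxnP ex bd) => m ml mmax; exists m.
have m0 : (0 < m)%N by apply: mmax.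
split=> //; first exact: bd.
rewrite ltnNge; apply/negP => le.
suff : (m.+1 <= m)%N by rewrite ltnn.
by apply: mmax; apply: leq_trans le; nia.
Qed.

(** * Combination of the block bound with the expansion *)

Section MainBound.
Variables (R : realType) (q : nat) (chi : int -> R[i]).
Hypothesis q16 : (16 <= q)%N.
Hypothesis sq : squarefree q.
Hypothesis gd : good_char q chi.
Local Notation L := (trunc_log 2 q).
Local Notation l := (trunc_log 2 L).
Local Notation P := (max_pdiv q).
Local Notation l1 := (ln q%:R : R).
Local Notation l2 := (ln l1).
Local Notation l3 := (ln l2).
Local Notation D := (l3 ^+ 2 / l2 + l3 ^+ 2 * ln P%:R / l1).

(** The numerator is 8, from the convexity of the fourth power, times 2 * 640^2, from the bound for
    m^(-4); the denominator is the value of the squared triple logarithm at q = 16, where it is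
    least. *)
Definition loss : R := 16 * (640 * 640) / ln (ln (ln 16)) ^+ 2.

Let c0 : 0 < ln (ln (ln 16)) :> R. Proof. by rewrite ln_gt0 // ln_ln16_gt1. Qed.

Lemma loss_gt0 : 0 < loss.
Proof. by rewrite divr_gt0 ?mulr_gt0 ?exprn_gt0. Qed.

Let P0 : (0 < P)%N. Proof. exact: max_pdiv_gt0. Qed.
Let lnP0 : 0 <= ln P%:R :> R. Proof. by rewrite ln_ge0 // ler1n. Qed.
Let l1_gt1 : 1 < l1. Proof. exact: lnq_gt1. Qed.
Let l2_gt1 : 1 < l2. Proof. exact: lnlnq_gt1. Qed.

Let loss_D : 16 * (640 * 640) * (l2^-1 + ln P%:R / l1) <= loss * D.
Proof.
have l3c : ln (ln (ln 16)) ^+ 2 <= l3 ^+ 2.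
  have le := lnlnlnq_lower R q16.
  by rewrite lerXn2r // nnegrE; [exact: ltW | exact: le_trans (ltW c0) le].
have l20 : 0 < l2 by apply: lt_trans l2_gt1.
have l10 : 0 < l1 by apply: lt_trans l1_gt1.
have -> : D = l3 ^+ 2 * (l2^-1 + ln P%:R / l1) by rewrite mulrDr mulrA.
rewrite [X in _ <= X]mulrA ler_wpM2r //; first by rewrite addr_ge0 ?invr_ge0 ?divr_ge0 // ltW.
rewrite /loss mulrAC ler_pdivlMr ?exprn_gt0 //; apply: ler_wpM2l => //; lra.
Qed.

Lemma char_sum_small (X : nat) : exists2 tau, 0 <= tau /\ tau ^+ 4 <= loss * D &
  nrm (\sum_(n < X) chi n.+1%:Z) <= 304 * Num.sqrt q%:R * l1 * tau.
Proof.
have q0 : (0 < q)%N by apply: leq_trans q16.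
have q1 : (1 < q)%N by apply: leq_trans q16.
have l10 : 0 < l1 by apply: lt_trans l1_gt1.
have l20 : 0 < l2 by apply: lt_trans l2_gt1.
have s0 : 0 <= Num.sqrt q%:R :> R by rewrite sqrtr_ge0.
have l2u := lnlnq_upper R q16.
have t0 : 0 <= ln P%:R / l1 by rewrite divr_ge0 // ltW.
have [l490|l490] := leqP 490 l; last first.
  (* Here log log q is at most 492, so the classical bound suffices: one block of length q and the
     trivial saving d = 1. *)
  exists 1.
    split=> //; rewrite expr1n; apply: le_trans loss_D.
    have lR : l%:R <= 490 :> R by rewrite ler_nat ltnW.
    have : 1 / 492 <= l2^-1 by rewrite mul1r lef_pV2 ?posrE //; lra.
    by move: (l2^-1) (ln P%:R / l1) t0 => x t *; lra.
  have block e t : phase_like e -> nrm (\sum_(n < q) e (t + n%:Z) * chi (t + n%:Z)) <= q%:R * 1.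
    move=> [e1 _]; rewrite mulr1; apply: le_trans (ler_nrm_sum _ _ _) _.
    apply: (@le_trans _ _ (\sum_(n < q) 1)); last by rewrite sumr_const card_ord.
    by apply: ler_sum => n _; rewrite nrmM mulr_ile1 ?nrm_ge0 // (dchar_le1 _ q0 (proj1 gd)).
  apply: le_trans (polya_vinogradov q1 gd q0 ler01 block X) _.
  have -> : 304 * Num.sqrt q%:R * l1 * 1 = 4 * Num.sqrt q%:R * (76 * l1) by ring.
  rewrite ler_wpM2l ?mulr_ge0 //; move: (ln q%:R) l1_gt1 => x x1; lra.
have [m [m0 mlel ml lm]] := exists_depth l490.
have pP p : prime p -> (p %| q)%N -> (p <= P)%N.
  by move=> pp pq; apply: max_pdiv_max; rewrite mem_primes pp q0.
have [N [N0 Nle block]] := block_length_exists m0 ml sq gd P0 pP.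
have L0 : (0 < L)%N by apply: trunc_log_max => //; apply: leq_trans q16.
have LR : 0 < L%:R :> R by rewrite ltr0n.
have mR : 0 < m%:R :> R by rewrite ltr0n.
have d0 : 0 <= L%:R^-1 :> R by rewrite invr_ge0 ltW.
have PV := polya_vinogradov q1 gd N0 d0 block X.
have Ll : (2 ^ l <= L)%N by apply: trunc_logP.
have mL : m%:R <= L%:R :> R.
  rewrite ler_nat; apply: leq_trans Ll; apply: ltnW; exact: leq_ltn_trans mlel (ltn_expl _ _).
have Lup := lnq_upper R q16; have Llow := lnq_lower R q16.
have lnN : ln N%:R <= 4 * (l1 / m%:R) + 1 + 3 * ln P%:R.
  apply: le_trans (_ : ln (2 ^ (2 * (L %/ m)).+1 * P ^ 3)%:R <= _).
    by rewrite ler_ln ?posrE ?ltr0n ?muln_gt0 ?expn_gt0 ?P0 // ler_nat.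
  rewrite natrM lnM ?posrE ?ltr0n ?expn_gt0 ?P0 //.
  rewrite lerD //; last by rewrite natrX lnXn ?ltr0n // -[_ *+ 3]mulr_natl.
  apply: le_trans (ln_le_pow2 R _ (leqnn _)) _; first by rewrite expn_gt0.
  rewrite -natr1 lerD2r natrM -[4]/((2 * 2)%:R) natrM -mulrA ler_pM2l //.
  apply: le_trans (_ : L%:R / m%:R <= _).
    by rewrite ler_pdivlMr // -natrM ler_nat leq_trunc_div.
  by rewrite mulrA ler_pM2r ?invr_gt0.
have dl : L%:R^-1 * l1 <= 2 by rewrite mulrC ler_pdivrMr.
have d1 : L%:R^-1 <= 1 :> R by rewrite invf_le1 // ler1n.
have ml1 : 1 <= 2 * (l1 / m%:R) by rewrite mulrA ler_pdivlMr // mul1r (le_trans mL).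
(* 304 = 4 * 76 with 76 = 4 + 2 * 36: the bound for log N contributes 4 l1 / m, and the constants 10
   + 1 + 9 + 16 = 36 are absorbed through 1 <= 2 l1 / m. *)
exists (m%:R^-1 + ln P%:R / l1); last first.
  apply: le_trans PV _.
  have -> : 304 * Num.sqrt q%:R * l1 * (m%:R^-1 + ln P%:R / l1)
     = 4 * Num.sqrt q%:R * (76 * (l1 / m%:R + ln P%:R)).
    by field; rewrite !gt_eqF.
  rewrite ler_wpM2l ?mulr_ge0 // -[8 * _ * _]mulrA.
  move: (ln N%:R) (L%:R^-1) (L%:R^-1 * l1) (l1 / m%:R) (ln P%:R) lnN dl d1 ml1 lnP0.
  by move=> n d dl' a p *; lra.
have i0 : 0 <= m%:R^-1 :> R by rewrite invr_ge0 ltW.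
split; first by rewrite addr_ge0.
apply: le_trans loss_D.
set a := m%:R^-1; set t := _ / _ in t0 *.
have t1 : t <= 1.
  rewrite ler_pdivrMr // mul1r ler_ln ?posrE ?ltr0n // ler_nat; exact: max_pdiv_leq.
have lR : 0 < l%:R :> R by rewrite ltr0n (leq_trans _ l490).
(* Since l < 640 m^2, m^(-4) is at most 640^2 / l^2; one factor l is given up and the other is
   compared with log log q. *)
have a4 : a ^+ 4 <= 2 * (640 * 640) * l2^-1.
  have le1 : l%:R * l%:R <= 640 * 640 * m%:R ^+ 4 :> R.
    have e : m%:R ^+ 4 = m%:R ^+ 2 * m%:R ^+ 2 :> R by rewrite -exprD.
    have -> : 640 * 640 * m%:R ^+ 4 = (640 * m%:R ^+ 2) * (640 * m%:R ^+ 2) :> R by rewrite e mulrACA.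
    have le : l%:R <= 640 * m%:R ^+ 2 :> R by rewrite -natrX -natrM ler_nat ltnW.
    by apply: ler_pM => //; exact: ltW.
  have le2 : l2 <= 2 * l%:R.
    have : 2 <= l%:R :> R by rewrite ler_nat (leq_trans _ l490).
    by move: (l%:R) l2u => x *; lra.
  rewrite ler_pdivlMr // /a exprVn mulrC ler_pdivrMr ?exprn_gt0 //.
  rewrite -mulrA; apply: le_trans le2 _; rewrite ler_pM2l //; apply: le_trans le1.
  by rewrite ler_peMr ?(ltW lR) // ler1n (leq_trans _ l490).
have t4 : t ^+ 4 <= t by rewrite exprS ler_piMr // exprn_ile1.
have conv : (a + t) ^+ 4 <= 8 * (a ^+ 4 + t ^+ 4).
  have sq2 (x y : R) : (x + y) ^+ 2 <= 2 * (x ^+ 2 + y ^+ 2).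
    by have := sqr_ge0 (x - y); rewrite !expr2; lra.
  have -> : (a + t) ^+ 4 = ((a + t) ^+ 2) ^+ 2 by rewrite -exprM.
  have -> : a ^+ 4 = (a ^+ 2) ^+ 2 by rewrite -exprM.
  have -> : t ^+ 4 = (t ^+ 2) ^+ 2 by rewrite -exprM.
  apply: le_trans (_ : (2 * (a ^+ 2 + t ^+ 2)) ^+ 2 <= _).
    rewrite lerXn2r ?nnegrE ?exprn_ge0 ?mulr_ge0 ?addr_ge0 //.
    by rewrite exprn_ge0.
    by rewrite exprn_ge0.
  have four (x y : R) : x <= 2 * y -> 2 ^+ 2 * x <= 8 * y by rewrite expr2; lra.
  by rewrite exprMn; apply: four; apply: sq2.
apply: le_trans conv _.
have fin (x y z w : R) : x <= 2 * (640 * 640) * z -> y <= w -> 0 <= w ->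
  8 * (x + y) <= 16 * (640 * 640) * (z + w) by lra.
exact: fin.
Qed.

End MainBound.

Unset Implicit Arguments.

Theorem mainTheorem2 (R : realType) :
  exists C : R, 0 < C /\
    forall (q : nat) (chi : int -> R[i]) (x : R),
      squarefree q -> (16 <= q)%N -> primitive_char q chi -> 1 <= x ->
      `| char_sum chi x | <=
        (C * Num.sqrt q%:R * ln q%:R *
         (ln (ln (ln q%:R)) ^+ 2 / ln (ln q%:R)
          + ln (ln (ln q%:R)) ^+ 2 * ln (max_pdiv q)%:R / ln q%:R)
           `^ (1 / 4%:R))%:C.
Proof.
exists (304 * loss R `^ (1 / 4%:R)); split.
  by rewrite mulr_gt0 // powR_gt0 // loss_gt0.
move=> q chi x sq q16 prim x1.
have q0 : (0 < q)%N by apply: leq_trans q16.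
have gd := primitive_good q0 sq prim.
have [tau [tau0 tauD] le] := char_sum_small q16 sq gd (Num.truncn x).
rewrite nrmE lecR /char_sum big_add1 big_mkord; apply: le_trans le _.
have l10 : 0 < ln q%:R :> R by apply: lt_trans (lnq_gt1 R q16).
have l20 : 0 < ln (ln q%:R) :> R by apply: lt_trans (lnlnq_gt1 R q16).
set D := _ + _ in tauD *.
have D0 : 0 <= D.
  have lnP : 0 <= ln (max_pdiv q)%:R :> R by rewrite ln_ge0 // ler1n max_pdiv_gt0.
  apply: addr_ge0; first by rewrite divr_ge0 ?sqr_ge0 // ltW.
  by rewrite divr_ge0 ?(ltW l10) // mulr_ge0 ?sqr_ge0.
have root : tau <= loss R `^ (1 / 4%:R) * D `^ (1 / 4%:R).
  by rewrite -powRM ?(ltW (loss_gt0 R)) //; apply: le_root4.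
have -> : 304 * loss R `^ (1 / 4%:R) * Num.sqrt q%:R * ln q%:R * D `^ (1 / 4%:R)
  = 304 * Num.sqrt q%:R * ln q%:R * (loss R `^ (1 / 4%:R) * D `^ (1 / 4%:R)) by ring.
by rewrite ler_wpM2l // !mulr_ge0 ?sqrtr_ge0 ?(ltW l10).
Qed.
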